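(* Let $\mathcal{A}:f=0$ be a nearly supersolvable line arrangement in the complex projective plane $\mathbb{P}^2$, with $d=|\mathcal{A}|$, and let $p$ be a nearly modular intersection point of $\mathcal{A}$, of multiplicity $m_p(\mathcal{A})$. Then the only possible cases are the following (splitting types being those of the bundle $E_{\mathcal{A}}=T\langle\mathcal{A}\rangle(-1)$). (1) $2m_p(\mathcal{A})<d$. Then $d=2m_p(\mathcal{A})+1$ is odd and $\mathcal{A}$ is free with exponents $(d_1,d_1)$ with $d_1=m_p(\mathcal{A})$, the generic splitting type is $(d_1,d_1)$ and there are no jumping lines. (2) $2m_p(\mathcal{A})=d$. Then $\mathcal{A}$ is nearly free with exponents $(d_1,d_1)$ with $d_1=m_p(\mathcal{A})$, the generic splitting type is $(d_1-1,d_1)$ and there are no jumping lines. (3) $2m_p(\mathcal{A})>d$. Then $\mathcal{A}$ is nearly free with exponents $(d_1,d_2)$ with $d_1=d-m_p(\mathcal{A})$, $d_2=m_p(\mathcal{A})$, and the generic splitting type is $(d_1,d_2-1)$. A line $L$ in $\mathbb{P}^2$ is a jumping line if and only if it passes through the jumping point $P(\mathcal{A})$ of the nearly free arrangement $\mathcal{A}$, and the corresponding splitting type is $(d_1-1,d_2)$. In particular, for a nearly supersolvable line arrangement the generic splitting type of $T\langle\mathcal{A}\rangle$ is determined by the combinatorics of $\mathcal{A}$.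
   Context: A line arrangement $\mathcal{A}:f=0$ of $d$ lines is a finite set of $d$ distinct lines in $\mathbb{P}^2=\mathbb{P}^2(\mathbb{C})$, where $f\in S=\mathbb{C}[x,y,z]$ is the product of $d$ linear forms defining the lines. An intersection point (or multiple point) of $\mathcal{A}$ is a point lying on at least two lines of $\mathcal{A}$; its multiplicity $m_p(\mathcal{A})$ is the number of lines of $\mathcal{A}$ through it; a double point has multiplicity $2$. The combinatorics of $\mathcal{A}$ is its intersection lattice. An intersection point $p$ is modular if for any other intersection point $q$ of $\mathcal{A}$ the line $\overline{pq}$ belongs to $\mathcal{A}$. $\mathcal{A}$ is supersolvable if it has a modular intersection point. An intersection point $p$ is nearly modular if: (i) for any intersection point $q\ne p$ of $\mathcal{A}$, with the exception of a unique double point $p'\neq p$ of $\mathcal{A}$, the line $\overline{pq}$ belongs to $\mathcal{A}$; (ii) the line $\overline{pp'}$ is not in $\mathcal{A}$ and contains only two multiple points of $\mathcal{A}$, namely $p$ and $p'$. $\mathcal{A}$ is nearly supersolvable if it is not supersolvable but has a nearly modular intersection point. $AR(f)\subset S^3$ is the graded $S$-module whose degree $m$ component consists of the triples $(a,b,c)\in S_m^3$ with $af_x+bf_y+cf_z=0$. $mdr(f)$ is the smallest $m\ge0$ with $AR(f)_m\neq0$; write $r=mdr(f)$. $\mathcal{A}$ is free if $AR(f)$ is a free graded $S$-module; its exponents are then $(r,d-1-r)$, and $AR(f)=S(-r)\oplus S(-(d-1-r))$. Let $\tau(\mathcal{A})=\sum_{k\ge2}n_k(k-1)^2$, where $n_k$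 is the number of intersection points of multiplicity $k$. $\mathcal{A}$ is nearly free if $\tau(\mathcal{A})=(d-1)^2-r(d-r-1)-1$; its exponents are then $(r,d-r)$. The jumping point: if $\mathcal{A}$ is nearly free and $\rho_1\in AR(f)_r$ is nonzero, then there is an exact sequence of graded $S$-modules $0\to S(-r)\to AR(f)\to I(r-d+1)\to0$, with first map sending $1$ to $\rho_1$, where $I\subset S$ is a saturated homogeneous ideal defining a single reduced point $P(\mathcal{A})\in\mathbb{P}^2$; when $2r<d$ this point is uniquely determined by $\mathcal{A}$ and is called the jumping point of $\mathcal{A}$. $T\langle\mathcal{A}\rangle$ is the sheaf of logarithmic vector fields along $\mathcal{A}$, normalized so that $E_{\mathcal{A}}=T\langle\mathcal{A}\rangle(-1)$ is the coherent sheaf on $\mathbb{P}^2$ associated with the graded module $AR(f)$; it is locally free of rank $2$. For a line $L\subset\mathbb{P}^2$, the splitting type of $E_{\mathcal{A}}$ along $L$ is the pair $(d_1^L,d_2^L)$, $d_1^L\le d_2^L$, with $E_{\mathcal{A}}|_L\simeq\mathcal{O}_L(-d_1^L)\oplus\mathcal{O}_L(-d_2^L)$. It is constant for a generic line, giving the generic splitting type; a jumping line is a line along which the splitting type differs from the generic one. *)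

(* Defs.v *)
(* C is R[i], for an arbitrary R : realType. *)
From HB Require Import structures.
From mathcomp Require Import all_boot all_order all_algebra.
From mathcomp Require Import reals.
From mathcomp Require Import complex.
From mathcomp Require Import mpoly.

Set Implicit Arguments.
Unset Strict Implicit.
Unset Printing Implicit Defensive.

Import Order.TTheory GRing.Theory Num.Theory.
Local Open Scope ring_scope.

Notation poly3 R := {mpoly R[i][3]}.

(* P^2 = P(C^3): points and (supports of) lines are the subspaces of C^3 of
   dimension 1 and 2, so that incidence is inclusion and the line through two
   distinct points p, q is the subspace p + q.  A line comes with a vector of
   coefficients of an equation, i.e. with homogeneous coordinates in the dual
   plane; two elements of [line R] are the same line of P^2 when they have the
   same [line_supp]. *)
Definition space3 (R : realType) := {vspace 'rV[R[i]]_3}.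

Definition point (R : realType) := {p : space3 R | \dim p == 1%N}.

Definition line (R : realType) := {a : 'rV[R[i]]_3 | a != 0}.

Definition line_supp (R : realType) (L : line R) : space3 R :=
  lker (linfun (mulmxr (val L)^T : 'rV[R[i]]_3 -> 'rV[R[i]]_1)).

Lemma dim_line_supp (R : realType) (L : line R) : \dim (line_supp L) = 2%N.
Proof.
set f := linfun (mulmxr (val L)^T : 'rV[R[i]]_3 -> 'rV[R[i]]_1).
have /= := limg_ker_dim f fullv; rewrite capfv dimvf /dim /= => dimf.
suff dim1 : \dim (limg f) = 1%N.
  by move: dimf; rewrite dim1 => /(@addIn 1 _ 2).
apply/eqP; rewrite eqn_leq lt0n dimv_eq0; apply/andP; split.
  by rewrite (leq_trans (dimvS (subvf _))) // dimvf.
apply: contra (valP L) => /eqP f0; apply/eqP/rowP => j; rewrite mxE.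
have := memv_img f (memvf (delta_mx 0 j)).
rewrite f0 memv0 lfunE /= => /eqP/rowP/(_ 0).
by rewrite -rowE !mxE.
Qed.

Definition line_form (R : realType) (L : line R) : poly3 R :=
  \sum_(j < 3) (val L) 0 j *: 'X_j.

Definition on_line (R : realType) (p : point R) (L : line R) : bool :=
  (val p <= line_supp L)%VS.

Record arrangement (R : realType) (d : nat) := Arrangement {
  aline : 'I_d -> line R;
  aline_distinct : injective (fun i => line_supp (aline i))
}.

Definition defpoly (R : realType) (d : nat) (A : arrangement R d) : poly3 R :=
  \prod_(i < d) line_form (aline A i).

Definition mult (R : realType) (d : nat) (A : arrangement R d) (p : point R)
    : nat :=
  #|[set i : 'I_d | on_line p (aline A i)]|.

Definition intersection_point (R : realType) (d : nat) (A : arrangement R d)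
    (p : point R) : bool :=
  (2 <= mult A p)%N.

Definition joined (R : realType) (d : nat) (A : arrangement R d)
    (p q : point R) : Prop :=
  exists i : 'I_d, line_supp (aline A i) = (val p + val q)%VS.

Definition modular (R : realType) (d : nat) (A : arrangement R d)
    (p : point R) : Prop :=
  intersection_point A p /\
  forall q : point R, intersection_point A q -> q != p -> joined A p q.

Definition supersolvable (R : realType) (d : nat) (A : arrangement R d)
    : Prop :=
  exists p : point R, modular A p.

Definition nearly_modular (R : realType) (d : nat) (A : arrangement R d)
    (p : point R) : Prop :=
  intersection_point A p /\
  exists p' : point R,
    [/\ mult A p' = 2%N /\ p' != p,
        forall q : point R, intersection_point A q -> q != p -> q != p' ->
          joined A p q,
        ~ joined A p p'
      & forall q : point R, intersection_point A q ->
          (val q <= val p + val p')%VS -> q = p \/ q = p'].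

Definition nearly_supersolvable (R : realType) (d : nat)
    (A : arrangement R d) : Prop :=
  ~ supersolvable A /\ exists p : point R, nearly_modular A p.

(* The intersection lattice, as the list of all intersections of lines of A
   (including C^3, for the empty family), ordered by inclusion. *)
Definition flats (R : realType) (d : nat) (A : arrangement R d)
    : seq (space3 R) :=
  [seq (\bigcap_(i in J) line_supp (aline A i))%VS | J : {set 'I_d}].

Definition same_combinatorics (R : realType) (d d' : nat)
    (A : arrangement R d) (A' : arrangement R d') : Prop :=
  exists phi : space3 R -> space3 R,
    [/\ {in flats A, forall X, phi X \in flats A'},
        {in flats A', forall Y, exists2 X, X \in flats A & phi X = Y}
      & {in flats A &, forall X Y, (phi X <= phi Y)%VS = (X <= Y)%VS}].

Definition intersection_points (R : realType) (d : nat) (A : arrangement R d)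
    : seq (point R) :=
  undup (pmap insub
    [seq (line_supp (aline A ij.1) :&: line_supp (aline A ij.2))%VS
    | ij <- enum {: 'I_d * 'I_d} & ij.1 != ij.2]).

Lemma mem_intersection_points (R : realType) (d : nat) (A : arrangement R d)
    (p : point R) :
  (p \in intersection_points A) = intersection_point A p.
Proof.
rewrite mem_undup mem_pmap_sub; apply/mapP/card_gt1P => /=.
  case=> -[i j]; rewrite mem_filter /= => /andP[neq_ij _] defp.
  by exists i, j; split=> //; rewrite inE /on_line [val p]defp ?capvSl ?capvSr.
case=> i [j]; rewrite !inE /on_line /= => -[le_pi le_pj neq_ij].
exists (i, j); first by rewrite mem_filter neq_ij mem_enum.
apply/eqP; rewrite eqEdim subv_cap le_pi le_pj /= (eqP (valP p)) leqNgt.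
apply/negP => gt1; case/negP: neq_ij; apply/eqP/(@aline_distinct R d A).
set U := line_supp _ in gt1 *; set V := line_supp _ in gt1 *.
have /eqP <- : (U :&: V == U)%VS by rewrite eqEdim capvSl dim_line_supp.
by apply/eqP; rewrite eqEdim capvSr dim_line_supp.
Qed.

Definition npoints (R : realType) (d : nat) (A : arrangement R d) (k : nat)
    : nat :=
  count (fun p => mult A p == k) (intersection_points A).

(* Multiplicities are at most d. *)
Definition tau (R : realType) (d : nat) (A : arrangement R d) : nat :=
  \sum_(2 <= k < d.+1) npoints A k * (k - 1) ^ 2.

(* [homogeneous k g] is g \in S_k, with S_k = 0 for k < 0. *)
Definition homogeneous (R : realType) (k : int) (g : poly3 R) : Prop :=
  match k with
  | Posz n => g \is n.-homog
  | Negz _ => g = 0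
  end.

Definition AR (R : realType) (f : poly3 R) (rho : 'rV[poly3 R]_3) : Prop :=
  \sum_(j < 3) rho 0 j * f^`M(j) = 0.

Definition ARdeg (R : realType) (f : poly3 R) (k : int)
    (rho : 'rV[poly3 R]_3) : Prop :=
  AR f rho /\ forall j, homogeneous k (rho 0 j).

Definition is_mdr (R : realType) (f : poly3 R) (r : nat) : Prop :=
  (exists2 rho, rho != 0 & ARdeg f r%:Z rho) /\
  forall m : nat, (m < r)%N -> forall rho, ARdeg f m%:Z rho -> rho = 0.

(* A graded module is graded free when it has a basis of homogeneous
   elements. *)
Definition is_free (R : realType) (d : nat) (A : arrangement R d) : Prop :=
  exists (n : nat) (e : 'I_n -> nat) (b : 'I_n -> 'rV[poly3 R]_3),
    (forall i, ARdeg (defpoly A) (e i)%:Z (b i)) /\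
    forall rho, AR (defpoly A) rho ->
      exists! c : 'rV[poly3 R]_n, rho = \sum_(i < n) c 0 i *: b i.

Definition free_with_exponents (R : realType) (d : nat) (A : arrangement R d)
    (d1 d2 : nat) : Prop :=
  [/\ is_free A, is_mdr (defpoly A) d1 & d2%:Z = d%:Z - 1 - d1%:Z].

Definition nearly_free (R : realType) (d : nat) (A : arrangement R d) : Prop :=
  exists2 r : nat, is_mdr (defpoly A) r &
    (tau A)%:Z = (d%:Z - 1) ^+ 2 - r%:Z * (d%:Z - r%:Z - 1) - 1.

Definition nearly_free_with_exponents (R : realType) (d : nat)
    (A : arrangement R d) (d1 d2 : nat) : Prop :=
  [/\ nearly_free A, is_mdr (defpoly A) d1 & d2%:Z = d%:Z - d1%:Z].

(* The saturated homogeneous ideal of the reduced point P: all polynomials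
   vanishing on the corresponding line of C^3. *)
Definition point_ideal (R : realType) (P : point R) (g : poly3 R) : Prop :=
  forall v : 'rV[R[i]]_3, v \in val P -> g.@[v 0] = 0.

(* Exactness of 0 -> S(-r) -> AR(f) -> I(r-d+1) -> 0, with 1 |-> rho1 and
   second map pi (whose values outside AR(f) are irrelevant); the first map is
   injective because rho1 <> 0. *)
Definition point_sequence (R : realType) (f : poly3 R) (d r : nat)
    (P : point R) (rho1 : 'rV[poly3 R]_3) (pi : 'rV[poly3 R]_3 -> poly3 R)
    : Prop :=
  [/\ forall c rho sigma, AR f rho -> AR f sigma ->
        pi (c *: rho + sigma) = c * pi rho + pi sigma,
      forall (k : int) rho, ARdeg f k rho ->
        homogeneous (k + r%:Z - d%:Z + 1) (pi rho),
      forall rho, AR f rho -> (pi rho = 0 <-> exists c, rho = c *: rho1)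
    & forall g, point_ideal P g <-> exists2 rho, AR f rho & pi rho = g].

Definition jumping_point (R : realType) (d : nat) (A : arrangement R d)
    (P : point R) : Prop :=
  exists (r : nat) (rho1 : 'rV[poly3 R]_3) (pi : 'rV[poly3 R]_3 -> poly3 R),
    [/\ is_mdr (defpoly A) r, ARdeg (defpoly A) r%:Z rho1, rho1 != 0
      & point_sequence (defpoly A) d r P rho1 pi].

(* A graded S-module, presented as a subquotient M/N of S^n: [gpiece k] is the
   component M_k, and [gnull] is membership in N, which is only ever used on
   homogeneous elements of M. *)
Record gmodule (R : realType) := GModule {
  grank : nat;
  gpiece : int -> 'rV[poly3 R]_grank -> Prop;
  gnull : 'rV[poly3 R]_grank -> Prop
}.

(* AR(f)(t) *)
Definition AR_gmodule (R : realType) (f : poly3 R) (t : int) : gmodule R :=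
  @GModule R 3 (fun k => ARdeg f (k + t)) (fun rho => rho = 0).

(* S(-a) (+) S(-b) *)
Definition split_gmodule (R : realType) (a b : int) : gmodule R :=
  @GModule R 2
    (fun k s =>
       homogeneous (k - a) (s 0 ord0) /\ homogeneous (k - b) (s 0 ord_max))
    (fun s => s = 0).

(* M / lM, with l an equation of L: the restriction to L of the sheaf M~ is
   the sheaf associated with M / lM. *)
Definition restrict_gmodule (R : realType) (L : line R) (M : gmodule R)
    : gmodule R :=
  @GModule R (grank M) (@gpiece R M)
    (fun x => exists (k : int) (y : 'rV[poly3 R]_(grank M)),
       gpiece k y /\ gnull (x - line_form L *: y)).

(* g(q) <> 0, for g homogeneous. *)
Definition nonvanishing (R : realType) (g : poly3 R) (q : point R) : Prop :=
  exists2 v : 'rV[R[i]]_3, v \in val q & g.@[v 0] != 0.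

(* The stalk of M~ at q is the homogeneous localization M_(q): its elements
   are the fractions x / g, represented by pairs (x, g), with x and g
   homogeneous of the same degree and g(q) <> 0. *)
Section Germs.
Variables (R : realType) (M : gmodule R).

Definition fraction := ('rV[poly3 R]_(grank M) * poly3 R)%type.

Definition germ (q : point R) (s : fraction) : Prop :=
  exists k : int, [/\ gpiece k s.1, homogeneous k s.2 & nonvanishing s.2 q].

Definition germ_eq (q : point R) (s t : fraction) : Prop :=
  exists (k : int) (h : poly3 R),
    [/\ homogeneous k h, nonvanishing h q
      & gnull (h *: (t.2 *: s.1 - s.2 *: t.1))].

Definition germ_add (s t : fraction) : fraction :=
  (t.2 *: s.1 + s.2 *: t.1, s.2 * t.2).

(* The action of the element a / e of the local ring at q. *)
Definition germ_scale (a e : poly3 R) (s : fraction) : fraction :=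
  (a *: s.1, e * s.2).

End Germs.

(* M~ and N~ are isomorphic as sheaves of modules on L: there is a family of
   isomorphisms of stalks at the points of L that maps sections to sections,
   i.e. the images of the germs of a fraction s at the points near q are the
   germs of a single fraction. *)
Definition sheaf_iso_on (R : realType) (L : line R) (M N : gmodule R) : Prop :=
  exists phi : point R -> fraction M -> fraction N,
  forall q : point R, on_line q L ->
    [/\ (forall s, germ q s -> germ q (phi q s)),
        (forall s t, germ q s -> germ q t ->
           (germ_eq q (phi q s) (phi q t) <-> germ_eq q s t)) /\
        (forall t, germ q t -> exists2 s, germ q s & germ_eq q (phi q s) t),
        (forall s t, germ q s -> germ q t ->
           germ_eq q (phi q (germ_add s t)) (germ_add (phi q s) (phi q t))),
        (forall (k : int) (a e : poly3 R) s,
           homogeneous k a -> homogeneous k e -> nonvanishing e q -> germ q s ->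
           germ_eq q (phi q (germ_scale a e s)) (germ_scale a e (phi q s)))
      & (forall s, germ q s ->
           exists (k : int) (h : poly3 R),
             [/\ homogeneous k h, nonvanishing h q
               & forall q' : point R, on_line q' L ->
                   nonvanishing (h * s.2 * (phi q s).2) q' ->
                   germ_eq q' (phi q' s) (phi q s)])].

(* (a, b) is the splitting type along L of the sheaf M~. *)
Definition splitting_type (R : realType) (M : gmodule R) (L : line R)
    (a b : int) : Prop :=
  a <= b /\
  sheaf_iso_on L (restrict_gmodule L M)
    (restrict_gmodule L (split_gmodule R a b)).

(* Generic: outside a curve of the dual projective plane. *)
Definition generic_splitting_type (R : realType) (M : gmodule R) (a b : int)
    : Prop :=
  exists (k : nat) (G : poly3 R),
    [/\ G \is k.-homog, G != 0
      & forall L : line R, G.@[(val L) 0] != 0 -> splitting_type M L a b].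

(* Stated negatively: the splitting type along L exists and is unique. *)
Definition jumping_line (R : realType) (M : gmodule R) (L : line R) : Prop :=
  exists a b : int, generic_splitting_type M a b /\ ~ splitting_type M L a b.

(* Graded modules whose sheaves are E_A = T<A>(-1) and T<A>. *)
Definition E_gmodule (R : realType) (d : nat) (A : arrangement R d)
    : gmodule R :=
  AR_gmodule (defpoly A) 0.

Definition T_gmodule (R : realType) (d : nat) (A : arrangement R d)
    : gmodule R :=
  AR_gmodule (defpoly A) 1.

(* Main.v *)
(* Let m lines of the arrangement pass through the nearly modular point p and
   n = d - m lines miss it, and let b1, b2 be the two lines through the exceptional
   double point p'.  Normalize the forms of the lines missing p by b(p) = 1: then
   b - c is proportional to the form of a line through p, for all pairs of such
   lines but {b1, b2}.  This allows one to construct, adding the lines one at a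
   time, a field tangent to all lines but b1 (or but b2) whose component transversal to
   the pencil at p is just the product of the lines through p, and to show that
   AR(f) is generated by g1, g2 of degree m and g3 of degree n, with the single relation
   b2 g1 - b1 g2 = al g3, where al has degree m + 1 - n and does not vanish at p'.
   Hence n <= m + 1.  If n = m + 1 then al is a constant and AR(f) is free on g1, g2;
   otherwise the minimal degree is n, AR(f) / S g3 is the ideal (b1, b2), and the
   jumping point is p'.  On a line L, the relation (b2, -b1, -al) is the cross
   product of two vectors of forms, the degrees of which give the splitting type.
   The Tjurina number is obtained by counting pairs of lines, and the lattice
   determines concurrency because its coatoms are the lines. *)

Require Import Defs.
From HB Require Import structures.
From mathcomp Require Import all_boot all_order all_algebra.
From mathcomp Require Import reals.
From mathcomp Require Import complex.
From mathcomp Require Import mpoly.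
From mathcomp Require Import boolp ring zify.

Set Implicit Arguments.
Unset Strict Implicit.
Unset Printing Implicit Defensive.

Import Order.TTheory GRing.Theory Num.Theory.
Local Open Scope ring_scope.

(** * Homogeneous components *)

(** The transversal component of a field is measured by its wedge with the Euler field. For a field
    of $AR(f)$ this wedge is divisible by the product of the lines through $p$, and it vanishes at
    $p'$ because the field is tangent to two lines there. The line $\overline{pp'}$ is not in the
    arrangement, so the product is nonzero at $p'$ and the quotient lies in the ideal $(b_1,b_2)$:
    this identifies the quotient of $AR(f)$ and also keeps [al] from vanishing at $p'$. A splitting
    type is an isomorphism of sheaves given stalk by stalk through fractions, so no matrix comes
    with it. Existence is proved with a global formula, pairing coefficient vectors with the two
    factors of the cross product. Uniqueness must recover polynomials from stalks: local numerators
    and denominators are compared at a point of the line where nothing vanishes, and a gluing lemma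
    over the algebraically closed field turns compatible fractions into forms, whose degrees then
    decide. *)

Section HomogeneousPart.
Variable F : numClosedFieldType.
Implicit Types (f g : {mpoly F[3]}) (k l : int) (m : 'X_{1..3}).

(* The degree is an integer so that shifts never truncate: [hom k f] with [k < 0]
   forces [f = 0]. *)
Definition hom k f : Prop := forall m, f@_m != 0 -> (mdeg m)%:Z = k.

Lemma homN0 k f m : hom k f -> (mdeg m)%:Z != k -> f@_m = 0.
Proof. by move=> hf; apply: contraNeq => /hf ->. Qed.

Lemma hom0 k : hom k 0.
Proof. by move=> m; rewrite mcoeff0 eqxx. Qed.

Lemma homD k f g : hom k f -> hom k g -> hom k (f + g).
Proof.
move=> hf hg m; rewrite mcoeffD; apply: contraNeq => hm.
by rewrite (homN0 hf) // (homN0 hg) // addr0.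
Qed.

Lemma homZ k c f : hom k f -> hom k (c *: f).
Proof.
move=> hf m; rewrite mcoeffZ; apply: contraNeq => hm.
by rewrite (homN0 hf) // mulr0.
Qed.

Lemma homN k f : hom k f -> hom k (- f).
Proof. by rewrite -scaleN1r; apply: homZ. Qed.

Lemma homB k f g : hom k f -> hom k g -> hom k (f - g).
Proof. by move=> hf hg; apply: homD => //; apply: homN. Qed.

Lemma hom_sum (I : Type) (r : seq I) (P : pred I) k (h : I -> {mpoly F[3]}) :
  (forall i, P i -> hom k (h i)) -> hom k (\sum_(i <- r | P i) h i).
Proof.
move=> hh; elim/big_rec: _ => [|i x Pi hx]; first exact: hom0.
by apply: homD => //; apply: hh.
Qed.

Lemma hom1 : hom 0 1.
Proof.
move=> m; rewrite mcoeff1; case: (eqVneq m 0%MM) => [->|]; last by rewrite eqxx.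
by rewrite mdeg0.
Qed.

Lemma homC c : hom 0 c%:MP.
Proof. by rewrite -[c%:MP]mulr1 mul_mpolyC; apply/homZ/hom1. Qed.

Lemma homX j : hom 1 'X_j.
Proof.
move=> m; rewrite mcoeffX; case: (_ =P m) => [<-|_]; last by rewrite eqxx.
by rewrite mdeg1.
Qed.

Definition homp k f : {mpoly F[3]} :=
  match k with Posz n => pihomog mdeg n f | Negz _ => 0 end.

Lemma mcoeff_homp k f m :
  (homp k f)@_m = if (mdeg m)%:Z == k then f@_m else 0.
Proof.
case: k => [n|n] /=; last by rewrite mcoeff0.
rewrite pihomogE raddf_sum /= eqz_nat.
under eq_bigr do rewrite mcoeffZ mcoeffX.
case: (boolP (m \in msupp f)) => [mf|mNf].
  rewrite big_mkcond (bigD1_seq m) ?msupp_uniq //= eqxx mulr1.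
  rewrite big1 ?addr0 // => i /negPf ni.
  by rewrite ni mulr0 if_same.
rewrite (memN_msupp_eq0 mNf) if_same big1_seq // => i /andP[_ i_f].
by case: (_ =P m) => [e|_]; rewrite ?mulr0 //; rewrite -e i_f in mNf.
Qed.

Lemma homp_hom k f : hom k (homp k f).
Proof. by move=> m; rewrite mcoeff_homp; case: ifP => [/eqP|_]; rewrite ?eqxx. Qed.

Lemma homp_id k f : hom k f -> homp k f = f.
Proof.
move=> hf; apply/mpolyP => m; rewrite mcoeff_homp; case: eqP => // /eqP.
by move=> /(homN0 hf).
Qed.

Lemma hompD k f g : homp k (f + g) = homp k f + homp k g.
Proof.
apply/mpolyP => m; rewrite mcoeffD !mcoeff_homp mcoeffD.
by case: eqP => //; rewrite addr0.
Qed.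

(** Lets the cofactors in an expansion be replaced by their homogeneous components of the right
    degree. *)
Lemma hompM k l f g : hom k f -> homp (k + l) (f * g) = f * homp l g.
Proof.
move=> hf; apply/mpolyP => m; rewrite mcoeff_homp !mcoeffM.
have degE (i j : 'X_{1..3}) : m = (i + j)%MM ->
    (mdeg i)%:Z + (mdeg j)%:Z = (mdeg m)%:Z.
  by move=> ->; rewrite mdegD PoszD.
case: eqP => [md|md].
  apply: eq_bigr => i /eqP /degE /= e; rewrite mcoeff_homp.
  case: (eqVneq f@_i.1 0) => [->|/hf h1]; first by rewrite !mul0r.
  suff -> : ((mdeg i.2)%:Z == l) by [].
  by apply/eqP; move: e; rewrite md h1 => /addrI.
rewrite big1 // => i /eqP /degE /= e; rewrite mcoeff_homp.
case: (eqVneq f@_i.1 0) => [->|/hf h1]; first by rewrite mul0r.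
case: eqP => [h2|]; last by rewrite mulr0.
by case: md; rewrite -e h1 h2.
Qed.

Lemma homM k l f g : hom k f -> hom l g -> hom (k + l) (f * g).
Proof. by move=> hf hg; rewrite -(homp_id hg) -(hompM _ _ hf); apply: homp_hom. Qed.

Lemma homX_exp k f n : hom k f -> hom (n%:Z * k) (f ^+ n).
Proof.
move=> hf; elim: n => [|n IH]; first by rewrite mul0r; apply: hom1.
by rewrite exprS intS mulrDl mul1r; apply: homM.
Qed.

Lemma hom_div k l f g : f != 0 -> hom k f -> hom l (f * g) -> hom (l - k) g.
Proof.
move=> f0 hf hfg; suff -> : g = homp (l - k) g by apply: homp_hom.
by apply: (mulfI f0); rewrite -(hompM _ _ hf) addrC subrK homp_id.
Qed.

Lemma hom_neg k f : k < 0 -> hom k f -> f = 0.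
Proof.
move=> k0 hf; apply/mpolyP => m; rewrite mcoeff0; apply: contraTeq k0 => /hf <-.
by rewrite -leNgt.
Qed.

Lemma hom0C f : hom 0 f -> f = (f@_0%MM)%:MP.
Proof.
move=> hf; apply/mpolyP => m; rewrite mcoeffC.
case: (eqVneq m 0%MM) => [->|m0]; first by rewrite mulr1.
by rewrite mulr0 (homN0 hf) // eqz_nat mdeg_eq0.
Qed.

Lemma hom_uniq k l f : f != 0 -> hom k f -> hom l f -> k = l.
Proof.
move=> f0 hk hl; have [m] : exists m, f@_m != 0.
  apply: contrapT => nE; case/eqP: f0; apply/mpolyP => m; rewrite mcoeff0.
  by apply: contrapT => /eqP h; apply: nE; exists m.
by move=> h; rewrite -(hk _ h) -(hl _ h).
Qed.

Lemma hom_dhomog (n : nat) f : f \is n.-homog <-> hom n f.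
Proof.
split=> [/dhomogP h m|h].
  by rewrite -mcoeff_msupp => /h ->.
by apply/dhomogP => m; rewrite mcoeff_msupp => /h [].
Qed.

Lemma hom_prod (I : Type) (r : seq I) (h : I -> {mpoly F[3]}) :
  (forall i, hom 1 (h i)) -> hom (size r) (\prod_(i <- r) h i).
Proof.
move=> hh; elim: r => [|i r IH]; first by rewrite big_nil; apply: hom1.
by rewrite big_cons /= intS; apply: homM.
Qed.

(** The absolute value is harmless: a negative [k] leaves [f] with empty support. *)
Lemma hom_eval k f (c : F) (v : 'I_3 -> F) : hom k f ->
  f.@[fun i => c * v i] = c ^+ absz k * f.@[v].
Proof.
move=> hf; rewrite !mevalE mulr_sumr; apply: eq_big_seq => m.
rewrite mcoeff_msupp => /hf <-; rewrite absz_nat mulrCA; congr (_ * _).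
rewrite mdegE -prodrXr -big_split /=; apply: eq_bigr => i _.
by rewrite exprMn.
Qed.

End HomogeneousPart.

(** * Polynomials that vanish at every point *)

Section Vanishing.
Variable F : numClosedFieldType.

Lemma poly_infinite_roots (p : {poly F}) : (forall x, p.[x] = 0) -> p = 0.
Proof.
move=> p0; apply/eqP; case: (eqVneq p 0) => // pN0.
(* In characteristic zero the first [size p] natural numbers are distinct, which is one root too
   many. *)
have := @max_poly_roots _ p [seq n%:R | n <- iota 0 (size p)] pN0.
rewrite size_map size_iota ltnn => H; suff: false by [].
apply: H; first by apply/allP => x _; apply/rootP/p0.
rewrite map_inj_uniq ?iota_uniq // => i j /eqP.
by rewrite eqr_nat => /eqP.
Qed.

(** [muni] isolates the last variable, so the point consists of the first [n] coordinates [v]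
    followed by [t]. *)
Lemma meval_muni n (p : {mpoly F[n.+1]}) (v : 'I_n -> F) (t : F) :
  (map_poly (meval v) (muni p)).[t] =
  p.@[fun i => if split (cast_ord (esym (addn1 n)) i) is inl j then v j else t].
Proof.
rewrite muniE mevalE raddf_sum horner_sum; apply: eq_bigr => m _.
rewrite /= -mul_polyC.
rewrite rmorphM /= map_polyC map_polyXn hornerM hornerC hornerXn.
rewrite /= mevalZ mevalX -mulrA; congr (_ * _).
rewrite big_ord_recr /=; congr (_ * _).
  apply: eq_bigr => i _; rewrite mnmE.
  case: splitP => [j /= e|j /= e]; last by move: (ltn_ord i); rewrite e ltnNge leq_addr.
  by congr (v _ ^+ _); apply: val_inj.
by case: splitP => // j /= e; move: (ltn_ord j); rewrite -e ltnn.
Qed.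

(** A monomial is recovered from its last exponent and the tuple of the others, so every coefficient
    of [p] is a coefficient of a coefficient of [muni p]. *)
Lemma muni_inj n (p : {mpoly F[n.+1]}) : muni p = 0 -> p = 0.
Proof.
move=> p0; apply/mpolyP => m; rewrite mcoeff0.
have := congr1 (fun q : {poly {mpoly F[n]}} => q`_(m ord_max)@_[multinom (m (widen_ord (leqnSn n) i)) | i < n]) p0.
rewrite coef0 mcoeff0 muniE coef_sum raddf_sum /= => <-.
have eqm (m' : 'X_{1..n.+1}) : m' ord_max = m ord_max ->
   [multinom (m' (widen_ord (leqnSn n) i)) | i < n] =
   [multinom (m (widen_ord (leqnSn n) i)) | i < n] -> m' = m.
  move=> h1 h2; apply/mnmP => i.
  case: (unliftP ord_max i) => [j ->|-> //].
  have := congr1 (fun x : 'X_{1..n} => x j) h2; rewrite /= !mnmE.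
  suff -> : widen_ord (leqnSn n) j = lift ord_max j by [].
  by apply: val_inj; rewrite /= /bump leqNgt ltn_ord.
under eq_bigr do rewrite coefZ coefXn mulr_natr mcoeffMn mcoeffZ mcoeffX.
case: (boolP (m \in msupp p)) => [mp|mNp].
  rewrite (bigD1_seq m) ?msupp_uniq //= !eqxx mulr1 mulr1n big1 ?addr0 // => m' m'm.
  case: eqP => [h2|_]; last by rewrite mulr0 mul0rn.
  case: eqP => [h1|_]; last by rewrite mulr0n.
  by case/eqP: m'm; apply: eqm.
rewrite (memN_msupp_eq0 mNp) big1_seq // => m' /andP[_ m'p].
case: eqP => [h2|_]; last by rewrite mulr0 mul0rn.
case: eqP => [h1|_]; last by rewrite mulr0n.
by move: mNp; rewrite -(eqm m') // m'p.
Qed.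

Lemma mpoly_vanish n (p : {mpoly F[n]}) : (forall v, p.@[v] = 0) -> p = 0.
Proof.
elim: n p => [|n IH] p p0.
  rewrite (nvar0_mpolyC p); have := p0 (fun _ => 0).
  by rewrite (nvar0_mpolyC p) mevalC mcoeffC eqxx mulr1 => ->.
apply: muni_inj; apply/polyP => i; rewrite coef0; apply: IH => v.
have /(congr1 (fun q : {poly F} => q`_i)) :
    map_poly (meval v) (muni p) = 0.
  by apply: poly_infinite_roots => t; rewrite meval_muni.
by rewrite coef_map coef0.
Qed.

End Vanishing.

(** * Cross products *)

Notation o0 := (@Ordinal 3 0 isT).
Notation o1 := (@Ordinal 3 1 isT).
Notation o2 := (@Ordinal 3 2 isT).

Section Vectors.
Variable K : comPzRingType.
Implicit Types a b c u v w : 'rV[K]_3.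

Lemma sum3E (V : nmodType) (f : 'I_3 -> V) :
  \sum_(j < 3) f j = f o0 + f o1 + f o2.
Proof.
rewrite !big_ord_recl big_ord0 addr0 addrA.
by congr (f _ + f _ + f _); apply: val_inj.
Qed.

Lemma row3P (T : Type) (a b : 'rV[T]_3) :
  a 0 o0 = b 0 o0 -> a 0 o1 = b 0 o1 -> a 0 o2 = b 0 o2 -> a = b.
Proof.
move=> h0 h1 h2; apply/rowP => -[[|[|[|//]]] i3].
- by rewrite (_ : Ordinal i3 = o0) //; apply: val_inj.
- by rewrite (_ : Ordinal i3 = o1) //; apply: val_inj.
- by rewrite (_ : Ordinal i3 = o2) //; apply: val_inj.
Qed.

Definition vec3 (T : Type) (x y z : T) : 'rV[T]_3 :=
  \row_j (if val j is 0%N then x else if val j is 1%N then y else z).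

Definition dot a b : K := \sum_(j < 3) a 0 j * b 0 j.

Definition cross a b : 'rV[K]_3 :=
  vec3 (a 0 o1 * b 0 o2 - a 0 o2 * b 0 o1)
       (a 0 o2 * b 0 o0 - a 0 o0 * b 0 o2)
       (a 0 o0 * b 0 o1 - a 0 o1 * b 0 o0).

Lemma dotE a b : dot a b = a 0 o0 * b 0 o0 + a 0 o1 * b 0 o1 + a 0 o2 * b 0 o2.
Proof. exact: sum3E. Qed.

Lemma dotC a b : dot a b = dot b a.
Proof. by rewrite !dotE; ring. Qed.

Lemma dotDl a b c : dot (a + b) c = dot a c + dot b c.
Proof. by rewrite !dotE !mxE; ring. Qed.

Lemma dotZl k a b : dot (k *: a) b = k * dot a b.
Proof. by rewrite !dotE !mxE; ring. Qed.

Lemma dotBl a b c : dot (a - b) c = dot a c - dot b c.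
Proof. by rewrite !dotE !mxE; ring. Qed.

Lemma dotDr a b c : dot a (b + c) = dot a b + dot a c.
Proof. by rewrite !dotE !mxE; ring. Qed.

Lemma dotZr k a b : dot a (k *: b) = k * dot a b.
Proof. by rewrite !dotE !mxE; ring. Qed.

Lemma dotBr a b c : dot a (b - c) = dot a b - dot a c.
Proof. by rewrite !dotE !mxE; ring. Qed.

Lemma dot0r a : dot a 0 = 0.
Proof. by rewrite !dotE !mxE; ring. Qed.

Lemma dot0l a : dot 0 a = 0.
Proof. by rewrite dotC dot0r. Qed.

Lemma dot_crossl a b : dot a (cross a b) = 0.
Proof. by rewrite !dotE !mxE /=; ring. Qed.

Lemma dot_crossr a b : dot b (cross a b) = 0.
Proof. by rewrite !dotE !mxE /=; ring. Qed.

Lemma crossC a b : cross a b = - cross b a.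
Proof. by apply: row3P; rewrite !mxE /=; ring. Qed.

Lemma crossvv a : cross a a = 0.
Proof. by apply: row3P; rewrite !mxE /=; ring. Qed.

Lemma crossZl k a b : cross (k *: a) b = k *: cross a b.
Proof. by apply: row3P; rewrite !mxE /=; ring. Qed.

Lemma crossZr k a b : cross a (k *: b) = k *: cross a b.
Proof. by apply: row3P; rewrite !mxE /=; ring. Qed.

Lemma crossBr a b c : cross a (b - c) = cross a b - cross a c.
Proof. by apply: row3P; rewrite !mxE /=; ring. Qed.

Lemma dot_cross_rot a b c : dot a (cross b c) = dot c (cross a b).
Proof. by rewrite !dotE !mxE /=; ring. Qed.

Lemma cross_cross a b c : cross a (cross b c) = dot a c *: b - dot a b *: c.
Proof. by apply: row3P; rewrite !mxE /= !dotE; ring. Qed.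

(* Cramer's rule *)
Lemma det_expand a b c u : dot c (cross a b) *: u =
  dot a u *: cross b c + dot b u *: cross c a + dot c u *: cross a b.
Proof. by apply: row3P; rewrite !mxE /= !dotE !mxE /=; ring. Qed.

End Vectors.

(** Stated over a ring because it is applied to rows of polynomials; the form [c] with value 1
    replaces the nonvanishing of [cross a b]. *)
Lemma cross_expand (K : comPzRingType) (a b c u : 'rV[K]_3) :
  dot c (cross a b) = 1 -> dot a u = 0 -> dot b u = 0 -> u = dot c u *: cross a b.
Proof.
by move=> c1 ha hb; have := det_expand a b c u; rewrite c1 ha hb !scale0r !add0r scale1r.
Qed.

Section VectorsField.
Variable F : fieldType.
Implicit Types a b c u v w : 'rV[F]_3.

Lemma dot_neq0 a : a != 0 -> exists v, dot a v = 1.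
Proof.
move=> a0; have [j aj] : exists j, a 0 j != 0.
  apply/existsP; apply: contraR a0 => /existsPn h.
  by apply/eqP/rowP => j; rewrite mxE; apply/eqP; rewrite -[_ == _]negbK h.
exists (\row_k ((k == j)%:R / a 0 j)).
rewrite /dot (bigD1 j) //= mxE eqxx mul1r mulfV // big1 ?addr0 // => k /negPf kj.
by rewrite mxE kj mul0r mulr0.
Qed.

Lemma cross_eq0 a b : a != 0 -> cross a b = 0 -> exists k, b = k *: a.
Proof.
move=> /dot_neq0[v av] ab; exists (dot b v).
have := cross_cross v a b; rewrite ab.
have -> : cross v 0 = 0 by apply: row3P; rewrite !mxE /=; ring.
by move/esym/subr0_eq; rewrite (dotC v b) (dotC v a) av scale1r.
Qed.

Lemma cross_prop a b k : b = k *: a -> cross a b = 0.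
Proof. by move=> ->; rewrite crossZr crossvv scaler0. Qed.

Lemma cross_trans a b c : b != 0 ->
  cross a b = 0 -> cross b c = 0 -> cross a c = 0.
Proof.
move=> b0 ab /(cross_eq0 b0)[l ->]; rewrite crossZr ab scaler0 //.
Qed.

(** A point of the line [a] is cut out on it by a second line, here with no scalar left over, by the
    formula for the double cross product. *)
Lemma pencil_basis a v : a != 0 -> v != 0 -> dot a v = 0 ->
  exists b, cross a b = v.
Proof.
move=> /dot_neq0[x ax] v0 av; exists (cross v x).
by rewrite cross_cross ax av scale1r scale0r subr0.
Qed.

Lemma dual_basis a b : cross a b != 0 -> exists c v w,
  [/\ dot c (cross a b) = 1, dot a v = 1 /\ dot b v = 0, dot a w = 0 /\ dot b w = 1,
      dot c v = 0 /\ dot c w = 0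
    & forall u, u = dot a u *: v + dot b u *: w + dot c u *: cross a b].
Proof.
move=> /dot_neq0[c]; rewrite dotC => c1; exists c, (cross b c), (cross c a).
split=> //.
- by rewrite dot_cross_rot c1 dot_crossl.
- by rewrite dot_crossr; split=> //; rewrite 2!dot_cross_rot c1.
- by rewrite dot_crossr dot_crossl.
- by move=> u; rewrite -det_expand c1 scale1r.
Qed.

Lemma pencil_expand a b c : cross a b != 0 -> dot c (cross a b) = 0 ->
  exists k l, c = k *: a + l *: b.
Proof.
move=> /dot_neq0[d]; rewrite dotC => d1 c0.
exists (dot c (cross b d)), (dot c (cross d a)).
apply/eqP; rewrite -subr_eq0; set e := _ - _.
have e0 u : dot e u = 0.
  rewrite -[u]scale1r -d1 det_expand !dotDr !dotZr /e !dotBl !dotDl !dotZl.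
  rewrite !dot_crossl !dot_crossr c0 !(dot_cross_rot a b d) d1.
  by rewrite (dot_cross_rot b d a) (dot_cross_rot a b d) d1; ring.
apply/negPn/negP => /dot_neq0[v]; rewrite e0 => /eqP.
by rewrite eq_sym oner_eq0.
Qed.

End VectorsField.

(** * Linear forms and derivations *)

Section LinearForms.
Variable F : numClosedFieldType.
Local Notation S := {mpoly F[3]}.
Implicit Types (a b p v w : 'rV[F]_3) (f g : S) (r : 'rV[S]_3).

(* Vector fields are rows [r] of polynomials: [cv a] is the constant field [a],
   and [pr a r] is the derivative of the linear form [lf a] along [r]. *)
Definition cv a : 'rV[S]_3 := map_mx (@mpolyC 3 F) a.

Definition euler : 'rV[S]_3 := \row_j 'X_j.

Definition pr a r : S := \sum_(j < 3) a 0 j *: r 0 j.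

Definition lf a : S := \sum_(j < 3) a 0 j *: 'X_j.

Definition ev f v : F := f.@[v 0].

Lemma pr_dot a r : pr a r = dot (cv a) r.
Proof. by apply: eq_bigr => j _; rewrite mxE mul_mpolyC. Qed.

Lemma lf_pr a : lf a = pr a euler.
Proof. by apply: eq_bigr => j _; rewrite mxE. Qed.

Lemma cvD a b : cv (a + b) = cv a + cv b.
Proof. exact: raddfD. Qed.

Lemma cvB a b : cv (a - b) = cv a - cv b.
Proof. exact: raddfB. Qed.

Lemma cvZ k a : cv (k *: a) = k%:MP *: cv a.
Proof. by apply/rowP => j; rewrite !mxE mpolyCM. Qed.

Lemma cv_cross a b : cv (cross a b) = cross (cv a) (cv b).
Proof. by apply: row3P; rewrite !mxE /= mpolyCB !mpolyCM. Qed.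

Lemma dot_cv a b : dot (cv a) (cv b) = (dot a b)%:MP.
Proof. by rewrite !dotE !mxE !mpolyCD !mpolyCM. Qed.

Lemma prDl a b r : pr (a + b) r = pr a r + pr b r.
Proof. by rewrite !pr_dot cvD dotDl. Qed.

Lemma prBl a b r : pr (a - b) r = pr a r - pr b r.
Proof. by rewrite !pr_dot cvB dotBl. Qed.

Lemma prZl k a r : pr (k *: a) r = k%:MP * pr a r.
Proof. by rewrite !pr_dot cvZ dotZl. Qed.

Lemma prDr a r s : pr a (r + s) = pr a r + pr a s.
Proof. by rewrite !pr_dot dotDr. Qed.

Lemma prBr a r s : pr a (r - s) = pr a r - pr a s.
Proof. by rewrite !pr_dot dotBr. Qed.

Lemma prZr a f r : pr a (f *: r) = f * pr a r.
Proof. by rewrite !pr_dot dotZr. Qed.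

Lemma pr_cv a b : pr a (cv b) = (dot a b)%:MP.
Proof. by rewrite pr_dot dot_cv. Qed.

Lemma lfD a b : lf (a + b) = lf a + lf b.
Proof. by rewrite !lf_pr prDl. Qed.

Lemma lfB a b : lf (a - b) = lf a - lf b.
Proof. by rewrite !lf_pr prBl. Qed.

Lemma lfZ k a : lf (k *: a) = k%:MP * lf a.
Proof. by rewrite !lf_pr prZl. Qed.

Lemma ev_lf a v : ev (lf a) v = dot a v.
Proof.
rewrite /ev raddf_sum; apply: eq_bigr => j _ /=.
by rewrite mevalZ mevalXU.
Qed.

Lemma evM f g v : ev (f * g) v = ev f v * ev g v.
Proof. exact: mevalM. Qed.

Lemma evD f g v : ev (f + g) v = ev f v + ev g v.
Proof. exact: mevalD. Qed.

Lemma evB f g v : ev (f - g) v = ev f v - ev g v.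
Proof. exact: mevalB. Qed.

Lemma evC c v : ev c%:MP v = c.
Proof. exact: mevalC. Qed.

Lemma ev_vanish f : (forall v, ev f v = 0) -> f = 0.
Proof.
move=> h; apply: mpoly_vanish => v; rewrite -(h (\row_j v j)).
by apply: meval_eq => j; rewrite mxE.
Qed.

Lemma evZ k f c v : hom k f -> ev f (c *: v) = c ^+ absz k * ev f v.
Proof.
move=> hf; rewrite /ev -(hom_eval _ _ hf).
by apply: meval_eq => j; rewrite mxE.
Qed.

Lemma lf_inj a : lf a = 0 -> a = 0.
Proof.
move=> h; apply/eqP/negPn/negP => /dot_neq0[v].
by rewrite -ev_lf h /ev meval0 => /eqP; rewrite eq_sym oner_eq0.
Qed.

Lemma lf_neq0 a : a != 0 -> lf a != 0.
Proof. by apply: contraNneq => /lf_inj ->. Qed.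

Lemma hom_lf a : hom 1 (lf a).
Proof. by apply: hom_sum => j _; apply/homZ/homX. Qed.

Lemma hom_pr k a r : (forall j, hom k (r 0 j)) -> hom k (pr a r).
Proof. by move=> h; apply: hom_sum => j _; apply/homZ/h. Qed.

Definition dv f g : Prop := exists q, g = f * q.

Lemma dv0 f : dv f 0.
Proof. by exists 0; rewrite mulr0. Qed.

Lemma dvv f : dv f f.
Proof. by exists 1; rewrite mulr1. Qed.

Lemma dvD f g h : dv f g -> dv f h -> dv f (g + h).
Proof. by move=> [q ->] [s ->]; exists (q + s); rewrite mulrDr. Qed.

Lemma dvN f g : dv f g -> dv f (- g).
Proof. by move=> [q ->]; exists (- q); rewrite mulrN. Qed.

Lemma dvB f g h : dv f g -> dv f h -> dv f (g - h).
Proof. by move=> hg hh; apply: dvD => //; apply: dvN. Qed.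

Lemma dvMl f g h : dv f g -> dv f (h * g).
Proof. by move=> [q ->]; exists (h * q); rewrite mulrCA. Qed.

Lemma dvMr f g h : dv f g -> dv f (g * h).
Proof. by rewrite mulrC; apply: dvMl. Qed.

Lemma dv_hom (k l : int) f g : f != 0 -> hom k f -> hom l g -> dv f g ->
  exists2 q, hom (l - k) q & g = f * q.
Proof.
by move=> f0 hf hg [q e]; exists q => //; apply: (hom_div f0 hf); rewrite -e.
Qed.

(* The linear projection onto the plane [a = 0] along [v], when [dot a v = 1]. *)
Definition ret a v f : S := f \mPo [tuple 'X_j - (v 0 j) *: lf a | j < 3].

Lemma ret_is_additive a v : additive (ret a v).
Proof. by move=> f g; rewrite /ret comp_mpolyB. Qed.

HB.instance Definition _ a v :=
  GRing.isAdditive.Build S S (ret a v) (ret_is_additive a v).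

Lemma retM a v f g : ret a v (f * g) = ret a v f * ret a v g.
Proof. exact: rmorphM. Qed.

Lemma retC a v c : ret a v c%:MP = c%:MP.
Proof. exact: comp_mpolyC. Qed.

Lemma retX a v j : ret a v 'X_j = 'X_j - (v 0 j) *: lf a.
Proof. by rewrite /ret comp_mpolyXU -tnth_nth tnth_mktuple. Qed.

Lemma ret_lf a v b : ret a v (lf b) = lf b - (dot b v)%:MP * lf a.
Proof.
rewrite {1}/lf raddf_sum /=.
under eq_bigr => j _ do rewrite -mul_mpolyC retM retC retX mulrBr mul_mpolyC.
rewrite big_split /= sumrN; congr (_ - _).
rewrite /dot raddf_sum mulr_suml; apply: eq_bigr => j _ /=.
by rewrite mul_mpolyC; do ?rewrite mul_mpolyC; rewrite scalerA.
Qed.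

Lemma ev_ret a v f x : ev (ret a v f) x = ev f (x - dot a x *: v).
Proof.
rewrite /ev /ret comp_mpoly_meval; apply: meval_eq => j.
rewrite tnth_mktuple mevalB mevalXU mevalZ [X in _ * X]ev_lf !mxE.
by rewrite mulrC.
Qed.

(** The congruence is compatible with sums and products, and for a variable it holds by
    construction. *)
Lemma ret_cong a v f : dv (lf a) (f - ret a v f).
Proof.
elim/mpolyind: f => [|c m f _ _ IH]; first by rewrite raddf0 subr0; apply: dv0.
rewrite raddfD /= opprD addrACA; apply: dvD => //.
rewrite -mul_mpolyC retM retC -mulrBr; apply: dvMl.
rewrite mpolyXE_id.
elim/big_rec: _ => [|i g _ IHg]; first by rewrite -[1]/(1%:MP) retC subrr; apply: dv0.
have dvX n : dv (lf a) ('X_i ^+ n - ret a v ('X_i ^+ n)).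
  elim: n => [|n IHn]; first by rewrite expr0 -[1]/(1%:MP) retC subrr; apply: dv0.
  rewrite exprS retM retX.
  have -> : 'X_i * 'X_i ^+ n - ('X_i - v 0 i *: lf a) * ret a v ('X_i ^+ n) =
    'X_i * ('X_i ^+ n - ret a v ('X_i ^+ n)) + lf a * ((v 0 i)%:MP * ret a v ('X_i ^+ n)).
    by rewrite -mul_mpolyC; ring.
  by apply: dvD; [apply: dvMl | apply/dvMr/dvv].
rewrite retM; set y := 'X_i ^+ _ in dvX *.
have -> : y * g - ret a v y * ret a v g =
  y * (g - ret a v g) + (y - ret a v y) * ret a v g by ring.
by apply: dvD; [apply: dvMl | apply: dvMr; apply: dvX].
Qed.

(** Divisibility by a linear form becomes the kernel of a ring morphism into a domain; primality of
    [lf a] follows. *)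
Lemma dv_ret a v f : dot a v = 1 -> dv (lf a) f <-> ret a v f = 0.
Proof.
move=> av; split=> [[q ->]|h]; last by have := ret_cong a v f; rewrite h subr0.
by rewrite retM ret_lf av mul1r subrr mul0r.
Qed.

Lemma lf_prime a f g : a != 0 -> dv (lf a) (f * g) -> dv (lf a) f \/ dv (lf a) g.
Proof.
move=> /dot_neq0[v av]; rewrite !(dv_ret _ av) retM => /eqP.
by rewrite mulf_eq0 => /orP[] /eqP ->; [left | right].
Qed.

Lemma lf_Ndv1 a : a != 0 -> ~ dv (lf a) 1.
Proof.
move=> /dot_neq0[v av]; rewrite (dv_ret _ av) -[1]/(1%:MP) retC => /eqP.
by rewrite mpolyC_eq0 oner_eq0.
Qed.

Lemma lf_dv a b : a != 0 -> dv (lf a) (lf b) -> cross a b = 0.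
Proof.
move=> /dot_neq0[v av]; rewrite (dv_ret _ av) ret_lf -lfZ -lfB => /lf_inj/subr0_eq ->.
by rewrite crossZr crossvv scaler0.
Qed.

Lemma ret_idem a v f : dot a v = 1 -> ret a v (ret a v f) = ret a v f.
Proof.
move=> av; apply/esym/subr0_eq; rewrite -raddfB.
by apply/(dv_ret _ av)/ret_cong.
Qed.

Lemma hom_ret k a v f : hom k f -> hom k (ret a v f).
Proof.
move=> hf; rewrite (mpolyE f) raddf_sum /= big_seq; apply: hom_sum => m.
rewrite mcoeff_msupp => /hf <-; rewrite -mul_mpolyC retM retC.
rewrite -[_%:Z]add0r; apply: homM; first exact: homC.
rewrite mpolyXE_id mdegE.
elim/big_rec2: _ => [|i n g _ IH]; first by rewrite -[1]/(1%:MP) retC; apply: homC.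
rewrite retM PoszD; apply: homM => //.
elim: (m i) => [|j IHj]; first by rewrite expr0 -[1]/(1%:MP) retC; apply: homC.
rewrite exprS intS retM; apply: homM => //.
by rewrite retX; apply: homB; [apply: homX | apply/homZ/hom_lf].
Qed.

(* The homogeneous ideal of the point [cross a b]. *)
Lemma ideal_ev a b f : cross a b != 0 ->
  (forall k, k != 0 -> ev f (k *: cross a b) = 0) ->
  exists A B, f = lf a * A + lf b * B.
Proof.
move=> ab; have [c [v [w [c1 [av bv] [aw bw] [cv cw] ex]]]] := dual_basis ab => f0.
(* Nothing is assumed about [f] at the origin. The factor [lf c], which vanishes there, supplies the
   missing case and is cancelled afterwards. *)
have fc0 : ret a v (ret b w (f * lf c)) = 0.
  apply: ev_vanish => x; rewrite !ev_ret.
  have -> : x - dot a x *: v - dot b (x - dot a x *: v) *: w = dot c x *: cross a b.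
    rewrite dotBr dotZr bv mulr0 subr0.
    by apply/eqP; rewrite 2!subr_eq {1}[x]ex -addrA addrC [X in X + _ == _]addrC.
  rewrite evM ev_lf dotZr c1 mulr1.
  by have [->|cx] := eqVneq (dot c x) 0; rewrite ?mulr0 // f0 // mul0r.
have h : ret a v (ret b w f) = 0.
  move/eqP: fc0; rewrite !retM [ret b w (lf c)]ret_lf cw mul0r subr0 ret_lf cv mul0r subr0.
  rewrite mulf_eq0 => /orP[/eqP //|/eqP/lf_inj c0].
  by move: c1; rewrite c0 dot0l => /eqP; rewrite eq_sym oner_eq0.
have [A hA] := ret_cong a v (ret b w f); have [B hB] := ret_cong b w f.
exists A, B.
by rewrite -(subrK (ret b w f) f) hB -[ret b w f]subr0 -h hA addrC.
Qed.

Lemma ideal_hom a b k f : cross a b != 0 -> hom k f -> ev f (cross a b) = 0 ->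
  exists A B, [/\ hom (k - 1) A, hom (k - 1) B & f = lf a * A + lf b * B].
Proof.
move=> ab hf f0; have [c _|A [B e]] := ideal_ev (f := f) ab.
  by rewrite (evZ _ _ hf) f0 mulr0.
exists (homp (k - 1) A), (homp (k - 1) B); split; try exact: homp_hom.
rewrite -(hompM _ _ (@hom_lf a)) -(hompM _ _ (@hom_lf b)) -hompD -e.
by rewrite addrC subrK homp_id.
Qed.

Lemma cross_neq0 a : a != 0 -> exists b, cross a b != 0.
Proof.
move=> a0; case: (eqVneq (cross a (vec3 1 0 0)) 0) => [e1|]; last by exists (vec3 1 0 0).
case: (eqVneq (cross a (vec3 0 1 0)) 0) => [e2|]; last by exists (vec3 0 1 0).
case/eqP: a0; apply: row3P; rewrite !mxE.
- by move/rowP/(_ o2): e2; rewrite !mxE /= => <-; ring.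
- by move/rowP/(_ o2): e1; rewrite !mxE /= => h; apply/eqP; rewrite -oppr_eq0 -h; apply/eqP; ring.
- by move/rowP/(_ o1): e1; rewrite !mxE /= => <-; ring.
Qed.

Lemma ev_Ndv a f : a != 0 -> ~ dv (lf a) f ->
  exists v, [/\ v != 0, dot a v = 0 & ev f v != 0].
Proof.
move=> a0 nf; have [v av] := dot_neq0 a0; have [b ab] := cross_neq0 a0.
(* The extra factor [lf b] keeps the point that will be found away from the origin. *)
have nfb : ret a v (f * lf b) <> 0.
  rewrite -(dv_ret _ av) => /(lf_prime a0)[//|/(lf_dv a0) h].
  by rewrite h eqxx in ab.
have [x] : exists x, ev (ret a v (f * lf b)) x != 0.
  apply: contrapT => h; apply/nfb/ev_vanish => x.
  by apply: contrapT => /eqP hx; apply: h; exists x.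
rewrite ev_ret evM mulf_eq0 negb_or ev_lf => /andP[fx bx].
exists (x - dot a x *: v); split=> //.
  by apply: contra_neq bx => ->; rewrite dot0r.
by rewrite dotBr dotZr av mulr1 subrr.
Qed.

End LinearForms.
Arguments euler {F}.

(** * Interpolation along the lines *)

Section Interpolation.
Variable F : numClosedFieldType.
Local Notation S := {mpoly F[3]}.
Implicit Types (a b g p x y : 'rV[F]_3) (s t : seq 'rV[F]_3) (f q W : S)
  (r : 'rV[S]_3).

Definition lfp s : S := \prod_(a <- s) lf a.

Lemma lfp_cons a s : lfp (a :: s) = lf a * lfp s.
Proof. exact: big_cons. Qed.

Lemma hom_lfp s : hom (size s) (lfp s).
Proof. by apply: hom_prod => a; apply: hom_lf. Qed.

Lemma lfp_neq0 s : (forall a, a \in s -> a != 0) -> lfp s != 0.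
Proof.
by move=> h; rewrite /lfp big_seq prodf_seq_neq0; apply/allP => a /h /lf_neq0 ->;
  rewrite implybT.
Qed.

Lemma lf_dvp b s q : b != 0 -> (forall a, a \in s -> a != 0 /\ cross b a != 0) ->
  dv (lf b) (lfp s * q) -> dv (lf b) q.
Proof.
move=> b0; elim: s => [|a s IH] h; first by rewrite /lfp big_nil mul1r.
rewrite lfp_cons -mulrA => /(lf_prime b0)[/(lf_dv b0) e|].
  by have [_] := h a (mem_head _ _); rewrite e eqxx.
by apply: IH => c cs; apply: h; rewrite in_cons cs orbT.
Qed.

Lemma lfp_dv_cancel s t q : (forall a, a \in s -> a != 0) ->
  (forall b, b \in t -> b != 0) ->
  (forall a b, a \in s -> b \in t -> cross b a != 0) ->
  dv (lfp s) (lfp t * q) -> dv (lfp s) q.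
Proof.
move=> s0; elim: t q => [|b t IH] q t0 st; first by rewrite /lfp big_nil mul1r.
rewrite lfp_cons -mulrA => -[q1 e1].
have b0 : b != 0 by apply/t0/mem_head.
have [q2 e2] : dv (lf b) q1.
  apply: (@lf_dvp b s) => //; last by rewrite -e1; apply/dvMr/dvv.
  by move=> a sa; split; [apply: s0 | apply: st => //; apply: mem_head].
apply: IH; first by move=> c ct; apply: t0; rewrite in_cons ct orbT.
  by move=> a c sa ct; apply: st => //; rewrite in_cons ct orbT.
by exists q2; apply: (mulfI (lf_neq0 b0)); rewrite e1 e2; ring.
Qed.

Definition parallels a s := [seq b <- s | cross a b == 0].

(** Linear forms that are not proportional are coprime, so divisibility can be checked one
    proportionality class at a time. Classes with several members do occur: restricted to a new
    line, all earlier lines through one of its points give proportional forms. *)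
Lemma lfp_dv_groups s W : (forall a, a \in s -> a != 0) ->
  (forall a, a \in s -> dv (lfp (parallels a s)) W) -> dv (lfp s) W.
Proof.
have [n] := ubnP (size s); elim: n s W => // n IH [|a0 s0] W sn s0N sW.
  by exists W; rewrite /lfp big_nil mul1r.
set s := a0 :: s0 in sn s0N sW *.
have a0s : a0 \in s by apply: mem_head.
have a00 := s0N _ a0s.
have [W1 e1] := sW _ a0s.
set t := [seq b <- s | cross a0 b != 0].
have ts : {subset t <= s} by apply: mem_subseq; apply: filter_subseq.
have -> : lfp s = lfp (parallels a0 s) * lfp t.
  rewrite /lfp !big_filter [LHS](bigID (fun b => cross a0 b == 0)) //=.
suff [q e2] : dv (lfp t) W1 by exists q; rewrite e1 e2 mulrA.
apply: IH.
- apply: leq_trans (_ : size t < size s)%N _; last by rewrite -ltnS.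
  by rewrite /t /s /= crossvv eqxx /= ltnS size_filter count_size.
- by move=> a /ts /s0N.
move=> a at_; have /sW := ts _ at_.
have par_t : parallels a t = parallels a s.
  rewrite /parallels /t -filter_predI; apply: eq_in_filter => b bs /=.
  case: eqP => //= ab; apply/negP => /eqP a0b.
  move: at_; rewrite mem_filter => /andP[/eqP + _]; apply.
  by apply: (cross_trans (s0N _ bs) a0b); rewrite crossC ab oppr0.
rewrite par_t e1; apply: lfp_dv_cancel.
- by move=> b; rewrite mem_filter => /andP[_ /s0N].
- by move=> b; rewrite mem_filter => /andP[_ /s0N].
move=> b c; rewrite !mem_filter => /andP[/eqP ab bs] /andP[/eqP a0c cs].
apply/negP => /eqP cb.
have a0b := cross_trans (s0N _ cs) a0c cb.
move: at_; rewrite mem_filter => /andP[/eqP + _]; apply.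
by apply: (cross_trans (s0N _ bs) a0b); rewrite crossC ab oppr0.
Qed.

Lemma lfp_dv_pairwise s W : uniq s -> (forall a, a \in s -> a != 0) ->
  (forall a b, a \in s -> b \in s -> cross a b = 0 -> a = b) ->
  (forall a, a \in s -> dv (lf a) W) -> dv (lfp s) W.
Proof.
move=> us s0 sp sW; apply: lfp_dv_groups => // a sa.
have -> : parallels a s = [:: a].
  rewrite -(filter_pred1_uniq us sa); apply: eq_in_filter => b sb /=.
  by apply/eqP/eqP => [/(sp _ _ sa sb) ->//|->]; rewrite crossvv.
by rewrite lfp_cons /lfp big_nil mulr1; apply: sW.
Qed.

Definition tang r a : Prop := dv (lf a) (pr a r).

(* The wedge product of [r] and the Euler field, in the coordinates [lf x], [lf y]:
   multiples of the Euler field are not seen. *)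
Definition delta x y r : S := lf x * pr y r - lf y * pr x r.

Lemma tangB r1 r2 a : tang r1 a -> tang r2 a -> tang (r1 - r2) a.
Proof. by rewrite /tang prBr; apply: dvB. Qed.

Lemma tangZ f r a : tang r a -> tang (f *: r) a.
Proof. by rewrite /tang prZr; apply: dvMl. Qed.

Lemma tang_euler a : tang euler a.
Proof. by rewrite /tang -lf_pr; apply: dvv. Qed.

(** [a] is a combination of [x] and [y], so up to a nonzero constant the wedge may be taken in a
    basis containing [a]; then each term has a factor [lf a] or [pr a r]. *)
Lemma delta_tang x y r a : cross x y != 0 -> dot a (cross x y) = 0 -> a != 0 ->
  tang r a -> dv (lf a) (delta x y r).
Proof.
move=> xy axy a0 [q]; have [k [l e]] := pencil_expand xy axy.
move=> ra; have lfa : lf a = k%:MP * lf x + l%:MP * lf y by rewrite e lfD !lfZ.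
have pra : pr a r = k%:MP * pr x r + l%:MP * pr y r by rewrite e prDl !prZl.
have [k0|k0] := eqVneq k 0.
  have l0 : l != 0.
    by apply: contra_neq a0 => l0; rewrite e k0 l0 !scale0r addr0.
  exists (l^-1%:MP * (lf x * q - pr x r)).
  have -> : delta x y r =
    l^-1%:MP * (lf x * (l%:MP * pr y r) - l%:MP * lf y * pr x r).
    rewrite /delta -!mulrA [lf x * (_ * _)]mulrCA -mulrBr mulrA -mpolyCM.
    by rewrite mulVf // mul1r.
  move: ra lfa; rewrite pra k0 mpolyC0 !mul0r !add0r => -> ->; ring.
exists (k^-1%:MP * (pr y r - lf y * q)).
have -> : delta x y r =
    k^-1%:MP * (k%:MP * lf x * pr y r - lf y * (k%:MP * pr x r)).
  rewrite /delta [lf y * (_ * _)]mulrCA -!mulrA -mulrBr mulrA -mpolyCM.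
  by rewrite mulVf // mul1r.
have -> : k%:MP * lf x = lf a - l%:MP * lf y by rewrite lfa addrK.
have -> : k%:MP * pr x r = lf a * q - l%:MP * pr y r by rewrite -ra pra addrK.
ring.
Qed.

(* One line is added at a time: restricted to the new line [b], the obstruction
   [pr b r] is divisible by the product of the equations of the previous lines,
   so that it can be killed by subtracting a multiple of that product times the
   constant field [p]. *)
Lemma interpolation_step x y (gs bs : seq 'rV[F]_3) b (r : 'rV[S]_3) (m : int) :
  let p := cross x y in p != 0 ->
  (forall g, g \in gs -> g != 0 /\ dot g p = 0) ->
  uniq (b :: bs) -> (forall c, c \in b :: bs -> dot c p = 1) ->
  (forall c, c \in bs -> exists2 g, g \in gs & exists k, c - b = k *: g) ->
  (forall j, hom m (r 0 j)) ->
  (forall g, g \in gs -> tang r g) -> (forall c, c \in bs -> tang r c) ->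
  exists r', [/\ forall j, hom m (r' 0 j), forall g, g \in gs -> tang r' g,
    forall c, c \in b :: bs -> tang r' c & delta x y r' = delta x y r].
Proof.
move=> p p0 gs0 /= /andP[bbs ubs] bsp hbs rm rgs rbs.
have bp : dot b p = 1 by apply/bsp/mem_head.
have cp c : c \in bs -> dot c p = 1 by move=> cs; apply: bsp; rewrite in_cons cs orbT.
have nz c : dot c p = 1 -> c != 0.
  by move=> h; apply: contra_eq_neq h => ->; rewrite dot0l eq_sym oner_eq0.
pose W := ret b p (pr b r).
pose ls := [seq c - b | c <- bs].
have ls0 a : a \in ls -> a != 0.
  move=> /mapP[c cs ->]; rewrite subr_eq0.
  by apply: contraNneq bbs => <-.
have retlf c : dot c p = 1 -> ret b p (lf c) = lf (c - b).
  by move=> h; rewrite ret_lf h mul1r lfB.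
have ret_lfp s : (forall c, c \in s -> dot c p = 1) ->
    ret b p (lfp s) = lfp [seq c - b | c <- s].
  elim: s => [|c s IH] h; first by rewrite /lfp !big_nil; exact: retC.
  rewrite /= !lfp_cons retM retlf ?h ?mem_head // IH // => d ds.
  by rewrite h // in_cons ds orbT.
have [e We] : dv (lfp ls) W.
  apply: lfp_dv_groups => // a /mapP[c0 c0s ->].
  have [g ggs [k0 ek0]] := hbs _ c0s.
  have [q eq] := rgs _ ggs.
  pose ks := [seq c <- bs | cross (c0 - b) (c - b) == 0].
  have ksP c : c \in ks -> exists k, c - b = k *: g.
    rewrite mem_filter => /andP[/eqP h _]; move: h.
    rewrite ek0 => /cross_eq0 h; case: h => [|k ->]; last by exists (k * k0); rewrite scalerA.
    by rewrite -ek0 ls0 //; apply: map_f.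
  have -> : parallels (c0 - b) ls = [seq c - b | c <- ks] by rewrite /parallels filter_map.
  (* [ks] are the earlier lines meeting [b] on the line [g]. Subtracting [q * lf b], which is zero
     on [b], cancels the contribution of [g] when [b] is written as [c - k *: g]; what remains is a
     multiple of [lf c] for each [c] in [ks]. *)
  have [q1 e1] : dv (lfp ks) (pr b r - q * lf b).
    apply: lfp_dv_pairwise.
    - exact: filter_uniq.
    - by move=> c; rewrite mem_filter => /andP[_ /cp/nz].
    - move=> c d; rewrite !mem_filter => /andP[_ cs] /andP[_ ds].
      move/(cross_eq0 (nz _ (cp _ cs))) => [k dk].
      by move: (cp _ ds); rewrite dk dotZl (cp _ cs) mulr1 => ->; rewrite scale1r.
    move=> c ck; have [k ek] := ksP _ ck.
    have cs : c \in bs by move: ck; rewrite mem_filter => /andP[].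
    have [q2 e2] := rbs _ cs.
    exists (q2 - q).
    have -> : b = c - k *: g by rewrite -ek opprB addrC subrK.
    by rewrite prBl lfB prZl lfZ e2 eq; ring.
  exists (ret b p q1); rewrite -ret_lfp; last first.
    by move=> c; rewrite mem_filter => /andP[_ /cp].
  rewrite -retM -e1 /W raddfB /= retM ret_lf bp mul1r subrr mulr0 subr0 //.
have lfls0 : lfp ls != 0 by apply: lfp_neq0.
have homW : hom m W by apply/hom_ret/hom_pr.
have home : hom (m - (size bs)%:Z) e.
  rewrite -(size_map (fun c => c - b) bs).
  by apply: (hom_div lfls0 (@hom_lfp ls)); rewrite -We.
(* [W] is fixed by the projection, hence so is its cofactor [e]; therefore [e * lfp bs] restricts on
   [b] to exactly [W]. *)
have rete : ret b p e = e.
  have WW : ret b p W = W by rewrite /W ret_idem.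
  apply: (mulfI lfls0); rewrite -We -WW We retM; congr (_ * _).
  by rewrite -ret_lfp ?ret_idem // => c /cp.
pose r' := r - (e * lfp bs) *: cv p.
have prr' c : pr c r' = pr c r - (dot c p)%:MP * (e * lfp bs).
  by rewrite /r' prBr prZr pr_cv [(dot c p)%:MP * _]mulrC.
have dx : dot x p = 0 by apply: dot_crossl.
have dy : dot y p = 0 by apply: dot_crossr.
exists r'; split.
- move=> j; rewrite /r' !mxE; apply: homB => //.
  rewrite -[m]addr0; apply: homM; last exact: homC.
  by rewrite -(subrK (size bs)%:Z m); apply: homM => //; apply: hom_lfp.
- move=> g ggs; rewrite /tang prr'; have [_ ->] := gs0 _ ggs.
  by rewrite mpolyC0 mul0r subr0; apply: rgs.
- move=> c; rewrite in_cons => /predU1P[->|cs]; rewrite /tang prr'.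
    rewrite bp mul1r; apply/(dv_ret _ bp); rewrite raddfB /= retM rete ret_lfp //.
    by rewrite -/W We mulrC subrr.
  apply: dvB; first exact: rbs.
  apply/dvMl/dvMl; rewrite /lfp (big_rem c) //=; apply/dvMr/dvv.
- by rewrite /delta !prr' dx dy mpolyC0 !mul0r !subr0.
Qed.

Lemma interpolation x y g gs bs : let p := cross x y in p != 0 ->
  (forall h, h \in g :: gs -> h != 0 /\ dot h p = 0) ->
  uniq bs -> (forall b, b \in bs -> dot b p = 1) ->
  (forall b c, b \in bs -> c \in bs -> b != c ->
     exists2 h, h \in g :: gs & exists k, c - b = k *: h) ->
  exists r, [/\ forall j, hom (size gs) (r 0 j),
    forall h, h \in g :: gs -> tang r h,
    forall b, b \in bs -> tang r b & delta x y r = lfp (g :: gs)].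
Proof.
move=> p p0 gs0; elim: bs => [_ _ _|b bs IH ubs bsp hbs].
  have [g0 gp] := gs0 _ (mem_head _ _).
  have [k [l eg]] := pencil_expand p0 gp.
  have [c [v [w [_ [xv yv] [xw yw] _ _]]]] := dual_basis p0.
  (* Base case: [u] is a constant field along the line [g], scaled so that its wedge with the Euler
     field is exactly [lf g]. Multiplying it by the other lines of the pencil makes it tangent to
     them. *)
  pose u := k *: w - l *: v.
  have xu : dot x u = - l by rewrite /u dotBr !dotZr xv xw; ring.
  have yu : dot y u = k by rewrite /u dotBr !dotZr yv yw; ring.
  exists (lfp gs *: cv u); split=> //.
  - by move=> j; rewrite !mxE -[(size gs)%:Z]addr0; apply: homM;
      [apply: hom_lfp | apply: homC].
  - move=> h; rewrite in_cons /tang prZr pr_cv => /predU1P[->|hgs].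
      have -> : dot g u = 0 by rewrite eg dotDl !dotZl xu yu; ring.
      by rewrite mulr0; apply: dv0.
    by apply: dvMr; rewrite /lfp (big_rem h) //=; apply/dvMr/dvv.
  rewrite /delta !prZr !pr_cv xu yu lfp_cons eg lfD !lfZ mpolyCN; ring.
have [|||r [rm rgs rbs dr]] := IH.
- by case/andP: ubs.
- by move=> c cs; apply: bsp; rewrite in_cons cs orbT.
- by move=> c d cs ds; apply: hbs; rewrite in_cons ?cs ?ds orbT.
have [|r' [r'm r'gs r'bs dr']] := interpolation_step p0 gs0 ubs bsp _ rm rgs rbs.
  move=> c cs; apply: hbs; rewrite ?mem_head ?in_cons ?cs ?orbT //.
  by case/andP: ubs => bbs _; apply: contraNneq bbs => ->.
by exists r'; split=> //; rewrite dr'.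
Qed.

End Interpolation.

(** * Generators and relations of AR(f) *)

Section Derivations.
Variable F : numClosedFieldType.
Local Notation S := {mpoly F[3]}.
Implicit Types (a b p x y : 'rV[F]_3) (s : seq 'rV[F]_3) (f g q : S)
  (r : 'rV[S]_3).

Definition homv (k : int) r : Prop := forall j, hom k (r 0 j).

Lemma homvB k r1 r2 : homv k r1 -> homv k r2 -> homv k (r1 - r2).
Proof. by move=> h1 h2 j; rewrite !mxE; apply: homB. Qed.

Lemma homvZ k l f r : hom k f -> homv l r -> homv (k + l) (f *: r).
Proof. by move=> h1 h2 j; rewrite !mxE; apply: homM. Qed.

Lemma homv_cv p : homv 0 (cv p).
Proof. by move=> j; rewrite mxE; apply: homC. Qed.

Lemma homv_euler : homv 1 euler.
Proof. by move=> j; rewrite mxE; apply: homX. Qed.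

Lemma homv_div k l f r : r != 0 -> homv k r -> homv l (f *: r) -> hom (l - k) f.
Proof.
move=> r0 rk fr; have [j rj] : exists j, r 0 j != 0.
  apply/existsP; apply: contraR r0 => /existsPn h.
  by apply/eqP/rowP => j; rewrite mxE; apply/eqP; rewrite -[_ == _]negbK h.
by apply: (hom_div rj (rk j)); have := fr j; rewrite mxE mulrC.
Qed.

Lemma homv_sub_euler k q r : homv k r -> hom (k - 1) q -> homv k (r - q *: euler).
Proof.
move=> hr hq; apply: homvB => //; rewrite -(subrK 1 k).
by apply: homvZ => //; apply: homv_euler.
Qed.

Lemma pr0 a : pr a 0 = 0.
Proof. by rewrite pr_dot dot0r. Qed.

Lemma expand_pr (a b c : 'rV[F]_3) (r : 'rV[S]_3) :
  dot c (cross a b) = 1 -> pr a r = 0 -> pr b r = 0 -> r = pr c r *: cv (cross a b).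
Proof.
move=> c1 ha hb; rewrite cv_cross pr_dot; apply: cross_expand.
- by rewrite -cv_cross dot_cv c1.
- by rewrite -pr_dot.
- by rewrite -pr_dot.
Qed.

Definition der r f : S := \sum_(j < 3) r 0 j * f^`M(j).

Lemma derDl r1 r2 f : der (r1 + r2) f = der r1 f + der r2 f.
Proof. by rewrite /der -big_split; apply: eq_bigr => j _; rewrite mxE mulrDl. Qed.

Lemma derZl g r f : der (g *: r) f = g * der r f.
Proof. by rewrite /der mulr_sumr; apply: eq_bigr => j _; rewrite mxE mulrA. Qed.

Lemma derBl r1 r2 f : der (r1 - r2) f = der r1 f - der r2 f.
Proof. by rewrite -[- r2]scaleN1r derDl derZl mulN1r. Qed.

Lemma derM r f g : der r (f * g) = der r f * g + f * der r g.
Proof.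
rewrite /der mulr_suml mulr_sumr -big_split; apply: eq_bigr => j _ /=.
by rewrite mderivM; ring.
Qed.

Lemma der1 r : der r 1 = 0.
Proof.
by rewrite /der big1 // => j _; rewrite -[1]/(1%:MP) mderivC mulr0.
Qed.

Lemma derC r c : der r c%:MP = 0.
Proof. by rewrite /der big1 // => j _; rewrite mderivC mulr0. Qed.

Lemma der_lf r a : der r (lf a) = pr a r.
Proof.
rewrite /der /pr; apply: eq_bigr => j _.
rewrite /lf raddf_sum (bigD1 j) //= big1 => [|i ij]; rewrite mderivZ mderivX mnm1E.
  have -> : (U_(j) - U_(j) = 0 :> 'X_{1..3})%MM by rewrite -{1}[U_(j)%MM]add0m addmK.
  by rewrite eqxx scale1r addr0 mpolyX0 -scalerAr mulr1.
by rewrite (negPf ij) scale0r scaler0.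
Qed.

Lemma der_lfp r s : (forall a, a \in s -> tang r a) -> dv (lfp s) (der r (lfp s)).
Proof.
elim: s => [|a s IH] h; first by rewrite /lfp big_nil der1; apply: dv0.
rewrite lfp_cons derM der_lf; have [q ->] := h a (mem_head _ _).
have [|q1 ->] := IH; first by move=> b bs; apply: h; rewrite in_cons bs orbT.
by exists (q + q1); ring.
Qed.

Lemma der_euler s : der euler (lfp s) = (size s)%:R%:MP * lfp s.
Proof.
elim: s => [|a s IH]; first by rewrite /lfp big_nil der1 mpolyC0 mul0r.
rewrite lfp_cons derM der_lf -lf_pr IH /= -[(size s).+1]addn1 natrD mpolyCD; ring.
Qed.

Lemma hom_der k l r f : homv k r -> hom l f -> hom (k + (l - 1)) (der r f).
Proof.
move=> hr hf; apply: hom_sum => j _; apply: homM => // m.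
rewrite mcoeff_deriv; apply: contraNeq => hm; rewrite (homN0 hf) ?mul0rn //.
apply: contraNneq hm => <-.
by rewrite mdegD mdeg1 addn1 intS [1 + _]addrC addrK.
Qed.

(** A tangent field multiplies [lfp s] by some polynomial and the Euler field multiplies it by its
    degree, which is invertible, so a multiple of the Euler field makes up the difference. *)
Lemma normalize s k r : s != [::] -> homv k r ->
  (forall a, a \in s -> a != 0 /\ tang r a) ->
  exists q, hom (k - 1) q /\ der (r - q *: euler) (lfp s) = 0.
Proof.
move=> s0 hr hs; have [|q e] := @der_lfp r s; first by move=> a /hs[].
have n0 : ((size s)%:R : F) != 0 by rewrite pnatr_eq0 size_eq0.
exists ((size s)%:R^-1%:MP * q); split.
  rewrite -[k - 1]add0r; apply: homM; first exact: homC.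
  have lf0 : lfp s != 0 by apply: lfp_neq0 => a /hs[].
  have := hom_der hr (@hom_lfp _ s); rewrite e => /(hom_div lf0 (@hom_lfp _ s)).
  by rewrite [(size s)%:Z - 1]addrC addrA addrK.
rewrite derBl derZl der_euler e mulrCA mulrA mulrA -mpolyCM mulfV //.
by rewrite mul1r mulrC subrr.
Qed.

(** By the product rule [lf a] divides [pr a r] times the product of the other forms, none of which
    is proportional to it. *)
Lemma der_tang s r a : (forall a, a \in s -> a != 0) -> uniq s ->
  (forall a b, a \in s -> b \in s -> cross a b = 0 -> a = b) ->
  der r (lfp s) = 0 -> a \in s -> tang r a.
Proof.
move=> s0 us sp; rewrite {1}/lfp => h sa; move: h.
rewrite (big_rem a) //= -/(lfp _) derM der_lf => /eqP; rewrite addr_eq0 => /eqP h.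
apply: (@lf_dvp _ a (rem a s)); first exact: s0.
  move=> b; rewrite mem_rem_uniq // => /andP[/eqP ba bs]; split; first exact: s0.
  by apply/eqP => /(sp _ _ sa bs) ab; apply: ba.
rewrite mulrC h; apply/dvN/dvMr/dvv.
Qed.

End Derivations.

Section Structure.
Variable F : numClosedFieldType.
Local Notation S := {mpoly F[3]}.
(** [gs] are the forms of the lines through [p], and [bs] the normalized forms of the others, led by
    the two through the exceptional double point. The form [b1 - b2] defines the line joining [p] to
    that point, so [b12_Njoined] excludes this line from the arrangement. *)
Variables (p b1 b2 : 'rV[F]_3) (gs bs0 : seq 'rV[F]_3).
Let bs := b1 :: b2 :: bs0.
Hypothesis p0 : p != 0.
Hypothesis gs_neq0 : gs != [::].
Hypothesis ugs : uniq gs.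
Hypothesis gsP : forall g, g \in gs -> g != 0 /\ dot g p = 0.
Hypothesis gs_par : forall g h, g \in gs -> h \in gs -> cross g h = 0 -> g = h.
Hypothesis ubs : uniq bs.
Hypothesis bsP : forall b, b \in bs -> dot b p = 1.
Hypothesis bs_joined : forall b c, b \in bs -> c \in bs -> b != c ->
  ~~ ((b == b1) && (c == b2)) -> ~~ ((b == b2) && (c == b1)) ->
  exists2 g, g \in gs & exists k, c - b = k *: g.
Hypothesis b12_Njoined : forall g, g \in gs -> cross (b1 - b2) g != 0.

Let s := gs ++ bs.
Let f : S := lfp s.
Let G : S := lfp gs.
Let m := size gs.
Let n := size bs.
Let P := cross b1 b2.

Let b1P : dot b1 p = 1. Proof. by apply/bsP/mem_head. Qed.
Let b2P : dot b2 p = 1. Proof. by apply/bsP; rewrite !inE eqxx orbT. Qed.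

Let bs_neq0 b : b \in bs -> b != 0.
Proof. by move/bsP; apply: contra_eq_neq => ->; rewrite dot0l eq_sym oner_eq0. Qed.

Let bs_par b c : b \in bs -> c \in bs -> cross b c = 0 -> b = c.
Proof.
move=> hb hc /(cross_eq0 (bs_neq0 hb)) [k e].
by move: (bsP hc); rewrite e dotZl bsP // mulr1 => ->; rewrite scale1r.
Qed.

Let s_neq0 a : a \in s -> a != 0.
Proof. by rewrite mem_cat => /orP[/gsP[]|/bs_neq0]. Qed.

Let Ngb g b : g \in gs -> b \in bs -> cross g b <> 0.
Proof.
move=> /gsP[g0 gp] /bsP bp /(cross_eq0 g0) [k e].
by move: bp; rewrite e dotZl gp mulr0 => /eqP; rewrite eq_sym oner_eq0.
Qed.

Let s_par a b : a \in s -> b \in s -> cross a b = 0 -> a = b.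
Proof.
rewrite !mem_cat => /orP[ha|ha] /orP[hb|hb]; first exact: gs_par.
- by move=> e; case: (Ngb ha hb e).
- by move=> e; case: (Ngb hb ha); rewrite crossC e oppr0.
exact: bs_par.
Qed.

Let us : uniq s.
Proof.
rewrite cat_uniq ugs ubs andbT; apply/hasPn => b bb; apply/negP => bg.
by apply: (Ngb bg bb); apply: crossvv.
Qed.

Let s_nil : s != [::].
Proof. by rewrite /s; case: (gs). Qed.

Let b12 : b1 != b2.
Proof. by move: ubs; rewrite /bs /= inE negb_or -andbA => /andP[]. Qed.

Let P0 : P != 0.
Proof.
apply: contraNneq b12 => /bs_par -> //; rewrite !inE eqxx ?orbT //.
Qed.

(** With [b1 - b2] as first coordinate of the pencil, both terms of the wedge visibly vanish at the
    exceptional point for fields tangent to [b1] and [b2]. *)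
Let xy : {y | cross (b1 - b2) y = p}.
Proof.
apply: cid; case: gs gsP b12_Njoined gs_neq0 => // g gs' hg hx _.
have [g0 gp] := hg _ (mem_head _ _); have xg := hx _ (mem_head _ _).
have [c [v [w [c1 [av bv] [aw bw] [cv cw] ex]]]] := dual_basis xg.
exists (dot c p *: g); rewrite crossZr [RHS]ex gp dotBl b1P b2P subrr !scale0r.
by rewrite !add0r.
Qed.

Let x := b1 - b2.
Let y := sval xy.
Let exy : cross x y = p. Proof. exact: (svalP xy). Qed.
Let xyN0 : cross x y != 0. Proof. by rewrite exy. Qed.

Local Notation dl := (delta x y).

Let dlB r1 r2 : dl (r1 - r2) = dl r1 - dl r2.
Proof. by rewrite /delta !prBr; ring. Qed.
Let dlD r1 r2 : dl (r1 + r2) = dl r1 + dl r2.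
Proof. by rewrite /delta !prDr; ring. Qed.
Let dlZ g r : dl (g *: r) = g * dl r.
Proof. by rewrite /delta !prZr; ring. Qed.
Let dl_euler : dl euler = 0.
Proof. by rewrite /delta -!lf_pr mulrC subrr. Qed.
Let dl_cv : dl (cv p) = 0.
Proof.
by rewrite /delta !pr_cv -exy dot_crossl dot_crossr mpolyC0 !mulr0 subrr.
Qed.

Let AR_tang r a : der r f = 0 -> a \in s -> tang r a.
Proof. exact: der_tang. Qed.

(** A line through both [P] and [p] is a multiple of [b1 - b2], hence not in [gs]. *)
Let ev_G k : k != 0 -> ev G (k *: P) != 0.
Proof.
move=> k0; rewrite /ev /G /lfp; rewrite rmorph_prod /= prodf_seq_neq0.
apply/allP => g gg; apply/implyP => _; rewrite -/(ev _ _) ev_lf dotZr mulf_neq0 //.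
apply/eqP => h; have [k1 [k2 e]] := pencil_expand P0 h.
have [_] := gsP gg; rewrite e dotDl !dotZl b1P b2P !mulr1 => /eqP.
rewrite addr_eq0 => /eqP ek.
have /eqP := b12_Njoined gg; apply; apply: (@cross_prop _ _ _ (- k2)).
by rewrite e ek scalerBr !scaleNr opprK.
Qed.

Let dl_ideal r k : der r f = 0 -> ev (dl r) (k *: P) = 0.
Proof.
move=> hr.
have [q1 e1] : tang r b1 by apply: AR_tang => //; rewrite mem_cat !inE eqxx !orbT.
have [q2 e2] : tang r b2 by apply: AR_tang => //; rewrite mem_cat !inE eqxx !orbT.
rewrite /delta prBl lfB e1 e2 evB !evM !evB !evM !ev_lf !dotZr.
by rewrite dot_crossl dot_crossr; ring.
Qed.

Let dl_dv r : der r f = 0 -> exists2 q, dl r = G * q &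
  exists c1 c2, q = lf b1 * c1 + lf b2 * c2.
Proof.
move=> hr; have [q e] : dv G (dl r).
  apply: lfp_dv_pairwise => //; first by move=> a /gsP[].
  move=> g gg; have [g0 gp] := gsP gg; apply: delta_tang => //; first by rewrite exy.
  by apply: AR_tang => //; rewrite mem_cat gg.
exists q => //; apply: (ideal_ev P0) => k k0.
have := dl_ideal k hr; rewrite e evM => /eqP; rewrite mulf_eq0.
by rewrite (negPf (ev_G k0)) => /eqP.
Qed.

(** The constant field [p] is tangent to the lines through [p]; the product of the other lines makes
    it tangent to those as well, and the wedge does not see it. *)
Let g3_spec : exists r, [/\ homv n r, der r f = 0, dl r = 0, r != 0 &
  exists q, r = lfp bs *: cv p - q *: euler].
Proof.
have hr : homv n (lfp bs *: cv p).
  by rewrite -[n%:Z]addr0; apply: homvZ; [apply: hom_lfp | apply: homv_cv].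
have [|q [hq eq]] := normalize s_nil hr.
  move=> a sa; split; first exact: s_neq0.
  move: sa; rewrite /tang prZr pr_cv mem_cat => /orP[/gsP[_ ->]|ab].
    by rewrite mpolyC0 mulr0; apply: dv0.
  by apply: dvMr; rewrite /lfp (big_rem a) //=; apply/dvMr/dvv.
exists (lfp bs *: cv p - q *: euler); split=> //; last by exists q.
- exact: homv_sub_euler.
- by rewrite dlB !dlZ dl_cv dl_euler !mulr0 subrr.
apply/negP => /eqP h.
have x0 : x != 0 by rewrite subr_eq0.
have := congr1 (pr x) h; rewrite prBr !prZr pr_cv -lf_pr -exy dot_crossl.
rewrite mpolyC0 mulr0 sub0r pr0 => /eqP; rewrite oppr_eq0 mulf_eq0 (negPf (lf_neq0 x0)) orbF => /eqP q0.
have := congr1 (pr b1) h; rewrite q0 scale0r subr0 prZr pr_cv b1P mpolyC1 mulr1 pr0.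
by apply/eqP/lfp_neq0.
Qed.

(** A field with zero wedge is, modulo the Euler field, a multiple of the constant field [p], and
    tangency to the lines off [p] makes [lfp bs] divide the factor. No multiple of the Euler field
    is left over, since a nonzero one does not annihilate [f]. *)
Let dl_ker g3 q3 r : g3 = lfp bs *: cv p - q3 *: euler -> der g3 f = 0 ->
  der r f = 0 -> dl r = 0 -> exists c, r = c *: g3.
Proof.
move=> e3 h3 hr hd.
have x0 : x != 0 by rewrite subr_eq0.
have [c ec] : dv (lf x) (pr x r).
  have : dv (lf x) (lf y * pr x r).
    by move/subr0_eq: hd => <-; apply/dvMr/dvv.
  by move/(lf_prime x0) => [/(lf_dv x0)|//] h; move: xyN0; rewrite h eqxx.
have ey : pr y r = lf y * c.
  by apply: (mulfI (lf_neq0 x0)); move/subr0_eq: hd => ->; rewrite ec; ring.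
pose r1 : 'rV[S]_3 := r - c *: euler.
have r1E := erefl r1; rewrite {2}/r1 in r1E; clearbody r1.
have [d [v [w [d1 _ _ _ _]]]] := dual_basis xyN0.
have px1 : pr x r1 = 0 by rewrite r1E prBr prZr -lf_pr ec mulrC subrr.
have py1 : pr y r1 = 0 by rewrite r1E prBr prZr -lf_pr ey mulrC subrr.
have er1 : r1 = pr d r1 *: cv p by rewrite -exy; apply: expand_pr.
have [t et] : dv (lfp bs) (pr d r1).
  apply: lfp_dv_pairwise => // b bb.
  have : tang r1 b.
    rewrite r1E; apply: tangB; last exact/tangZ/tang_euler.
    by apply: AR_tang => //; rewrite mem_cat bb orbT.
  by rewrite /tang {1}er1 prZr pr_cv bsP // mpolyC1 mulr1.
exists t.
have er : r = t *: g3 + (c + t * q3) *: euler.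
  rewrite e3 -[LHS](subrK (c *: euler)) -r1E er1 et.
  rewrite scalerBr !scalerA scalerDl [t * lfp bs]mulrC.
  by rewrite addrACA addNr addr0.
move: hr; rewrite er derDl !derZl h3 mulr0 add0r der_euler => /eqP.
have f0 : f != 0 by apply: lfp_neq0.
rewrite !mulf_eq0 (negPf f0) orbF => /orP[/eqP ->|]; first by rewrite scale0r addr0.
by rewrite mpolyC_eq0 pnatr_eq0 size_eq0 (negPf s_nil).
Qed.

(** The factor [lf b] restores tangency to the line left out of the interpolation, and raises the
    degree from [m - 1] to [m]. *)
Let generator b b' : b \in bs -> b' \in bs -> b != b' ->
  (forall c d, c \in rem b bs -> d \in rem b bs -> c != d ->
     exists2 g, g \in gs & exists k, d - c = k *: g) ->
  exists r, [/\ homv m r, der r f = 0 & dl r = G * lf b].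
Proof.
move=> bb b'b bb' join.
have : exists r, [/\ homv (m%:Z - 1) r, forall g, g \in gs -> tang r g,
    forall c, c \in rem b bs -> tang r c & dl r = G].
  rewrite /m /G; case: gs gs_neq0 gsP join => // g gs' _ hgs join.
  have := @interpolation _ x y g gs' (rem b bs); case=> //.
  - by rewrite exy.
  - exact: rem_uniq.
  - by move=> c; rewrite exy mem_rem_uniq // => /andP[_ /bsP].
  move=> r [h1 h2 h3 h4]; exists r; split=> //.
  by rewrite /= intS [1 + _]addrC addrK.
move=> [r [hr tg tb dr]].
have hr' : homv m (lf b *: r).
  by rewrite -(subrK 1 m%:Z) addrC; apply: homvZ => //; apply: hom_lf.
have [|q [hq eq]] := normalize s_nil hr'.
  move=> a sa; split; first exact: s_neq0.
  move: sa; rewrite mem_cat => /orP[/tg|ab]; first exact: tangZ.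
  have [->|ba] := eqVneq a b; first by rewrite /tang prZr; apply/dvMr/dvv.
  by apply/tangZ/tb; rewrite mem_rem_uniq // inE ba.
exists (lf b *: r - q *: euler); split=> //.
  exact: homv_sub_euler.
by rewrite dlB !dlZ dl_euler dr mulr0 subr0 mulrC.
Qed.

Lemma structure : exists (g1 g2 g3 : 'rV[S]_3) (al : S),
  [/\ [/\ homv m g1, homv m g2, homv n g3 & hom (m%:Z + 1 - n%:Z) al],
      [/\ der g1 f = 0, der g2 f = 0, der g3 f = 0 &
          lf b2 *: g1 - lf b1 *: g2 = al *: g3],
      forall r, der r f = 0 ->
        exists c1 c2 c3, r = c1 *: g1 + c2 *: g2 + c3 *: g3,
      forall c1 c2 c3, c1 *: g1 + c2 *: g2 + c3 *: g3 = 0 ->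
        exists e, [/\ c1 = e * lf b2, c2 = - (e * lf b1) & c3 = - (e * al)]
    & ev al (cross b1 b2) != 0].
Proof.
have b1b : b1 \in bs by apply: mem_head.
have b2b : b2 \in bs by rewrite !inE eqxx orbT.
have [g1 [m1 d1 e1]] : exists r, [/\ homv m r, der r f = 0 & dl r = G * lf b1].
  apply: (generator b1b b2b b12) => c d; rewrite !mem_rem_uniq // !inE.
  move=> /andP[/negPf cN cb] /andP[/negPf dN db] cd; apply: bs_joined => //.
  - by rewrite cN.
  - by rewrite dN andbF.
have [g2 [m2 d2 e2]] : exists r, [/\ homv m r, der r f = 0 & dl r = G * lf b2].
  have b21 : b2 != b1 by rewrite eq_sym.
  apply: (generator b2b b1b b21) => c d; rewrite !mem_rem_uniq // !inE.
  move=> /andP[/negPf cN cb] /andP[/negPf dN db] cd; apply: bs_joined => //.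
  - by rewrite dN andbF.
  - by rewrite cN.
have [g3 [m3 d3 e3 g30 [q3 eg3]]] := g3_spec.
have G0 : G != 0 by apply: lfp_neq0 => a /gsP[].
have f1 : lf b1 != 0 by apply/lf_neq0/bs_neq0.
have f2 : lf b2 != 0 by apply/lf_neq0/bs_neq0.
(* The wedges of the two terms are both [G * lf b1 * lf b2], so they cancel. *)
have [||al hal] := dl_ker (r := lf b2 *: g1 - lf b1 *: g2) eg3 d3.
- by rewrite derBl !derZl d1 d2; ring.
- by rewrite dlB !dlZ e1 e2; ring.
have al_hom : hom (m%:Z + 1 - n%:Z) al.
  apply: (homv_div g30 m3); rewrite -hal addrC.
  by apply: homvB; apply: homvZ => //; apply: hom_lf.
exists g1, g2, g3, al; split=> //.
- move=> r hr; have [q eq [c1 [c2 e]]] := dl_dv hr.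
  have [||c3 ec3] := dl_ker (r := r - (c1 *: g1 + c2 *: g2)) eg3 d3.
  + by rewrite derBl derDl !derZl d1 d2 hr; ring.
  + by rewrite dlB dlD !dlZ e1 e2 eq e; ring.
  by exists c1, c2, c3; rewrite -ec3 addrC subrK.
- move=> c1 c2 c3 h.
  have : dl (c1 *: g1 + c2 *: g2 + c3 *: g3) = 0 by rewrite h /delta !pr0 !mulr0 subrr.
  rewrite !dlD !dlZ e1 e2 e3 mulr0 addr0 => h1.
  have h2 : c1 * lf b1 = - c2 * lf b2.
    by apply: (mulfI G0); apply/eqP; rewrite -subr_eq0; apply/eqP; rewrite -h1; ring.
  have [e ee] : dv (lf b2) c1.
    have : dv (lf b2) (c1 * lf b1) by rewrite h2; apply/dvMl/dvv.
    move/(lf_prime (bs_neq0 b2b)) => [//|/(lf_dv (bs_neq0 b2b))].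
    by rewrite crossC => /eqP; rewrite oppr_eq0 (negPf P0).
  have ec2 : c2 = - (e * lf b1).
    apply: (mulfI f2); apply/eqP; rewrite -subr_eq0; apply/eqP.
    by move/eqP: h2; rewrite -subr_eq0 ee => /eqP <-; ring.
  exists e; split=> //; first by rewrite mulrC.
  have : (e * al + c3) *: g3 = 0.
    rewrite scalerDl -scalerA -hal -h ee ec2 scalerBr !scalerA [lf b2 * e]mulrC.
    by rewrite scaleNr.
  move/eqP; rewrite scalemx_eq0 (negPf g30) orbF addrC addr_eq0 => /eqP //.
(* If [al] were [lf b1 * A + lf b2 * B], the relation would make [lf b1] divide [g1 - B *: g3]. The
   quotient [sg] would annihilate [f] and have wedge [G], which is nonzero at [P]. *)
apply/negP => /eqP al0.
have [A [B [_ _ eAB]]] := ideal_hom P0 al_hom al0.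
have h4 : lf b2 *: (g1 - B *: g3) = lf b1 *: (g2 + A *: g3).
  apply/eqP; rewrite -subr_eq0 scalerBr scalerDr !scalerA opprD addrACA hal eAB.
  by rewrite scalerDl -opprD [X in _ - X]addrC subrr.
have [sg esg] : exists sg, g1 - B *: g3 = lf b1 *: sg.
  have h5 j : exists q, (g1 - B *: g3) 0 j = lf b1 * q.
    have : dv (lf b1) (lf b2 * (g1 - B *: g3) 0 j).
      move/rowP/(_ j): h4; rewrite mxE => ->; rewrite mxE; apply/dvMr/dvv.
    by move/(lf_prime (bs_neq0 b1b)) => [/(lf_dv (bs_neq0 b1b))/eqP|//]; rewrite (negPf P0).
  have [h hP] := choice h5; exists (\row_j h j).
  by apply/rowP => j; rewrite hP !mxE.
have dsg : der sg f = 0.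
  apply: (mulfI f1); rewrite mulr0 -derZl -esg derBl derZl d1 d3; ring.
have : dl sg = G.
  apply: (mulfI f1); rewrite -dlZ -esg dlB dlZ e1 e3; ring.
have := dl_ideal 1 dsg => h6 h7; move: h6; rewrite h7 => /eqP.
by rewrite (negPf (ev_G _)) // oner_eq0.
Qed.

End Structure.

(** * Sections over a line *)

Section Glue.
Variable F : numClosedFieldType.
Local Notation S := {mpoly F[3]}.
Implicit Types (a b v w : 'rV[F]_3) (f g : S).

Lemma horner_mmap (h : 'I_3 -> {poly F}) f t :
  (mmap (@polyC F) h f).[t] = f.@[fun j => (h j).[t]].
Proof.
rewrite mevalE /mmap horner_sum; apply: eq_bigr => m _.
rewrite hornerM hornerC; congr (_ * _).
by rewrite /mmap1 horner_prod; apply: eq_bigr => j _; rewrite horner_exp.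
Qed.

Lemma ev_pencil v w f : exists p : {poly F}, forall t, p.[t] = ev f (v + t *: w).
Proof.
exists (mmap (@polyC F) (fun j => (v 0 j)%:P + w 0 j *: 'X) f) => t.
rewrite horner_mmap; apply: meval_eq => j.
by rewrite hornerD hornerC hornerZ hornerX !mxE mulrC.
Qed.

Lemma poly_rootless_const (p : {poly F}) :
  (forall t, p.[t] != 0) -> exists2 c, c != 0 & forall t, p.[t] = c.
Proof.
move=> p0; have : size p == 1%N.
  by apply: contraT => /closed_rootP[t /rootP h]; move: (p0 t); rewrite h eqxx.
case/size_poly1P => c c0 e; exists c => // t; by rewrite e hornerC.
Qed.

(** On each of the two affine charts of the line a form without zeros is constant. Homogeneity
    relates the two constants by a factor [s ^+ n.+1] for every nonzero [s], which is absurd for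
    [s = 1] and [s = 2]. *)
Lemma line_zero a n f : a != 0 -> hom n.+1 f ->
  exists v, [/\ v != 0, dot a v = 0 & ev f v = 0].
Proof.
move=> a0 hf; apply: contrapT => nz.
have {}nz v : v != 0 -> dot a v = 0 -> ev f v != 0.
  by move=> v0 av; apply/negP => /eqP fv; apply: nz; exists v.
have [b ab] := cross_neq0 a0.
have [c [_ [w [c1 _ [aw bw] [_ cw] _]]]] := dual_basis ab.
set u := cross a b in c1.
have [au bu] : dot a u = 0 /\ dot b u = 0 by split; [apply: dot_crossl | apply: dot_crossr].
have nuw s t : s != 0 \/ t != 0 -> ev f (s *: u + t *: w) != 0.
  move=> st; apply: nz; last by rewrite dotDr !dotZr au aw; ring.
  apply/negP => /eqP h; move: (congr1 (dot c) h) (congr1 (dot b) h).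
  rewrite !dotDr !dotZr c1 cw bu bw !dot0r !mulr0 !mulr1 addr0 add0r => s0 t0.
  by case: st; rewrite ?s0 ?t0 eqxx.
have [p pE] := ev_pencil u w f; have [q qE] := ev_pencil w u f.
have [|c2 c20 pc] := @poly_rootless_const p.
  by move=> t; rewrite pE -[u]scale1r; apply: nuw; left; apply: oner_neq0.
have [|c3 c30 qc] := @poly_rootless_const q.
  by move=> t; rewrite qE addrC -[w]scale1r; apply: nuw; right; apply: oner_neq0.
have e s : s != 0 -> c3 = s ^+ n.+1 * c2.
  move=> s0; rewrite -(qc s) -(pc s^-1) qE pE -(evZ _ _ hf) scalerDr scalerA.
  by rewrite mulfV // scale1r addrC.
have two0 : (2%:R : F) != 0 by rewrite pnatr_eq0.
move: (e _ two0); rewrite (e _ (oner_neq0 F)) expr1n mul1r -natrX => h.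
have {h} : (2 ^ n.+1)%:R = 1 :> F by apply: (mulIf c20); rewrite -h mul1r.
move/eqP; rewrite -[1]/(1%:R) eqr_nat => /eqP h.
by move: (ltn_expl n.+1 (isT : (1 < 2)%N)); rewrite h.
Qed.

(** Induction on the degree of a denominator [G] for the whole family. At a zero of [G] on the line
    some [g t] is nonzero, so [Y] vanishes there too, and modulo [lf a] a common linear factor
    [lf b] is cancelled. *)
Lemma glue_step a (T : Type) (D : int) (y g : T -> S) n G Y : a != 0 ->
  (forall v, v != 0 -> dot a v = 0 -> exists t, ev (g t) v != 0) ->
  hom n%:Z G -> hom (n%:Z + D) Y -> ~ dv (lf a) G ->
  (forall t, dv (lf a) (Y * g t - y t * G)) ->
  exists2 P, hom D P & forall t, dv (lf a) (y t - P * g t).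
Proof.
move=> a0 cov; elim: n G Y => [|n IH] G Y hG hY nG h.
  rewrite add0r in hY; have eG := hom0C hG; set c := G@_0%MM in eG.
  have c0 : c != 0 by apply/negP => /eqP c0; apply: nG; rewrite eG c0 mpolyC0; apply: dv0.
  exists (c^-1%:MP * Y) => [|t]; first by rewrite -[D]add0r; apply: homM => //; apply: homC.
  have -> : y t - c^-1%:MP * Y * g t = - c^-1%:MP * (Y * g t - y t * G).
    have : c^-1%:MP * c%:MP = 1 :> S by rewrite -mpolyCM mulVf // mpolyC1.
    by rewrite eG => e; rewrite -{1}[y t]mul1r -e; ring.
  exact: dvMl.
have [v [v0 av Gv]] := line_zero a0 hG.
have [t gtv] := cov v v0 av.
have Yv : ev Y v = 0.
  have [q /(congr1 (fun h : S => ev h v))] := h t; rewrite evB !evM ev_lf av Gv mul0r mulr0 subr0.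
  by move/eqP; rewrite mulf_eq0 (negPf gtv) orbF => /eqP.
have [b ab] := pencil_basis a0 v0 av.
have ab0 : cross a b != 0 by rewrite ab.
rewrite -ab in Gv Yv.
have [A [B [hA hB eG]]] := ideal_hom ab0 hG Gv.
have [A' [B' [hA' hB' eY]]] := ideal_hom ab0 hY Yv.
apply: (IH B B').
- by rewrite (_ : n%:Z = n.+1%:Z - 1) //; lia.
- by rewrite (_ : n%:Z + D = n.+1%:Z + D - 1) //; lia.
- by case=> q e; apply: nG; rewrite eG e; exists (A + lf b * q); ring.
move=> t'; have : dv (lf a) (lf b * (B' * g t' - y t' * B)).
  have -> : lf b * (B' * g t' - y t' * B) =
    (Y * g t' - y t' * G) - lf a * (A' * g t' - y t' * A) by rewrite eG eY; ring.
  by apply: dvB => //; apply/dvMr/dvv.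
by move/(lf_prime a0) => [/(lf_dv a0)/eqP|//]; rewrite (negPf ab0).
Qed.

(* A section over the line [a = 0] of a twist of the structure sheaf is the
   restriction of a homogeneous polynomial. *)
Lemma glue a (T : Type) (k : T -> int) (D : int) (y g : T -> S) : a != 0 ->
  (forall t, hom (k t) (g t)) -> (forall t, hom (k t + D) (y t)) ->
  (forall v, v != 0 -> dot a v = 0 -> exists t, ev (g t) v != 0) ->
  (forall t t', dv (lf a) (y t * g t' - y t' * g t)) ->
  exists2 P, hom D P & forall t, dv (lf a) (y t - P * g t).
Proof.
move=> a0 hg hy cov coh.
have [b ab] := cross_neq0 a0.
have [t gt] := cov _ ab (dot_crossl a b).
have nG : ~ dv (lf a) (g t).
  by case=> q e; move: gt; rewrite e evM ev_lf dot_crossl mul0r eqxx.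
have g0 : g t != 0 by apply/negP => /eqP e; apply: nG; rewrite e; apply: dv0.
case: (k t) (hg t) (hy t) => n hgn hyn; last by rewrite (hom_neg _ hgn) ?eqxx in g0.
exact: (glue_step a0 cov hgn hyn nG (fun t' => coh t t')).
Qed.

End Glue.

(** * Restriction of a presentation to a line *)

Section Presentation.
Variable F : numClosedFieldType.
Local Notation S := {mpoly F[3]}.
Implicit Types (c d rho : 'rV[S]_3).

Definition lin (g : 'I_3 -> 'rV[S]_3) c : 'rV[S]_3 := \sum_(j < 3) c 0 j *: g j.

Definition homs (e : 'I_3 -> int) (k : int) c : Prop :=
  forall j, hom (k - e j) (c 0 j).

Lemma linD g c d : lin g (c + d) = lin g c + lin g d.
Proof. by rewrite /lin -big_split; apply: eq_bigr => j _; rewrite mxE scalerDl. Qed.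

Lemma linZ g h c : lin g (h *: c) = h *: lin g c.
Proof. by rewrite /lin scaler_sumr; apply: eq_bigr => j _; rewrite mxE scalerA. Qed.

Lemma linB g c d : lin g (c - d) = lin g c - lin g d.
Proof. by rewrite linD -scaleN1r linZ scaleN1r. Qed.

Lemma lin_fracB g h u s c d : lin g (h *: (u *: c - s *: d)) =
  h *: (u *: lin g c - s *: lin g d).
Proof. by rewrite linZ linB !linZ. Qed.

Lemma lin_fracD g u s c d : lin g (u *: c + s *: d) = u *: lin g c + s *: lin g d.
Proof. by rewrite linD !linZ. Qed.

Lemma lin0 g : lin g 0 = 0.
Proof. by rewrite /lin big1 // => j _; rewrite mxE scale0r. Qed.

Lemma lin_hom g e k c : (forall j, homv (e j) (g j)) -> homs e k c -> homv k (lin g c).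
Proof.
move=> hg hc i; rewrite summxE; apply: hom_sum => j _; rewrite mxE.
by rewrite -(subrK (e j) k); apply: homM; [apply: hc | apply: hg].
Qed.

Lemma lin_der g c f : (forall j, der (g j) f = 0) -> der (lin g c) f = 0.
Proof.
move=> hg; rewrite /lin sum3E !derDl !derZl !hg; ring.
Qed.

Lemma homsD e k c d : homs e k c -> homs e k d -> homs e k (c + d).
Proof. by move=> hc hd j; rewrite mxE; apply: homD. Qed.

Lemma homsB e k c d : homs e k c -> homs e k d -> homs e k (c - d).
Proof. by move=> hc hd j; rewrite !mxE; apply: homB. Qed.

Lemma homsZ e k l h c : hom k h -> homs e l c -> homs e (k + l) (h *: c).
Proof. by move=> hh hc j; rewrite mxE -addrA; apply: homM. Qed.

(* AR(f) is given by three generators [g j] of degrees [e j] and one relation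
   [r] of degree [w]; modulo [l = lf a], the relation is the cross product of
   two vectors [q1], [q2], whose entries have degrees [e j - a1], [e j - a2]. *)
Record presentation (f : S) (a : 'rV[F]_3) (g : 'I_3 -> 'rV[S]_3) (e : 'I_3 -> int)
    (r q1 q2 : 'rV[S]_3) (a1 a2 : int) : Prop := Presentation {
  pres_neq0 : a != 0;
  pres_hom : forall j, homv (e j) (g j);
  pres_der : forall j, der (g j) f = 0;
  pres_gen : forall k rho, homv k rho -> der rho f = 0 ->
    exists2 c, homs e k c & rho = lin g c;
  pres_rel : lin g r = 0;
  pres_rels : forall c, lin g c = 0 -> exists h, c = h *: r;
  pres_homr : homs e (e o0 + e o1 + e o2 - a1 - a2) r;
  pres_hom1 : forall j, hom (e j - a1) (q1 0 j);
  pres_hom2 : forall j, hom (e j - a2) (q2 0 j);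
  pres_cross : forall j, dv (lf a) (cross q1 q2 0 j - r 0 j);
  pres_zero : forall v, v != 0 -> dot a v = 0 -> exists j, ev (r 0 j) v != 0
}.

Lemma hom_dot (k l : int) e c (q : 'rV[S]_3) : homs e k c -> (forall j, hom (e j - l) (q 0 j)) ->
  hom (k - l) (dot c q).
Proof.
move=> hc hq; apply: hom_sum => j _.
have -> : k - l = (k - e j) + (e j - l) by rewrite addrA subrK.
exact: homM.
Qed.

Lemma dv_dot h c d : (forall j, dv h (c 0 j)) -> dv h (dot c d).
Proof. by move=> hc; rewrite dotE; do 2?apply: dvD; apply/dvMr/hc. Qed.

Lemma dot_self_cross1 (K : comPzRingType) (u v : 'rV[K]_3) r :
  dot r u = - dot (cross u v - r) u.
Proof. by rewrite dotBl [dot (cross _ _) _]dotC dot_crossl sub0r opprK. Qed.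

Lemma dot_self_cross2 (K : comPzRingType) (u v : 'rV[K]_3) r :
  dot r v = - dot (cross u v - r) v.
Proof. by rewrite dotBl [dot (cross _ _) _]dotC dot_crossr sub0r opprK. Qed.

Section Consequences.
Variables (f : S) (a : 'rV[F]_3) (g : 'I_3 -> 'rV[S]_3) (e : 'I_3 -> int).
Variables (r q1 q2 : 'rV[S]_3) (a1 a2 : int).
Hypothesis H : presentation f a g e r q1 q2 a1 a2.
Let w := e o0 + e o1 + e o2 - a1 - a2.

Let subE (V : zmodType) (u v : 'rV[V]_3) j : (u - v) 0 j = u 0 j - v 0 j.
Proof. by rewrite !mxE. Qed.

Let dv_r1 : dv (lf a) (dot r q1).
Proof.
rewrite (dot_self_cross1 q1 q2); apply/dvN/dv_dot => j.
by rewrite subE; apply: (pres_cross H).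
Qed.

Let dv_r2 : dv (lf a) (dot r q2).
Proof.
rewrite (dot_self_cross2 q1 q2); apply/dvN/dv_dot => j.
by rewrite subE; apply: (pres_cross H).
Qed.

(** Modulo [lf a] such a [c] is a multiple of [r], which is orthogonal to [q1] and [q2] as their
    cross product. *)
Lemma pres_null_dot c y k : der y f = 0 -> homv k y -> lin g c = lf a *: y ->
  dv (lf a) (dot c q1) /\ dv (lf a) (dot c q2).
Proof.
move=> dy hy; have [c' _ ->] := pres_gen H hy dy.
move/eqP; rewrite -subr_eq0 -linZ -linB => /eqP /(pres_rels H) [h eh].
have -> : c = lf a *: c' + h *: r by rewrite -eh addrC subrK.
rewrite !dotDl !dotZl; split; apply: dvD; try exact: dvMl.
- exact/dvMr/dvv.
- exact/dvMr/dvv.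
Qed.

Let cross_coord (K : comPzRingType) (c d u v : 'rV[K]_3) j :
  cross c d 0 j = dot c v * u 0 j - dot c u * v 0 j - cross c (cross u v - d) 0 j.
Proof.
have -> : cross c d = cross c (cross u v) - cross c (cross u v - d).
  by rewrite crossBr opprB addrC subrK.
by rewrite subE cross_cross !mxE.
Qed.

Let ord3 (l : 'I_3) : [\/ l = o0, l = o1 | l = o2].
Proof.
by case: l => -[|[|[|//]]] l3; [constructor 1|constructor 2|constructor 3]; apply: val_inj.
Qed.

Let dv_cross (h : S) c d : (forall j, dv h (d 0 j)) -> forall j, dv h (cross c d 0 j).
Proof.
move=> hd j; case: (ord3 j) => ->; rewrite mxE /=; apply: dvB; apply/dvMl/hd.
Qed.

(** Modulo [lf a], a vector orthogonal to [q1] and [q2] has zero cross product with [r], by the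
    double cross product formula. As [r] has no zero on the line, [glue] turns the local
    proportionality factors into one form [P]. *)
Lemma pres_dot_null c k : homs e k c ->
  dv (lf a) (dot c q1) -> dv (lf a) (dot c q2) ->
  exists2 y, homv (k - 1) y /\ der y f = 0 & lin g c = lf a *: y.
Proof.
move=> hc h1 h2.
have cr j : dv (lf a) (cross c r 0 j).
  rewrite (cross_coord c r q1 q2); apply: dvB.
    by apply: dvB; apply: dvMr.
  by apply: dv_cross => i; rewrite subE; apply: (pres_cross H).
have cr0 : dv (lf a) (c 0 o1 * r 0 o2 - c 0 o2 * r 0 o1) by have := cr o0; rewrite mxE.
have cr1 : dv (lf a) (c 0 o2 * r 0 o0 - c 0 o0 * r 0 o2) by have := cr o1; rewrite mxE.
have cr2 : dv (lf a) (c 0 o0 * r 0 o1 - c 0 o1 * r 0 o0) by have := cr o2; rewrite mxE.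
have coh i j : dv (lf a) (c 0 i * r 0 j - c 0 j * r 0 i).
  have sw u v : dv (lf a) (u - v) -> dv (lf a) (v - u) by rewrite -opprB => /dvN; rewrite opprK.
  by case: (ord3 i) => ->; case: (ord3 j) => ->; rewrite ?subrr; (apply: dv0 || done || exact: sw).
have [|P hP cP] := @glue F a 'I_3 (fun j => w - e j) (k - w) (fun j => c 0 j)
  (fun j => r 0 j) (pres_neq0 H) (pres_homr H) _ (pres_zero H) coh.
  move=> j; rewrite (_ : w - e j + (k - w) = k - e j) //; ring.
have lf0 : lf a != 0 by apply/lf_neq0/(pres_neq0 H).
have hq j : exists q, hom (k - 1 - e j) q /\ c 0 j - P * r 0 j = lf a * q.
  have [|q hq eq] := dv_hom (l := k - e j) lf0 (@hom_lf _ a) _ (cP j).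
    apply: homB => //; rewrite (_ : k - e j = k - w + (w - e j)); last by ring.
    by apply: homM => //; apply: (pres_homr H).
  by exists q; split=> //; rewrite (_ : k - 1 - e j = k - e j - 1) //; ring.
have [qs qsP] := choice hq.
pose d : 'rV[S]_3 := \row_j qs j.
have ec : c = P *: r + lf a *: d.
  apply/rowP => j; rewrite !mxE; have [_ <-] := qsP j; by rewrite addrC subrK.
exists (lin g d).
  split; last exact/lin_der/(pres_der H).
  by apply: (lin_hom (pres_hom H)) => j; rewrite mxE; have [] := qsP j.
by rewrite ec linD !linZ (pres_rel H) scaler0 add0r.
Qed.

Let cramer (K : comPzRingType) (x1 x2 : K) (p1 p2 : 'rV[K]_3) :
  let p i := x1 * p2 0 i - x2 * p1 0 i in
  [/\ dot (vec3 0 (p o2) (- p o1)) p1 = cross p1 p2 0 o0 * x1 /\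
      dot (vec3 0 (p o2) (- p o1)) p2 = cross p1 p2 0 o0 * x2,
      dot (vec3 (- p o2) 0 (p o0)) p1 = cross p1 p2 0 o1 * x1 /\
      dot (vec3 (- p o2) 0 (p o0)) p2 = cross p1 p2 0 o1 * x2
    & dot (vec3 (p o1) (- p o0) 0) p1 = cross p1 p2 0 o2 * x1 /\
      dot (vec3 (p o1) (- p o0) 0) p2 = cross p1 p2 0 o2 * x2].
Proof. by rewrite /= !dotE !mxE /=; split; split; ring. Qed.

(* Cramer's rule: [r 0 j] times a vector of the target lies in the image. *)
Lemma pres_cramer j k y1 y2 : hom (k - a1) y1 -> hom (k - a2) y2 ->
  exists c, [/\ homs e (k + (w - e j)) c,
    dv (lf a) (dot c q1 - r 0 j * y1) & dv (lf a) (dot c q2 - r 0 j * y2)].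
Proof.
move=> hy1 hy2.
suff [c hc [e1 e2]] : exists2 c, homs e (k + (w - e j)) c &
    dot c q1 = cross q1 q2 0 j * y1 /\ dot c q2 = cross q1 q2 0 j * y2.
  by exists c; split=> //; rewrite ?e1 ?e2 -mulrBl; apply/dvMr/(pres_cross H).
pose p i := y1 * q2 0 i - y2 * q1 0 i.
have hp i l : l = k - a1 - a2 + e i -> hom l (p i).
  move=> ->; apply: homB.
    rewrite (_ : _ + e i = k - a1 + (e i - a2)); last by ring.
    by apply: homM => //; apply: (pres_hom2 H).
  rewrite (_ : _ + e i = k - a2 + (e i - a1)); last by ring.
  by apply: homM => //; apply: (pres_hom1 H).
have [c0 c1 c2] := cramer y1 y2 q1 q2.
case: (ord3 j) => ->; [exists (vec3 0 (p o2) (- p o1)) => //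
  | exists (vec3 (- p o2) 0 (p o0)) => // | exists (vec3 (p o1) (- p o0) 0) => //];
  move=> i; case: (ord3 i) => ->; rewrite mxE /=;
  by [apply: hom0 | apply: hp; rewrite /w; ring | apply/homN/hp; rewrite /w; ring].
Qed.

End Consequences.
End Presentation.

(** * Existence of splitting types *)

Section Vec2.

Definition vec2 (T : Type) (x y : T) : 'rV[T]_2 := \row_j (if j == 0 then x else y).

Lemma vec20 (T : Type) (x y : T) : vec2 x y 0 0 = x. Proof. by rewrite mxE. Qed.
Lemma vec21 (T : Type) (x y : T) : vec2 x y 0 ord_max = y. Proof. by rewrite mxE. Qed.

Lemma ord2P (P : 'I_2 -> Prop) : P 0 -> P ord_max -> forall j, P j.
Proof.
move=> h0 h1 [[|[|//]] j2]; first by rewrite (_ : Ordinal j2 = 0) //; apply: val_inj.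
by rewrite (_ : Ordinal j2 = ord_max) //; apply: val_inj.
Qed.

Lemma row2P (T : Type) (u v : 'rV[T]_2) : u 0 0 = v 0 0 -> u 0 ord_max = v 0 ord_max -> u = v.
Proof. by move=> h0 h1; apply/rowP; apply: ord2P. Qed.

Lemma vec2D (V : zmodType) (x y x' y' : V) : vec2 (x + x') (y + y') = vec2 x y + vec2 x' y'.
Proof. by apply: row2P; rewrite !mxE. Qed.

Lemma vec2Z (K : comPzRingType) (k x y : K) : vec2 (k * x) (k * y) = k *: vec2 x y.
Proof. by apply: row2P; rewrite !mxE. Qed.

Definition dot2 (K : comPzRingType) (q1 q2 c : 'rV[K]_3) : 'rV[K]_2 :=
  vec2 (dot c q1) (dot c q2).

Lemma dot2_0 (K : comPzRingType) (q1 q2 c : 'rV[K]_3) : dot2 q1 q2 c 0 0 = dot c q1.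
Proof. exact: vec20. Qed.

Lemma dot2_1 (K : comPzRingType) (q1 q2 c : 'rV[K]_3) :
  dot2 q1 q2 c 0 ord_max = dot c q2.
Proof. exact: vec21. Qed.

Lemma dot2D (K : comPzRingType) (q1 q2 c d : 'rV[K]_3) :
  dot2 q1 q2 (c + d) = dot2 q1 q2 c + dot2 q1 q2 d.
Proof. by rewrite /dot2 !dotDl vec2D. Qed.

Lemma dot2Z (K : comPzRingType) (q1 q2 c : 'rV[K]_3) h :
  dot2 q1 q2 (h *: c) = h *: dot2 q1 q2 c.
Proof. by rewrite /dot2 !dotZl vec2Z. Qed.

Lemma dot2B (K : comPzRingType) (q1 q2 c d : 'rV[K]_3) :
  dot2 q1 q2 (c - d) = dot2 q1 q2 c - dot2 q1 q2 d.
Proof. by rewrite dot2D -scaleN1r dot2Z scaleN1r. Qed.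

Lemma dot2_fracB (K : comPzRingType) (q1 q2 c d : 'rV[K]_3) h u s :
  dot2 q1 q2 (h *: (u *: c - s *: d)) =
  h *: (u *: dot2 q1 q2 c - s *: dot2 q1 q2 d).
Proof. by rewrite dot2Z dot2B !dot2Z. Qed.

Lemma dot2_germD (K : comPzRingType) (q1 q2 x c d : 'rV[K]_3) h k u s :
  h *: dot2 q1 q2 x - k *: (u *: dot2 q1 q2 c + s *: dot2 q1 q2 d) =
  dot2 q1 q2 (h *: x - k *: (u *: c + s *: d)).
Proof. by rewrite dot2B !dot2Z dot2D !dot2Z. Qed.

Lemma dot2_germZ (K : comPzRingType) (q1 q2 x c : 'rV[K]_3) h k u :
  h *: dot2 q1 q2 x - k *: (u *: dot2 q1 q2 c) =
  dot2 q1 q2 (h *: x - k *: (u *: c)).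
Proof. by rewrite dot2B !dot2Z. Qed.

End Vec2.

Section Sheaves.
Variable R : realType.
Local Notation C := R[i].
Local Notation S := (poly3 R).
Implicit Types (L : line R) (q : point R) (v : 'rV[C]_3) (g h : S).

Lemma homogeneousE k g : homogeneous k g <-> hom k g.
Proof.
case: k => [n|n] /=; first exact: hom_dhomog.
by split=> [->|/hom_neg ->] //; apply: hom0.
Qed.

Lemma ARdegE (f : S) k rho : ARdeg f k rho <-> homv k rho /\ der rho f = 0.
Proof.
split=> [[h1 h2]|[h1 h2]]; split=> //.
  by move=> j; apply/homogeneousE/h2.
by move=> j; apply/homogeneousE/h1.
Qed.

Definition rep q : 'rV[C]_3 := vpick (val q).

Lemma rep_neq0 q : rep q != 0.
Proof.
rewrite /rep vpick0; apply/negP => /eqP h; move: (valP q).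
by rewrite /= h dimv0.
Qed.

Lemma val_rep q : val q = <[rep q]>%VS.
Proof.
apply/eqP; rewrite eq_sym eqEdim dim_vline rep_neq0 (eqP (valP q)) leqnn andbT.
by rewrite -memvE memv_pick.
Qed.

Definition mkpoint v (v0 : v != 0) : point R.
Proof. by exists <[v]>%VS; rewrite dim_vline v0. Defined.

Lemma mkpoint_rep v (v0 : v != 0) : exists2 c, c != 0 & rep (mkpoint v0) = c *: v.
Proof.
have := val_rep (mkpoint v0); rewrite /= => e.
have /vlineP[c ec] : rep (mkpoint v0) \in <[v]>%VS by rewrite e memv_line.
exists c => //; apply/negP => /eqP c0; move: (rep_neq0 (mkpoint v0)).
by rewrite ec c0 scale0r eqxx.
Qed.

Lemma mem_line_supp L v : (v \in line_supp L) = (dot (val L) v == 0).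
Proof.
rewrite memv_ker lfunE /= /mulmxr /=.
have -> : (v *m (val L)^T == 0) = ((v *m (val L)^T) 0 0 == 0).
  apply/eqP/eqP => [->|h]; first by rewrite mxE.
  by apply/matrixP => i j; rewrite !ord1 h mxE.
by rewrite mxE dotC; congr (_ == _); apply: eq_bigr => j _; rewrite mxE.
Qed.

Lemma on_lineE q L : on_line q L = (dot (val L) (rep q) == 0).
Proof. by rewrite /on_line val_rep -memvE mem_line_supp. Qed.

Lemma line_neq0 L : val L != 0.
Proof. exact: valP L. Qed.

Lemma nonvanishingE k g q : hom k g -> nonvanishing g q <-> ev g (rep q) != 0.
Proof.
move=> hg; split=> [[v]|h]; last by exists (rep q) => //; rewrite val_rep memv_line.
rewrite val_rep => /vlineP[c ->]; rewrite -/(ev g _) (evZ _ _ hg).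
by apply: contra_neq => ->; rewrite mulr0.
Qed.

Lemma nonvanishing1 q : nonvanishing (1 : S) q.
Proof. by exists 0; rewrite ?mem0v // meval1 oner_neq0. Qed.

Lemma nonvanishingM g h k l q : hom k g -> hom l h ->
  nonvanishing g q -> nonvanishing h q -> nonvanishing (g * h) q.
Proof.
move=> hg hh /(nonvanishingE _ hg) ng /(nonvanishingE _ hh) nh.
by apply/(nonvanishingE _ (homM hg hh)); rewrite evM mulf_neq0.
Qed.

Lemma nonvanishing_Ndv g q L k : hom k g -> on_line q L -> nonvanishing g q ->
  ~ dv (lf (val L)) g.
Proof.
rewrite on_lineE => hg /eqP qL /(nonvanishingE _ hg) + [f e].
by rewrite e evM ev_lf qL mul0r eqxx.
Qed.

Lemma dv_frac (l x y z u g0 : S) : dv l (x - y) -> dv l (y - z * u) ->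
  dv l (g0 * x - z * g0 * u).
Proof.
move=> h1 h2; rewrite (_ : _ - _ = g0 * (x - y) + g0 * (y - z * u)); last by ring.
exact: dvD (dvMl _ h1) (dvMl _ h2).
Qed.

Section Split.
Variables (L : line R) (a b : int).
Local Notation N := (restrict_gmodule L (split_gmodule R a b)).
Local Notation l := (lf (val L)).

Lemma split_gpiece k (x : 'rV[S]_2) :
  @gpiece R N k x <-> hom (k - a) (x 0 0) /\ hom (k - b) (x 0 ord_max).
Proof. by rewrite /= !homogeneousE. Qed.

Lemma split_gnull_dv (x : 'rV[S]_2) :
  @gnull R N x -> dv l (x 0 0) /\ dv l (x 0 ord_max).
Proof.
move=> [k [y [_ /= /subr0_eq ->]]]; rewrite !mxE; split; exact/dvMr/dvv.
Qed.

Lemma split_gnull_intro k (x : 'rV[S]_2) : hom (k - a) (x 0 0) ->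
  hom (k - b) (x 0 ord_max) -> dv l (x 0 0) -> dv l (x 0 ord_max) -> @gnull R N x.
Proof.
move=> h1 h2 d1 d2; have l0 : l != 0 by apply/lf_neq0/line_neq0.
have [y1 hy1 e1] := dv_hom l0 (@hom_lf _ (val L)) h1 d1.
have [y2 hy2 e2] := dv_hom l0 (@hom_lf _ (val L)) h2 d2.
exists (k - 1), (vec2 y1 y2); split.
  by apply/split_gpiece; rewrite vec20 vec21 ![k - 1 - _]addrAC.
rewrite /= -vec2Z -[line_form L]/(lf (val L)) -e1 -e2.
by apply/eqP; rewrite subr_eq0; apply/eqP/row2P; rewrite ?vec20 ?vec21.
Qed.

(* Equality of germs on [L] of sections of a split bundle is equality of
   fractions modulo [l]. *)
Lemma split_germ_eq q (s t : fraction N) : on_line q L -> germ q s -> germ q t ->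
  @germ_eq R N q s t <->
  (forall j, dv l (t.2 * (s.1 : 'rV[S]_2) 0 j - s.2 * (t.1 : 'rV[S]_2) 0 j)).
Proof.
case: s t => [s1 s2] [t1 t2] /= qL [k [/split_gpiece[hs1 hs1'] /homogeneousE hs2 ns]].
move=> [k' [/split_gpiece[ht1 ht1'] /homogeneousE ht2 nt]] /=.
simpl in *; split=> [[k1 [h [/homogeneousE hh nh]]] | H].
  move/split_gnull_dv; rewrite /= !mxE => -[d1 d2].
  have pr x : dv l (h * x) -> dv l x.
    move/(lf_prime (line_neq0 L)) => [|//].
    by have := nonvanishing_Ndv hh qL nh.
  by apply: ord2P; [apply: (pr _ d1) | apply: (pr _ d2)].
exists 0, 1; split; [exact/homogeneousE/hom1 | exact: nonvanishing1 |].
rewrite scale1r; apply: (@split_gnull_intro (k + k')); rewrite !mxE; try exact: H.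
- apply: homB; [rewrite addrAC addrC | rewrite -addrA]; exact: homM.
- apply: homB; [rewrite addrAC addrC | rewrite -addrA]; exact: homM.
Qed.

End Split.

Section Existence.
Variables (L : line R) (f : S) (t : int) (g : 'I_3 -> 'rV[S]_3) (e : 'I_3 -> int).
Variables (r q1 q2 : 'rV[S]_3) (a b : int).
Hypothesis H : presentation f (val L) g e r q1 q2 a b.
Hypothesis ab : a <= b.
Local Notation M := (restrict_gmodule L (AR_gmodule f t)).
Local Notation N := (restrict_gmodule L (split_gmodule R (a - t) (b - t))).

Local Notation T := (dot2 q1 q2).

(** The choice is independent of the degree: a nonzero field is homogeneous of one degree only, and
    0 gets zero coefficients. *)
Let coef_ex : exists co : 'rV[S]_3 -> 'rV[S]_3, forall x k,
  homv k x -> der x f = 0 -> homs e k (co x) /\ x = lin g (co x).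
Proof.
suff H1 (x : 'rV[S]_3) : exists c, forall k, homv k x -> der x f = 0 ->
    homs e k c /\ x = lin g c.
  by have [co coP] := boolp.choice H1; exists co.
have [->|x0] := eqVneq x 0.
  by exists 0 => k _ _; rewrite lin0; split=> // j; rewrite mxE; apply: hom0.
have [[k [hk dx]]|nx] := pselect (exists k, homv k x /\ der x f = 0); last first.
  by exists 0 => k hk dx; case: nx; exists k.
have [c hc ec] := pres_gen H hk dx; exists c => k' hk' _; split=> //.
suff -> : k' = k by [].
have [j xj] : exists j, x 0 j != 0.
  apply/existsP; apply: contraR x0 => /existsPn h.
  by apply/eqP/rowP => j; rewrite mxE; apply/eqP; rewrite -[_ == _]negbK h.
exact: hom_uniq xj (hk' j) (hk j).
Qed.

Let null_eq k c : homs e (k + t) c ->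
  @gnull R M (lin g c) <-> @gnull R N (T c).
Proof.
move=> hc; split.
  move=> [k' [y [/ARdegE[hy dy] /= /subr0_eq ey]]].
  have [d1 d2] := pres_null_dot H dy hy ey.
  apply: (@split_gnull_intro _ _ _ k); rewrite ?dot2_0 ?dot2_1 //.
    rewrite (_ : k - (a - t) = k + t - a); last by ring.
    exact: hom_dot hc (pres_hom1 H).
  rewrite (_ : k - (b - t) = k + t - b); last by ring.
  exact: hom_dot hc (pres_hom2 H).
move=> /split_gnull_dv; rewrite dot2_0 dot2_1 => -[d1 d2].
have [y [hy dy] ey] := pres_dot_null H hc d1 d2.
exists (k - 1), y; split; last by rewrite /= ey subrr.
by apply/ARdegE; split=> //; rewrite (_ : k - 1 + t = k + t - 1) //; ring.
Qed.

Let gpieceT k c : homs e (k + t) c -> @gpiece R N k (T c).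
Proof.
move=> hc; apply/split_gpiece; rewrite dot2_0 dot2_1; split.
  rewrite (_ : k - (a - t) = k + t - a); last by ring.
  exact: hom_dot hc (pres_hom1 H).
rewrite (_ : k - (b - t) = k + t - b); last by ring.
exact: hom_dot hc (pres_hom2 H).
Qed.

(** The isomorphism sends [lin g c / s] to [T c / s], by the same formula at every point, so it is
    local. The choice of [c] does not matter because [T] sends relations to null elements. *)
Lemma splitting_of_presentation : splitting_type (AR_gmodule f t) L (a - t) (b - t).
Proof.
split; first by rewrite lerD2r.
have [co coP] := coef_ex.
have coE k x : @gpiece R M k x -> homs e (k + t) (co x) /\ x = lin g (co x).
  by move=> /ARdegE[hx dx]; apply: coP.
have gpieceM k c : homs e (k + t) c -> @gpiece R M k (lin g c).
  move=> hc; apply/ARdegE; split; first exact: lin_hom (pres_hom H) hc.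
  exact/lin_der/(pres_der H).
have homs_sc k l h c : hom k h -> homs e (l + t) c -> homs e (k + l + t) (h *: c).
  by move=> hh hc; rewrite -addrA; apply: homsZ.
have dot0 k c : homs e (k + t) c -> lin g c = 0 -> @gnull R N (T c).
  move=> hc c0; apply/(null_eq hc); rewrite c0; exists 0, 0; split.
    apply/ARdegE; split; first by move=> j; rewrite [_ 0 j](mxE _ _ 0 j); apply: hom0.
    by rewrite -[0 : 'rV[S]_3](scale0r (0 : 'rV[S]_3)) derZl mul0r.
  by rewrite /= scaler0 subrr.
have nullN0 : @gnull R N 0.
  have z j : (0 : 'rV[S]_2) 0 j = 0 by rewrite mxE.
  by apply: (@split_gnull_intro _ _ _ 0); rewrite /= z; (exact: hom0 || exact: dv0).
exists (fun _ s => (T (co s.1), s.2)) => q qL; split.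
- move=> [s1 s2] [k [hs1 hs2 ns]]; exists k; split=> //=.
  by apply: gpieceT; have [] := coE _ _ hs1.
- split.
    move=> [s1 s2] [u1 u2] [k [hs1 hs2 ns]] [k' [hu1 hu2 nu]]; simpl in *.
    have [cs es] := coE _ _ hs1; have [cu eu] := coE _ _ hu1.
    move/homogeneousE: hs2 => hs2; move/homogeneousE: hu2 => hu2.
    have E h : h *: (u2 *: s1 - s2 *: u1) = lin g (h *: (u2 *: co s1 - s2 *: co u1)).
      by rewrite lin_fracB -es -eu.
    have E' h : h *: (u2 *: T (co s1) - s2 *: T (co u1)) =
        T (h *: (u2 *: co s1 - s2 *: co u1)).
      by rewrite dot2_fracB.
    have hc k1 h : hom k1 h -> homs e (k1 + (k + k') + t) (h *: (u2 *: co s1 - s2 *: co u1)).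
      move=> hh; apply: (homs_sc _ _ _ _) => //; apply: homsB; last exact: (homs_sc _ _ _ _).
      by rewrite [k + k']addrC; apply: (homs_sc _ _ _ _).
    split=> -[k1 [h [hh nh nz]]]; exists k1, h; split=> //; move: nz => /=;
      move/homogeneousE: hh => hh; rewrite E E'; by move/(null_eq (hc _ _ hh)).
  move=> [y g0] [k [/split_gpiece[hy1 hy2] hg0 ng0]]; simpl in *.
  move/homogeneousE: hg0 => hg0.
  (* Cramer's rule reaches only [r 0 j] times the given numerator; with [r 0 j] nonzero at [q], this
     factor goes into the denominator of the preimage. *)
  have [j rj] := pres_zero H (rep_neq0 q) (eqP (etrans (esym (on_lineE q L)) qL)).
  rewrite (_ : k - (a - t) = k + t - a) in hy1; last by ring.
  rewrite (_ : k - (b - t) = k + t - b) in hy2; last by ring.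
  have [c [hc d1 d2]] := pres_cramer H j hy1 hy2.
  set w := _ - e j in hc.
  have hr : hom w (r 0 j) by apply: (pres_homr H).
  have hcw : homs e (k + w + t) c by rewrite addrAC.
  have hg : hom (k + w) (r 0 j * g0) by rewrite addrC; apply: homM.
  have nr : nonvanishing (r 0 j) q by apply/(nonvanishingE _ hr).
  have nrg : nonvanishing (r 0 j * g0) q by apply: (nonvanishingM hr hg0).
  exists (lin g c, r 0 j * g0).
    by exists (k + w); split=> //; [apply: gpieceM | apply/homogeneousE].
  have gc := gpieceM _ _ hcw; have [hco eco] := coE _ _ gc.
  rewrite /=; exists 0, 1; split; [exact/homogeneousE/hom1 | exact: nonvanishing1 |].
  rewrite scale1r /=.
  have n1 : @gnull R N (T (co (lin g c) - c)).
    by apply: (dot0 (k + w)); [apply: homsB | rewrite linB -eco subrr].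
  have vfracE j' (u v : S) (x1 x2 : 'rV[S]_2) : (u *: x1 - v *: x2) 0 j' = u * x1 0 j' - v * x2 0 j'.
    by rewrite !mxE.
  have {n1} [n11 n12] := split_gnull_dv n1; rewrite dot2_0 dotBl in n11; rewrite dot2_1 dotBl in n12.
  have := (@split_gpiece L (a - t) (b - t) _ _).1 (gpieceT hco).
  rewrite dot2_0 dot2_1 => -[hT1 hT2].
  apply: (@split_gnull_intro _ _ _ (k + (k + w))); rewrite ?vfracE ?dot2_0 ?dot2_1.
  - apply: homB; first by rewrite -addrA; exact: homM hg0 hT1.
    rewrite addrAC addrC (_ : k - (a - t) = k + t - a); last by ring.
    exact: homM hg hy1.
  - apply: homB; first by rewrite -addrA; exact: homM hg0 hT2.
    rewrite addrAC addrC (_ : k - (b - t) = k + t - b); last by ring.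
    exact: homM hg hy2.
  - exact: dv_frac n11 d1.
  - exact: dv_frac n12 d2.
- move=> [s1 s2] [u1 u2] [k [hs1 hs2 ns]] [k' [hu1 hu2 nu]]; simpl in *.
  have [cs es] := coE _ _ hs1; have [cu eu] := coE _ _ hu1.
  move/homogeneousE: hs2 => hs2; move/homogeneousE: hu2 => hu2.
  rewrite /germ_add /=; set x := u2 *: s1 + s2 *: u1.
  have hd : homs e (k + k' + t) (u2 *: co s1 + s2 *: co u1).
    by apply: homsD; last exact: (homs_sc _ _ _ _); rewrite [k + k']addrC; apply: (homs_sc _ _ _ _).
  have ex : x = lin g (u2 *: co s1 + s2 *: co u1) by rewrite lin_fracD -es -eu.
  have [hx ex'] : homs e (k + k' + t) (co x) /\ x = lin g (co x).
    by apply: coE; rewrite ex; apply: gpieceM.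
  exists 0, 1; split; [exact/homogeneousE/hom1 | exact: nonvanishing1 |].
  rewrite scale1r /= (dot2_germD q1 q2 (co x) (co s1) (co u1)).
  apply: (dot0 (k + k' + (k + k'))).
    by apply: homsB; apply: (homs_sc _ _ _ _) => //; apply: homM.
  by rewrite linB !linZ -ex' -ex subrr.
- move=> k a0 e0 [s1 s2] ha0 he0 ne0 [k' [hs1 hs2 ns]]; simpl in *.
  have [cs es] := coE _ _ hs1.
  move/homogeneousE: hs2 => hs2; move/homogeneousE: ha0 => ha0; move/homogeneousE: he0 => he0.
  have hd : homs e (k + k' + t) (a0 *: co s1) by apply: (homs_sc _ _ _ _).
  have ex : a0 *: s1 = lin g (a0 *: co s1) by rewrite linZ -es.
  have [hx ex'] : homs e (k + k' + t) (co (a0 *: s1)) /\ a0 *: s1 = lin g (co (a0 *: s1)).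
    by apply: coE; rewrite ex; apply: gpieceM.
  exists 0, 1; split; [exact/homogeneousE/hom1 | exact: nonvanishing1 |].
  rewrite scale1r /= (dot2_germZ q1 q2 (co (a0 *: s1)) (co s1)).
  apply: (dot0 (k + k' + (k + k'))).
    by apply: homsB; apply: (homs_sc _ _ _ _) => //; apply: homM.
  by rewrite linB !linZ -ex' -es subrr.
move=> [s1 s2] _; exists 0, 1; split; [exact/homogeneousE/hom1 | exact: nonvanishing1 |].
move=> q' _ _; exists 0, 1; split; [exact/homogeneousE/hom1 | exact: nonvanishing1 |].
by rewrite scale1r subrr.
Qed.

End Existence.
End Sheaves.

(** * Uniqueness of splitting types *)

Section Uniqueness.
Variable R : realType.
Local Notation C := R[i].
Local Notation S := (poly3 R).
Implicit Types (q : point R) (g h : S).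

Definition graded_stable (M : gmodule R) : Prop :=
  forall k l h (x : 'rV[S]_(grank M)),
    homogeneous k h -> @gpiece R M l x -> @gpiece R M (k + l) (h *: x).

Section Line.
Variable L : line R.
Local Notation l := (lf (val L)).
Local Notation frac := (('I_2 -> S) * S)%type.

Definition scf g (x : 'I_2 -> S) : 'I_2 -> S := fun j => g * x j.

(** The equality of germs found in [split_germ_eq]. It does not mention the point, so germs taken at
    different points can be compared. *)
Definition ceq (s t : frac) : Prop := forall j, dv l (t.2 * s.1 j - s.2 * t.1 j).

Lemma ceq_sym s t : ceq s t -> ceq t s.
Proof.
by move=> st j; have := dvN (st j); rewrite opprB.
Qed.

Lemma ceq_trans t s u : ceq s t -> ~ dv l t.2 -> ceq t u -> ceq s u.
Proof.
move=> st nt tu j; have : dv l (t.2 * (u.2 * s.1 j - s.2 * u.1 j)).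
  rewrite (_ : t.2 * _ = u.2 * (t.2 * s.1 j - s.2 * t.1 j) +
    s.2 * (u.2 * t.1 j - t.2 * u.1 j)); last by ring.
  exact: dvD (dvMl _ (st j)) (dvMl _ (tu j)).
by move/(lf_prime (line_neq0 L)) => [].
Qed.

Lemma ceq_scale x y s t : ceq s t -> ceq (scf x s.1, y * s.2) (scf x t.1, y * t.2).
Proof.
move=> st j; rewrite /scf /= (_ : _ - _ = x * y * (t.2 * s.1 j - s.2 * t.1 j)); last by ring.
exact: dvMl.
Qed.

Lemma ceq_same (x : 'I_2 -> S) f g h u w :
  w * (f * g) = u * h -> ceq (scf f (scf g x), u) (scf h x, w).
Proof.
move=> e j.
rewrite /scf /=; move: (x j) => z.
have -> : w * (f * (g * z)) - u * (h * z) = (w * (f * g) - u * h) * z by ring.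
by rewrite e subrr; exists 0; rewrite !mulr0 mul0r.
Qed.

(** An isomorphism onto a split bundle, translated from stalks into congruences modulo [l] and
    values at representatives. *)
Record line_iso (M : gmodule R) (a b : int)
    (phi : point R -> fraction M -> frac) : Prop := LineIso {
  iso_piece : forall q (s : fraction M), on_line q L -> germ q s ->
    exists k : int, [/\ hom (k - a) ((phi q s).1 0), hom (k - b) ((phi q s).1 ord_max),
      hom k (phi q s).2 & ev (phi q s).2 (rep q) != 0];
  iso_eq : forall q (s t : fraction M), on_line q L -> germ q s -> germ q t ->
    ceq (phi q s) (phi q t) <-> germ_eq q s t;
  iso_surj : forall q (x : 'I_2 -> S) (y : S) (k : int), on_line q L -> hom (k - a) (x 0) ->
    hom (k - b) (x ord_max) -> hom k y -> ev y (rep q) != 0 ->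
    exists2 s : fraction M, germ q s & ceq (phi q s) (x, y);
  iso_scale : forall q (k : int) (h e : S) (s : fraction M), on_line q L -> hom k h -> hom k e ->
    ev e (rep q) != 0 -> germ q s ->
    ceq (phi q (germ_scale h e s)) (scf h (phi q s).1, e * (phi q s).2);
  iso_local : forall q (s : fraction M), on_line q L -> germ q s ->
    exists (k : int) (h : S), [/\ hom k h, ev h (rep q) != 0
      & forall q', on_line q' L -> ev (h * s.2 * (phi q s).2) (rep q') != 0 ->
        ceq (phi q' s) (phi q s)]
}.

Lemma germ_scale_germ (M : gmodule R) q k h e (s : fraction M) : graded_stable M ->
  hom k h -> hom k e -> ev e (rep q) != 0 -> germ q s -> germ q (germ_scale h e s).
Proof.
move=> st hh he ne [k' [s1 /homogeneousE s2 ns]]; exists (k + k'); split=> /=.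
- by apply: st => //; apply/homogeneousE.
- by apply/homogeneousE/homM.
by apply: (nonvanishingM he s2) => //; apply/(nonvanishingE _ he).
Qed.

Lemma sheaf_line_iso (M : gmodule R) a b : graded_stable M ->
  sheaf_iso_on L (restrict_gmodule L M) (restrict_gmodule L (split_gmodule R a b)) ->
  exists phi, @line_iso (restrict_gmodule L M) a b phi.
Proof.
move=> st [phi H].
exists (fun q s => (fun j => ((phi q s).1 : 'rV[S]_2) 0 j, (phi q s).2)); split.
- move=> q s qL sg; have [h1 _ _ _ _] := H q qL.
  have [k [/split_gpiece[p1 p2] /homogeneousE p3 p4]] := h1 _ sg; exists k; split=> //.
  exact/(nonvanishingE _ p3).
- move=> q s t qL sg tg; have [h1 [h2 _] _ _ _] := H q qL.
  exact: iff_trans (iff_sym (split_germ_eq qL (h1 _ sg) (h1 _ tg))) (h2 s t sg tg).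
- move=> q x y k qL hx1 hx2 hy ny; have [h1 [_ h2] _ _ _] := H q qL.
  pose z : 'rV[S]_2 := \row_j x j.
  have zE j : z 0 j = x j by rewrite mxE.
  have gxy : @germ R (restrict_gmodule L (split_gmodule R a b)) q (z, y).
    exists k; split; [|exact/homogeneousE | exact/(nonvanishingE _ hy)].
    by apply/split_gpiece; rewrite !zE.
  have [s sg se] := h2 _ gxy; exists s => // j.
  by have := iffLR (split_germ_eq qL (h1 _ sg) gxy) se j; rewrite /= zE.
- move=> q k h e s qL hh he ne sg; have [h1 _ _ h4 _] := H q qL.
  have ns : nonvanishing e q by apply/(nonvanishingE _ he).
  have ge := h4 k h e s (iffRL (homogeneousE _ _) hh) (iffRL (homogeneousE _ _) he) ns sg.
  have stM : graded_stable (restrict_gmodule L M) by [].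
  have stN : graded_stable (restrict_gmodule L (split_gmodule R a b)).
    move=> k1 k2 u v /homogeneousE hu /split_gpiece[hv1 hv2]; apply/split_gpiece.
    by rewrite !mxE -!addrA; split; apply: homM.
  have g1 := h1 _ (germ_scale_germ stM hh he ne sg).
  have g2 := germ_scale_germ stN hh he ne (h1 _ sg).
  by move=> j; have := iffLR (split_germ_eq qL g1 g2) ge j; rewrite /= mxE.
move=> q s qL sg; have [h1 _ _ _ h5] := H q qL.
have [k [h [/homogeneousE hh nh hl]]] := h5 s sg; exists k, h; split=> //.
  exact/(nonvanishingE _ hh).
have [k1 [ps1 /homogeneousE ps2 ns]] := h1 _ sg.
have [k2 [s1 /homogeneousE s2 _]] := sg.
move=> q' q'L; rewrite !evM !mulf_eq0 !negb_or => /andP[/andP[nh' ns'] np'].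
have sg' : @germ R (restrict_gmodule L M) q' s.
  by exists k2; split=> //; [apply/homogeneousE | apply/(nonvanishingE _ s2)].
have [h1' _ _ _ _] := H q' q'L.
have g1 : @germ R (restrict_gmodule L (split_gmodule R a b)) q' (phi q' s) by apply: h1'.
have g2 : @germ R (restrict_gmodule L (split_gmodule R a b)) q' (phi q s).
  by exists k1; split=> //; [apply/homogeneousE | apply/(nonvanishingE _ ps2)].
apply: (iffLR (split_germ_eq q'L g1 g2)); apply: hl => //.
apply/(nonvanishingE _ (homM (homM hh s2) ps2)).
by rewrite !evM !mulf_neq0.
Qed.

(** Multiplication by [x / y] turns a section of the twist by [k] into a germ of degree zero at
    [q]. *)
Lemma unit_form q (k : int) : exists (n : int) (x y : S), [/\ hom n x, hom (n + k) y,
  ev x (rep q) != 0 & ev y (rep q) != 0 :> C].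
Proof.
have [b bq] := dot_neq0 (rep_neq0 q).
have nb : ev (lf b) (rep q) != 0 by rewrite ev_lf dotC bq oner_neq0.
have evX n : ev (lf b ^+ n) (rep q) != 0 by rewrite /ev rmorphXn /= expf_neq0.
have hX n : hom n%:Z (lf b ^+ n) by have := homX_exp (n := n) (@hom_lf _ b); rewrite mulr1.
(* Starting from the exponent $|k|$ keeps both exponents nonnegative. *)
exists (absz k)%:Z, (lf b ^+ absz k), (lf b ^+ absz ((absz k)%:Z + k)); split=> //.
rewrite -[X in hom X]gez0_abs; first exact: hX.
lia.
Qed.

Lemma ev_point_Ndv q g : on_line q L -> ev g (rep q) != 0 -> ~ dv l g.
Proof. by rewrite on_lineE => /eqP qL + [f e]; rewrite e evM ev_lf qL mul0r eqxx. Qed.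

Fixpoint allp (P : S -> Prop) (gs : seq S) : Prop :=
  if gs is g :: gs' then P g /\ allp P gs' else True.

(** As [l] is prime it does not divide the product of the forms, which is therefore nonzero
    somewhere on the line. *)
Lemma common_point (gs : seq S) : allp (fun g => exists k, hom k g) gs ->
  allp (fun g => ~ dv l g) gs ->
  exists q, on_line q L /\ allp (fun g => ev g (rep q) != 0) gs.
Proof.
move=> hgs ngs; have L0 := line_neq0 L.
have np : ~ dv l (\prod_(g <- gs) g).
  elim: gs ngs {hgs} => [|g gs IH] /= ngs; first by rewrite big_nil; apply: lf_Ndv1.
  by case: ngs => ng ngs; rewrite big_cons => /(lf_prime L0)[|/(IH ngs)].
have [v [v0 Lv nv]] := ev_Ndv L0 np.
have [c c0 ec] := mkpoint_rep v0; exists (mkpoint v0); split.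
  by rewrite on_lineE ec dotZr Lv mulr0.
rewrite ec; elim: gs hgs {ngs np} nv => //= g gs IH [[k hg] hgs].
rewrite big_cons evM mulf_eq0 negb_or => /andP[ng ngs]; split; last exact: IH.
by rewrite (evZ _ _ hg) mulf_neq0 ?expf_neq0.
Qed.

Lemma evM_neq0 (v : 'rV[C]_3) g h : ev g v != 0 -> ev h v != 0 -> ev (g * h) v != 0.
Proof. by move=> hg hh; rewrite evM mulf_neq0. Qed.

Section Transfer.
Variables (M : gmodule R) (a b a' b' : int).
Variables (phi psi : point R -> fraction M -> frac).
Hypotheses (stM : graded_stable M).
Hypotheses (Hphi : @line_iso M a b phi) (Hpsi : @line_iso M a' b' psi).

(** [m] and [m'] are the preimages under [phi] of the same section [x] at two points. At a point of
    the line where no denominator vanishes, they differ by a unit fraction, which [psi] respects;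
    the resulting congruence no longer depends on the point. *)
Let coherence q q' (m m' : fraction M) (x : 'I_2 -> S) X W X' W' n n' k :
  on_line q L -> on_line q' L -> germ q m -> germ q' m' ->
  hom n X -> hom (n + k) W -> hom n' X' -> hom (n' + k) W' ->
  ev X (rep q) != 0 -> ev W (rep q) != 0 ->
  ev X' (rep q') != 0 -> ev W' (rep q') != 0 ->
  ceq (phi q m) (scf X x, W) -> ceq (phi q' m') (scf X' x, W') ->
  forall j, dv l (W * (psi q m).1 j * (X' * (psi q' m').2) -
                  W' * (psi q' m').1 j * (X * (psi q m).2)).
Proof.
move=> qL q'L mg m'g hX hW hX' hW' nX nW nX' nW' e e'.
have [k1 [_ _ hp np]] := iso_piece Hphi qL mg.
have [k1' [_ _ hp' np']] := iso_piece Hphi q'L m'g.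
have [k2 [_ _ hs ns]] := iso_piece Hpsi qL mg.
have [k2' [_ _ hs' ns']] := iso_piece Hpsi q'L m'g.
have [k3 [h1 [hh1 nh1 l1]]] := iso_local Hphi qL mg.
have [k3' [h1' [hh1' nh1' l1']]] := iso_local Hphi q'L m'g.
have [k4 [h2 [hh2 nh2 l2]]] := iso_local Hpsi qL mg.
have [k4' [h2' [hh2' nh2' l2']]] := iso_local Hpsi q'L m'g.
have [km [pm1 pm2 pm3]] := mg; have [km' [pm1' pm2' pm3']] := m'g.
have hm := iffLR (homogeneousE _ _) pm2; have hm' := iffLR (homogeneousE _ _) pm2'.
have nm := iffLR (nonvanishingE _ hm) pm3; have nm' := iffLR (nonvanishingE _ hm') pm3'.
pose gs := [:: X; W; X'; W'; (phi q m).2; (phi q' m').2; (psi q m).2; (psi q' m').2;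
  h1; h1'; h2; h2'; m.2; m'.2].
have [|| q0 [q0L n0]] := @common_point gs.
- by do !split; eexists; eassumption.
- exact: (conj (ev_point_Ndv qL nX)
  (conj (ev_point_Ndv qL nW)
  (conj (ev_point_Ndv q'L nX')
  (conj (ev_point_Ndv q'L nW')
  (conj (ev_point_Ndv qL np)
  (conj (ev_point_Ndv q'L np')
  (conj (ev_point_Ndv qL ns)
  (conj (ev_point_Ndv q'L ns')
  (conj (ev_point_Ndv qL nh1)
  (conj (ev_point_Ndv q'L nh1')
  (conj (ev_point_Ndv qL nh2)
  (conj (ev_point_Ndv q'L nh2')
  (conj (ev_point_Ndv qL nm)
  (conj (ev_point_Ndv q'L nm')
  I)))))))))))))).
case: n0 => nX0 [nW0 [nX0' [nW0' [np0 [np0' [ns0 [ns0' [nh10 [nh10' n0]]]]]]]]].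
case: n0 => nh20 [nh20' [nm0 [nm0' _]]].
have mg0 : germ q0 m by exists km; split=> //; apply/(nonvanishingE _ hm).
have mg0' : germ q0 m' by exists km'; split=> //; apply/(nonvanishingE _ hm').
have e1 : ceq (phi q0 m) (phi q m) by exact: (l1 q0 q0L (evM_neq0 (evM_neq0 nh10 nm0) np0)).
have e1' : ceq (phi q0 m') (phi q' m') by exact: (l1' q0 q0L (evM_neq0 (evM_neq0 nh10' nm0') np0')).
have e2 : ceq (psi q0 m) (psi q m) by exact: (l2 q0 q0L (evM_neq0 (evM_neq0 nh20 nm0) ns0)).
have e2' : ceq (psi q0 m') (psi q' m') by exact: (l2' q0 q0L (evM_neq0 (evM_neq0 nh20' nm0') ns0')).
have N g : ev g (rep q0) != 0 -> ~ dv l g by exact: ev_point_Ndv.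
have hA : hom (n + n' + k) (W' * X) by rewrite -addrA addrC; apply: homM.
have hB : hom (n + n' + k) (W * X') by rewrite addrAC; apply: homM.
have nB : ev (W * X') (rep q0) != 0 by exact: evM_neq0.
(* The scalar is the quotient of the local trivializations [X / W] and [X' / W'], so that [phi]
   gives [m1] and [m] the same image. *)
pose m1 := germ_scale (W' * X) (W * X') m'.
have m1g : germ q0 m1 by apply: (germ_scale_germ stM hA hB nB).
have s1 := iso_scale Hphi q0L hA hB nB mg0'.
have s2 := iso_scale Hpsi q0L hA hB nB mg0'.
have f1 : ceq (phi q0 m1) (phi q0 m).
  have n5 : ev (phi q0 m').2 (rep q0) != 0 by have [k5 [_ _ _ n5]] := iso_piece Hphi q0L mg0'.
  apply: (ceq_trans s1 (N _ (evM_neq0 nB n5))).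
  have f0 := ceq_sym (ceq_trans e1 (N _ np0) e).
  have := ceq_scale (W' * X) (W * X') (ceq_trans e1' (N _ np0') e') => /= f2.
  apply: (ceq_trans f2 (N _ (evM_neq0 nB nW0'))); apply: (ceq_trans (t := (scf X x, W)) _ (N _ nW0) f0).
  by apply: ceq_same; ring.
have f2 : ceq (psi q0 m1) (psi q0 m).
  exact: (iffRL (iso_eq Hpsi q0L m1g mg0) (iffLR (iso_eq Hphi q0L m1g mg0) f1)).
have f3 : ceq (psi q m) (scf (W' * X) (psi q' m').1, W * X' * (psi q' m').2).
  have n5 : ~ dv l (psi q0 m).2 by have [k5 [_ _ _ n5]] := iso_piece Hpsi q0L mg0; apply: N.
  have n6 : ~ dv l (psi q0 m1).2 by have [k5 [_ _ _ n6]] := iso_piece Hpsi q0L m1g; apply: N.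
  have n7 : ev (psi q0 m').2 (rep q0) != 0 by have [k5 [_ _ _ n7]] := iso_piece Hpsi q0L mg0'.
  apply: (ceq_trans (ceq_sym e2) n5); apply: (ceq_trans (ceq_sym f2) n6).
  exact: (ceq_trans s2 (N _ (evM_neq0 nB n7)) (ceq_scale _ _ e2')).
move=> j; have := f3 j.
rewrite /scf /=; move: ((psi q m).1 j) ((psi q' m').1 j) => y y'.
move: ((psi q m).2) ((psi q' m').2) => z z' h.
rewrite (_ : _ - _ = W * X' * z' * y - z * (W' * X * y')); last by ring.
exact: h.
Qed.

(** [psi] composed with the inverse of [phi] on global sections of the twist by [k]: the local
    images agree by [coherence] and are glued into the polynomials [P]. *)
Lemma transfer k (x : 'I_2 -> S) : hom (k - a) (x 0) -> hom (k - b) (x ord_max) ->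
  exists P : 'I_2 -> S, [/\ hom (k - a') (P 0), hom (k - b') (P ord_max)
    & forall q, on_line q L -> exists m X W n, [/\ germ q m,
        hom n X /\ hom (n + k) W, ev X (rep q) != 0 /\ ev W (rep q) != 0,
        ceq (phi q m) (scf X x, W) & ceq (psi q m) (scf X P, W)]].
Proof.
move=> hx0 hx1; pose T := {q : point R | on_line q L}.
have data (t : T) : exists z : fraction M * S * S * int,
    [/\ germ (val t) z.1.1.1, hom z.2 z.1.1.2 /\ hom (z.2 + k) z.1.2,
     ev z.1.1.2 (rep (val t)) != 0 /\ ev z.1.2 (rep (val t)) != 0
     & ceq (phi (val t) z.1.1.1) (scf z.1.1.2 x, z.1.2)].
  case: t => q qL /=; have [n [X [W [hX hW nX nW]]]] := unit_form q k.
  have [||m mg me] := @iso_surj _ _ _ _ Hphi q (scf X x) W (n + k) qL _ _ hW nW.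
  - by rewrite -addrA; exact: homM hX hx0.
  - by rewrite -addrA; exact: homM hX hx1.
  by exists (m, X, W, n).
have [z zP] := boolp.choice data.
pose m t := (z t).1.1.1; pose X t := (z t).1.1.2; pose W t := (z t).1.2; pose n t := (z t).2.
have ps t : exists k', [/\ hom (k' - a') ((psi (val t) (m t)).1 0),
    hom (k' - b') ((psi (val t) (m t)).1 ord_max), hom k' (psi (val t) (m t)).2
    & ev (psi (val t) (m t)).2 (rep (val t)) != 0].
  by have [mg _ _ _] := zP t; exact: (iso_piece Hpsi (valP t) mg).
have [k' k'P] := boolp.choice ps.
have coh j (t t' : T) : dv l (W t * (psi (val t) (m t)).1 j * (X t' * (psi (val t') (m t')).2) -
    W t' * (psi (val t') (m t')).1 j * (X t * (psi (val t) (m t)).2)).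
  have [mg [hX hW] [nX nW] e] := zP t; have [mg' [hX' hW'] [nX' nW'] e'] := zP t'.
  exact: (coherence (valP t) (valP t') mg mg' hX hW hX' hW' nX nW nX' nW' e e').
have cov v : v != 0 -> dot (val L) v = 0 ->
    exists t : T, ev (X t * (psi (val t) (m t)).2) v != 0.
  move=> v0 Lv; have [c c0 ec] := mkpoint_rep v0.
  have vL : on_line (mkpoint v0) L by rewrite on_lineE ec dotZr Lv mulr0.
  exists (exist _ (mkpoint v0) vL); set t := exist _ _ _.
  have [_ [hX _] [nX _] _] := zP t; have [_ _ hp np] := k'P t.
  have := mulf_neq0 nX np; rewrite -evM /= ec (evZ _ _ (homM hX hp)).
  by apply: contra_neq => ->; rewrite mulr0.
have hg t : hom (n t + k' t) (X t * (psi (val t) (m t)).2).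
  by have [_ [hX _] _ _] := zP t; have [_ _ hp _] := k'P t; apply: homM.
have [|P0 hP0 e0] := glue (D := k - a') (line_neq0 L) hg _ cov (coh 0).
  move=> t; have [_ [_ hW] _ _] := zP t; have [hp _ _ _] := k'P t.
  rewrite (_ : n t + k' t + (k - a') = n t + k + (k' t - a')); last by ring.
  exact: homM.
have [|P1 hP1 e1] := glue (D := k - b') (line_neq0 L) hg _ cov (coh ord_max).
  move=> t; have [_ [_ hW] _ _] := zP t; have [_ hp _ _] := k'P t.
  rewrite (_ : n t + k' t + (k - b') = n t + k + (k' t - b')); last by ring.
  exact: homM.
exists (fun j => if j == 0 then P0 else P1); split=> // q qL.
pose t : T := exist _ q qL; have [mg hXW nXW e] := zP t.
exists (m t), (X t), (W t), (n t); split=> //.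
have E (u v w y o : S) : dv l (u * v - y * (w * o)) -> dv l (u * v - o * (w * y)).
  rewrite (_ : u * v - y * (w * o) = u * v - o * (w * y)); last by ring.
  exact: id.
apply: ord2P; [exact: E (e0 t) | exact: E (e1 t)].
Qed.

End Transfer.
(** A germ is zero when it equals its multiple by the scalar 0, a condition that passes through both
    isomorphisms. *)
Lemma iso_zero (M : gmodule R) a b a' b' phi psi q (m : fraction M) :
  graded_stable M -> @line_iso M a b phi -> @line_iso M a' b' psi ->
  on_line q L -> germ q m ->
  (forall j, dv l ((psi q m).1 j)) -> forall j, dv l ((phi q m).1 j).
Proof.
move=> stM Hphi Hpsi qL mg h j.
have n1 : ev (1 : S) (rep q) != 0 by rewrite /ev meval1 oner_neq0.
have h0 : hom 0 (0 : S) := @hom0 _ 0; have h1 : hom 0 (1 : S) := @hom1 _.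
have mg0 := germ_scale_germ stM h0 h1 n1 mg.
have s1 := iso_scale Hphi qL h0 h1 n1 mg; have s2 := iso_scale Hpsi qL h0 h1 n1 mg.
have [k1 [_ _ _ /(ev_point_Ndv qL) np]] := iso_piece Hphi qL mg.
have [k2 [_ _ _ /(ev_point_Ndv qL) ns]] := iso_piece Hpsi qL mg.
have d (u y : S) : dv l u -> dv l (y * (0 * u) - 1 * y * u).
  rewrite (_ : y * (0 * u) - 1 * y * u = - y * u); last by ring.
  exact: dvMl.
have d' (u y : S) : dv l (y * (0 * u) - 1 * y * u) -> dv l (y * u).
  rewrite (_ : y * (0 * u) - 1 * y * u = - (y * u)); last by ring.
  by move/dvN; rewrite opprK.
have n1s (y : S) : ~ dv l y -> ~ dv l (1 * y) by rewrite mul1r.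
have e0 := ceq_trans s2 (n1s _ ns) (fun j => d _ _ (h j)).
have e1 := iffRL (iso_eq Hphi qL mg0 mg) (iffLR (iso_eq Hpsi qL mg0 mg) e0).
have [k3 [_ _ _ /(ev_point_Ndv qL) np0]] := iso_piece Hphi qL mg0.
have := d' _ _ (ceq_trans (ceq_sym s1) np0 e1 j).
by move/(lf_prime (line_neq0 L)) => [].
Qed.

Lemma ceq_dv s (x : 'I_2 -> S) X W j : ~ dv l W -> ceq s (scf X x, W) ->
  dv l (x j) -> dv l (s.1 j).
Proof.
move=> nW /(_ j) /= e xj; have : dv l (W * s.1 j).
  by rewrite -(subrK (s.2 * scf X x j) (W * s.1 j)); apply: dvD => //; apply/dvMl/dvMl.
by move/(lf_prime (line_neq0 L)) => [].
Qed.

Lemma ceq_Ndv s (x : 'I_2 -> S) X W j : ~ dv l X -> ~ dv l s.2 ->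
  ceq s (scf X x, W) -> dv l (s.1 j) -> dv l (x j).
Proof.
move=> nX ns /(_ j) /= e sj; have : dv l (s.2 * (X * x j)).
  by have := dvB (dvMl W sj) e; rewrite opprB addrC subrK.
by do 2!move/(lf_prime (line_neq0 L)) => [//|].
Qed.

Lemma some_point : exists q, on_line q L.
Proof. by have [//|//|q [qL _]] := @common_point [::]; exists q. Qed.

Definition basis2 (i j : 'I_2) : S := if j == i then 1 else 0.

Section Compare.
Variables (M : gmodule R) (a b a' b' : int).
Variables (phi psi : point R -> fraction M -> frac).
Hypotheses (stM : graded_stable M) (ab' : a' <= b').
Hypotheses (Hphi : @line_iso M a b phi) (Hpsi : @line_iso M a' b' psi).

Let Ndv1 : ~ dv l 1. Proof. exact/lf_Ndv1/line_neq0. Qed.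

Let transfer0 : exists P : 'I_2 -> S, [/\ hom (a - a') (P 0), hom (a - b') (P ord_max)
    & forall q, on_line q L -> exists m X W n, [/\ germ q m,
        hom n X /\ hom (n + a) W, ev X (rep q) != 0 /\ ev W (rep q) != 0,
        ceq (phi q m) (scf X (basis2 0), W) & ceq (psi q m) (scf X P, W)]].
Proof.
apply: (transfer stM Hphi Hpsi); last exact: hom0.
rewrite subrr; exact: hom1.
Qed.

Let P0_neq0 (P : 'I_2 -> S) q m X W : on_line q L -> germ q m ->
  ev X (rep q) != 0 -> ev W (rep q) != 0 ->
  ceq (phi q m) (scf X (basis2 0), W) -> ceq (psi q m) (scf X P, W) ->
  (forall j, P j = 0) -> False.
Proof.
move=> qL mg nX nW e1 e2 P0.
have NW := ev_point_Ndv qL nW; have NX := ev_point_Ndv qL nX.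
have h0 : forall j, dv l ((psi q m).1 j).
  by move=> j; apply: (ceq_dv NW e2); rewrite P0; apply: dv0.
have h1 := iso_zero stM Hphi Hpsi qL mg h0.
have [k1 [_ _ _ /(ev_point_Ndv qL) np]] := iso_piece Hphi qL mg.
exact: Ndv1 (ceq_Ndv NX np e1 (h1 0)).
Qed.

(** Otherwise the first basis section, of degree [a], would go to components of negative degrees
    [a - a'] and [a - b'], hence to zero, against injectivity. *)
Lemma line_iso_le1 : a' <= a.
Proof.
rewrite leNgt; apply/negP => aa'.
have [q qL] := some_point.
have [P [hP0 hP1 H]] := transfer0.
have [m [X [W [n [mg _ [nX nW] e1 e2]]]]] := H q qL.
apply: (P0_neq0 qL mg nX nW e1 e2).
apply: ord2P; [apply: (hom_neg _ hP0) | apply: (hom_neg _ hP1)].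
  by rewrite subr_lt0.
by rewrite subr_lt0; apply: lt_le_trans ab'.
Qed.

(** If [b < b'], both basis sections land in the first summand, where the first one becomes a
    nonzero constant. The second would then be a multiple of the first. *)
Lemma line_iso_le2 : a = a' -> a <= b -> b' <= b.
Proof.
move=> aa ab; rewrite leNgt; apply/negP => bb'.
have [q qL] := some_point.
have [P [hP0 hP1 H]] := transfer0.
have [m [X [W [n [mg [hX hW] [nX nW] e1 e2]]]]] := H q qL.
have P1 : P ord_max = 0 by apply: (hom_neg _ hP1); rewrite subr_lt0; apply: le_lt_trans bb'.
have [||Q [hQ0 hQ1 HQ]] := transfer stM Hphi Hpsi (k := b) (x := basis2 ord_max).
- exact: hom0.
- rewrite subrr; exact: hom1.
have Q1 : Q ord_max = 0 by apply: (hom_neg _ hQ1); rewrite subr_lt0.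
have [m' [X' [W' [n' [mg' [hX' hW'] [nX' nW'] e1' e2']]]]] := HQ q qL.
have [c0|c0] := eqVneq (P 0) 0.
  by apply: (P0_neq0 qL mg nX nW e1 e2); apply: ord2P.
have evc v : ev (P 0) v != 0.
  move: hP0; rewrite aa subrr => /hom0C e; rewrite e evC.
  by apply: contraNneq c0 => c0; rewrite e c0 mpolyC0.
(* [A / B] is the ratio of the images of the two basis sections, so scaling [m] by it gives a germ
   with the image of [m']. *)
pose A := Q 0 * X' * W; pose B := P 0 * X * W'.
have hA : hom (n + n' + b) A.
  rewrite (_ : n + n' + b = b - a' + n' + (n + a)); last by rewrite aa; ring.
  exact: homM (homM hQ0 hX') hW.
have hB : hom (n + n' + b) B.
  rewrite (_ : n + n' + b = a - a' + n + (n' + b)); last by rewrite aa; ring.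
  exact: homM (homM hP0 hX) hW'.
have nB : ev B (rep q) != 0 := evM_neq0 (evM_neq0 (evc _) nX) nW'.
have mg1 := germ_scale_germ stM hA hB nB mg.
have s1 := iso_scale Hphi qL hA hB nB mg; have s2 := iso_scale Hpsi qL hA hB nB mg.
have [k1 [_ _ _ np]] := iso_piece Hphi qL mg.
have [k2 [_ _ _ ns]] := iso_piece Hpsi qL mg.
have [k3 [_ _ _ np']] := iso_piece Hphi qL mg'.
have [k4 [_ _ _ np1]] := iso_piece Hphi qL mg1.
have N g : ev g (rep q) != 0 -> ~ dv l g by exact: ev_point_Ndv.
have f0 : ceq (scf A (scf X P), B * W) (scf X' Q, W').
  apply: ord2P; rewrite /scf /=.
    rewrite /A /B; exists 0; move: (P 0) (Q 0) => u v; ring.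
  by rewrite P1 Q1; exists 0; ring.
have f1 := ceq_trans s2 (N _ (evM_neq0 nB ns)) (ceq_scale A B e2).
have f2 := ceq_trans f1 (N _ (evM_neq0 nB nW)) f0.
have f3 := ceq_trans f2 (N _ nW') (ceq_sym e2').
have f4 := iffRL (iso_eq Hphi qL mg1 mg') (iffLR (iso_eq Hpsi qL mg1 mg') f3).
have g1 := ceq_trans s1 (N _ (evM_neq0 nB np)) (ceq_scale A B e1).
have g2 := ceq_trans (ceq_sym g1) (N _ np1) (ceq_trans f4 (N _ np') e1').
have E (u1 u2 u3 u4 u5 u6 : S) :
    dv l (u1 * (u2 * (u3 * 0)) - u4 * u5 * (u6 * 1)) -> dv l (u4 * u5 * u6).
  move/dvN.
  rewrite (_ : - (u1 * (u2 * (u3 * 0)) - u4 * u5 * (u6 * 1)) = u4 * u5 * u6); last by ring.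
  exact: id.
have := g2 ord_max; rewrite /scf /basis2 /= => h.
move: (E _ _ _ _ _ _ h); exact/N/(evM_neq0 (evM_neq0 nB nW) nX').
Qed.

End Compare.

Lemma splitting_unique (M : gmodule R) a b a' b' : graded_stable M ->
  splitting_type M L a b -> splitting_type M L a' b' -> a = a' /\ b = b'.
Proof.
move=> stM [ab /(sheaf_line_iso stM)[phi Hphi]] [ab' /(sheaf_line_iso stM)[psi Hpsi]].
have {}stM : graded_stable (restrict_gmodule L M) := stM.
have aa : a = a'.
  apply/eqP; rewrite eq_le.
  by rewrite (line_iso_le1 stM ab' Hphi Hpsi) (line_iso_le1 stM ab Hpsi Hphi).
split=> //; apply/eqP; rewrite eq_le.
rewrite (line_iso_le2 stM Hphi Hpsi aa ab) (line_iso_le2 stM Hpsi Hphi (esym aa) ab') //.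
Qed.

End Line.

Lemma AR_stable (f : S) t : graded_stable (AR_gmodule f t).
Proof.
move=> k m h x /homogeneousE hh /ARdegE[hx dx]; apply/ARdegE; split.
  by rewrite -addrA; apply: homvZ.
by rewrite derZl dx mulr0.
Qed.

Lemma mk_line (v : 'rV[C]_3) : v != 0 -> exists L : line R, val L = v.
Proof. by move=> v0; exists (exist _ v v0). Qed.

Lemma generic_unique (f : S) t a b a' b' :
  generic_splitting_type (AR_gmodule f t) a b ->
  generic_splitting_type (AR_gmodule f t) a' b' -> a = a' /\ b = b'.
Proof.
move=> [k [G [_ G0 hG]]] [k' [G' [_ G0' hG']]].
(* The variable excludes the zero vector, which is not a line; [G] and [G'] may be constants. *)
have [v] : exists v, ev (G * G' * 'X_o0) v != 0.
  apply: contrapT => h; have : G * G' * 'X_o0 = 0.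
    by apply: ev_vanish => v; apply: contrapT => /eqP hv; apply: h; exists v.
  apply/eqP; rewrite !mulf_neq0 //; apply/negP => /eqP h0.
  have := congr1 (fun g => ev g (\row_j 1)) h0.
  by rewrite /ev mevalXU mxE meval0 => /eqP; rewrite oner_eq0.
rewrite !evM !mulf_eq0 !negb_or => /andP[/andP[nG nG'] nX].
have v0 : v != 0 by apply: contraNneq nX => ->; rewrite /ev mevalXU mxE.
have [L eL] := mk_line v0.
apply: (splitting_unique (L := L) (@AR_stable f t)); [apply: hG | apply: hG'];
  by rewrite eL.
Qed.

End Uniqueness.

(** * Presentations attached to a pencil *)

Section PencilPresentation.
Variable F : numClosedFieldType.
Local Notation S := {mpoly F[3]}.

Definition tri (T : Type) (x y z : T) (j : 'I_3) : T :=
  if val j is 0%N then x else if val j is 1%N then y else z.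

(* [f] is a product of [m] lines through the nearly modular point and [n] other
   lines; [lf b1] and [lf b2] are the two lines through the exceptional double
   point, which is [cross b1 b2]. *)
Record pencil_pres (f : S) (m n : nat) (b1 b2 : 'rV[F]_3) (g1 g2 g3 : 'rV[S]_3)
    (al : S) : Prop := PencilPres {
  pp_P : cross b1 b2 != 0;
  pp_hom1 : homv m g1;
  pp_hom2 : homv m g2;
  pp_hom3 : homv n g3;
  pp_homal : hom (m%:Z + 1 - n%:Z) al;
  pp_der1 : der g1 f = 0;
  pp_der2 : der g2 f = 0;
  pp_der3 : der g3 f = 0;
  pp_rel : lf b2 *: g1 - lf b1 *: g2 = al *: g3;
  pp_gen : forall r, der r f = 0 ->
    exists c1 c2 c3, r = c1 *: g1 + c2 *: g2 + c3 *: g3;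
  pp_rels : forall c1 c2 c3, c1 *: g1 + c2 *: g2 + c3 *: g3 = 0 ->
    exists e, [/\ c1 = e * lf b2, c2 = - (e * lf b1) & c3 = - (e * al)];
  pp_al : ev al (cross b1 b2) != 0
}.

Lemma homCM (c : F) k (h : S) : hom k h -> hom k (c%:MP * h).
Proof. by move=> hh; rewrite mul_mpolyC; apply: homZ. Qed.

Lemma ord3P (P : 'I_3 -> Prop) : P o0 -> P o1 -> P o2 -> forall j, P j.
Proof.
move=> h0 h1 h2 [[|[|[|//]]] j3].
- by rewrite (_ : Ordinal j3 = o0) //; apply: val_inj.
- by rewrite (_ : Ordinal j3 = o1) //; apply: val_inj.
- by rewrite (_ : Ordinal j3 = o2) //; apply: val_inj.
Qed.

Lemma lin_tri (g1 g2 g3 c : 'rV[S]_3) :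
  lin (tri g1 g2 g3) c = c 0 o0 *: g1 + c 0 o1 *: g2 + c 0 o2 *: g3.
Proof. exact: sum3E. Qed.

Section Matrices.
Variables (f : S) (m n : nat) (b1 b2 : 'rV[F]_3) (g1 g2 g3 : 'rV[S]_3) (al : S).
Hypothesis H : pencil_pres f m n b1 b2 g1 g2 g3 al.
Local Notation P := (cross b1 b2).
Local Notation g := (tri g1 g2 g3).
Local Notation e := (tri m%:Z m%:Z n%:Z).
Let r : 'rV[S]_3 := vec3 (lf b2) (- lf b1) (- al).

Lemma pp_gen_hom k x : homv k x -> der x f = 0 ->
  exists2 c, homs e k c & x = lin g c.
Proof.
move=> hx dx; have [c1 [c2 [c3 ex]]] := pp_gen H dx.
exists (vec3 (homp (k - m%:Z) c1) (homp (k - m%:Z) c2) (homp (k - n%:Z) c3)).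
  by apply: ord3P; rewrite mxE /=; apply: homp_hom.
rewrite lin_tri !mxE /=; apply/rowP => i; rewrite -(homp_id (hx i)) ex !mxE !hompD.
have E (c h : S) (l : int) : hom l h -> homp k (c * h) = homp (k - l) c * h.
  by move=> hh; rewrite mulrC -{1}(subrK l k) addrC (hompM _ _ hh) mulrC.
have h1 : homv m g1 := pp_hom1 H; have h2 : homv m g2 := pp_hom2 H.
have h3 : homv n g3 := pp_hom3 H.
by rewrite (E _ _ _ (h1 i)) (E _ _ _ (h2 i)) (E _ _ _ (h3 i)).
Qed.

Lemma pp_lin_rel : lin g r = 0.
Proof.
rewrite lin_tri !mxE /= !scaleNr; apply/eqP; rewrite subr_eq0; apply/eqP.
exact: (pp_rel H).
Qed.

Lemma pp_lin_rels c : lin g c = 0 -> exists h, c = h *: r.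
Proof.
rewrite lin_tri => /(pp_rels H)[h [h1 h2 h3]]; exists h.
by apply: row3P; rewrite [RHS]mxE [in RHS]mxE /= ?mulrN.
Qed.

(** Away from [P] one of the two lines is nonzero, and at [P] it is [al]. *)
Lemma pp_zero v : v != 0 -> exists j, ev (r 0 j) v != 0.
Proof.
move=> v0; have [w2|w2] := eqVneq (dot b2 v) 0; last first.
  by exists o0; rewrite mxE /= ev_lf.
have evN (h : S) u : ev (- h) u = - ev h u by rewrite /ev mevalN.
have [w1|w1] := eqVneq (dot b1 v) 0; last first.
  by exists o1; rewrite mxE /= evN ev_lf oppr_eq0.
exists o2; rewrite mxE /= evN oppr_eq0.
have [c [x [y [_ _ _ _ ex]]]] := dual_basis (pp_P H).
have ev_ : v = dot c v *: P by rewrite {1}[v]ex w1 w2 !scale0r !add0r.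
rewrite ev_ (evZ _ _ (pp_homal H)) mulf_neq0 ?(pp_al H) // expf_neq0 //.
by apply: contraNneq v0 => c0; rewrite ev_ c0 scale0r.
Qed.

Lemma pp_presentation a (q1 q2 : 'rV[S]_3) (a1 a2 : int) : a != 0 ->
  a1 + a2 = m%:Z + n%:Z - 1 ->
  (forall j, hom (e j - a1) (q1 0 j)) -> (forall j, hom (e j - a2) (q2 0 j)) ->
  (forall j, dv (lf a) (cross q1 q2 0 j - r 0 j)) ->
  presentation f a g e r q1 q2 a1 a2.
Proof.
move=> a0 ea h1 h2 hr; split=> //.
- by apply: ord3P; [exact: pp_hom1 H | exact: pp_hom2 H | exact: pp_hom3 H].
- by apply: ord3P; [exact: pp_der1 H | exact: pp_der2 H | exact: pp_der3 H].
- exact: pp_gen_hom.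
- exact: pp_lin_rel.
- exact: pp_lin_rels.
- have -> : e o0 + e o1 + e o2 - a1 - a2 = m%:Z + 1.
    by rewrite -addrA -opprD ea /=; ring.
  apply: ord3P; rewrite mxE /=.
  + by rewrite addrC addKr; apply: hom_lf.
  + by rewrite addrC addKr; apply/homN/hom_lf.
  + exact/homN/(pp_homal H).
- by move=> v v0 _; apply: pp_zero.
Qed.

(** Reorders the degrees when [n = m], where [pres_generic] yields them in decreasing order. *)
Lemma cross_swap (a : 'rV[F]_3) (q1 q2 : 'rV[S]_3) a1 a2 :
  presentation f a g e r q1 q2 a1 a2 -> presentation f a g e r q2 (- q1) a2 a1.
Proof.
move=> h; split.
- exact: pres_neq0 h.
- exact: pres_hom h.
- exact: pres_der h.
- exact: pres_gen h.
- exact: pres_rel h.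
- exact: pres_rels h.
- by have := pres_homr h; rewrite addrAC.
- exact: pres_hom2 h.
- by move=> j; rewrite mxE; apply/homN/(pres_hom1 h).
- have E (K : comPzRingType) (u v : 'rV[K]_3) : cross v (- u) = cross u v.
    by apply: row3P; rewrite !mxE /=; ring.
  by rewrite E; apply: pres_cross h.
- exact: pres_zero h.
Qed.

Lemma pp_al_neq0 : al != 0.
Proof. by apply: contraNneq (pp_al H) => ->; rewrite /ev meval0. Qed.

Lemma pp_le : (n <= m.+1)%N.
Proof.
rewrite leqNgt; apply/negP => mn; move/eqP: pp_al_neq0; apply.
by apply: hom_neg (pp_homal H); lia.
Qed.

(** [al] is a nonzero constant, and dividing by it writes [r] as an exact cross product, whatever
    the line. *)
Lemma pres_free a : a != 0 -> n = m.+1 -> exists q1 q2, presentation f a g e r q1 q2 m m.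
Proof.
move=> a0 nm; have hal : hom 0 al.
  by rewrite (_ : 0 = m%:Z + 1 - n%:Z); [exact: pp_homal H | lia].
have [c ec] : exists c, al = c%:MP by exists (al@_0%MM); apply: hom0C.
have c0 : c != 0 by apply: contraNneq pp_al_neq0 => c0; rewrite ec c0 mpolyC0.
exists (vec3 (- al) 0 (- lf b2)), (vec3 0 1 (- (c^-1%:MP * lf b1))).
apply: pp_presentation => //; first by rewrite nm intS; ring.
- apply: ord3P; rewrite mxE /=.
  + by rewrite subrr; apply: homN.
  + exact: hom0.
  + by rewrite nm intS addrK; apply/homN/hom_lf.
- apply: ord3P; rewrite mxE /=.
  + exact: hom0.
  + by rewrite subrr; apply: hom1.
  + by rewrite nm intS addrK; apply/homN/homCM/hom_lf.
have e1 : al * c^-1%:MP = 1 by rewrite ec -mpolyCM mulfV // mpolyC1.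
have E (K : comPzRingType) (x y z u : K) : x * u = 1 ->
    cross (vec3 (- x) 0 (- y)) (vec3 0 1 (- (u * z))) = vec3 y (- z) (- x).
  move=> xu; apply: row3P; rewrite !mxE /=; try ring.
  by rewrite mulr0 sub0r mulNr mulrN opprK mulrA xu mul1r.
by move=> j; rewrite (E _ _ _ _ _ e1) subrr; apply: dv0.
Qed.

(** The line misses [P], so subtracting a suitable multiple of a power of [lf a] makes [al] vanish
    at [P]. Modulo [lf a] it is then a combination of [lf b1] and [lf b2], whose cofactors [A] and
    [B] fill one of the two vectors. *)
Lemma pres_generic a : (n <= m)%N -> dot a P != 0 ->
  exists q1 q2, presentation f a g e r q1 q2 n (m%:Z - 1).
Proof.
move=> nm aP; have a0 : a != 0 by apply: contraNneq aP => ->; rewrite dot0l.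
have lc : exists2 D : nat, m%:Z + 1 - n%:Z = D.+1%:Z & (m - n)%N = D.
  by exists (m - n)%N; lia.
have [D eD eD'] := lc; have hal := pp_homal H; rewrite eD in hal.
pose c := ev al P / dot a P ^+ D.+1.
have haD : hom D.+1 (c%:MP * lf a ^+ D.+1).
  apply: homCM.
  by have := homX_exp (n := D.+1) (@hom_lf _ a); rewrite mulr1.
have [|A [B [hA hB eAB]]] := ideal_hom (pp_P H) (homB hal haD).
  rewrite evB evM evC /ev rmorphXn /= -!/(ev _ _) ev_lf /c divfK ?subrr //.
  by rewrite expf_neq0.
have hD : D.+1%:Z - 1 = m%:Z - n%:Z by lia.
rewrite hD in hA hB.
exists (vec3 (- B) A (- 1)), (vec3 (lf b1) (lf b2) 0).
apply: pp_presentation => //; first by ring.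
- apply: ord3P; rewrite mxE /=.
  + exact: homN.
  + exact: hA.
  + by rewrite subrr; apply/homN/hom1.
- have E1 : m%:Z - (m%:Z - 1) = 1 by ring.
  apply: ord3P; rewrite mxE /=.
  + by rewrite E1; apply: hom_lf.
  + by rewrite E1; apply: hom_lf.
  + exact: hom0.
have E (K : comPzRingType) (x y u v : K) :
    cross (vec3 (- v) u (- 1)) (vec3 x y 0) = vec3 y (- x) (- (x * u + y * v)).
  by apply: row3P; rewrite !mxE /=; ring.
rewrite E; apply: ord3P; rewrite mxE /=.
- by rewrite [r 0 o0]mxE subrr; apply: dv0.
- by rewrite [r 0 o1]mxE subrr; apply: dv0.
- rewrite [r 0 o2]mxE /= -eAB exprS.
  exists (c%:MP * lf a ^+ D); ring.
Qed.

(** On a line through [P] the forms [lf b1] and [lf b2] are proportional: either the first one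
    vanishes, or the second is [t] times the first. The constant [t] lowers one of the degrees. *)
Lemma pres_special a : a != 0 -> dot a P = 0 ->
  exists q1 q2, presentation f a g e r q1 q2 (n%:Z - 1) m.
Proof.
move=> a0 aP; have [k [l ea]] := pencil_expand (pp_P H) aP.
have lfa : lf a = k%:MP * lf b1 + l%:MP * lf b2 by rewrite ea lfD !lfZ.
have hal : hom (m%:Z - (n%:Z - 1)) al.
  by rewrite (_ : _ - _ = m%:Z + 1 - n%:Z); [exact: pp_homal H | ring].
have E1 : n%:Z - (n%:Z - 1) = 1 by ring.
have [l0|l0] := eqVneq l 0.
  have k0 : k != 0 by apply: contraNneq a0 => k0; rewrite ea k0 l0 !scale0r addr0.
  exists (vec3 (- al) 0 (- lf b2)), (vec3 0 1 0).
  apply: pp_presentation => //; first by ring.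
  - apply: ord3P; rewrite mxE /=; [exact: homN | exact: hom0 |].
    by rewrite E1; apply/homN/hom_lf.
  - apply: ord3P; rewrite mxE /=; [exact: hom0 | | exact: hom0].
    by rewrite subrr; apply: hom1.
  have E (K : comPzRingType) (x y : K) :
      cross (vec3 (- x) 0 (- y)) (vec3 0 1 0) = vec3 y 0 (- x).
    by apply: row3P; rewrite !mxE /=; ring.
  rewrite E; apply: ord3P; rewrite mxE /=.
  - by rewrite [r 0 o0]mxE subrr; apply: dv0.
  - rewrite [r 0 o1]mxE /=; exists (k^-1%:MP).
    rewrite lfa l0 mpolyC0.
    have ek : k%:MP * k^-1%:MP = 1 :> S by rewrite -mpolyCM mulfV // mpolyC1.
    by rewrite -[LHS]mul1r -ek; ring.
  - by rewrite [r 0 o2]mxE subrr; apply: dv0.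
pose t := - (k / l).
exists (vec3 0 al (- lf b1)), (vec3 1 t%:MP 0).
apply: pp_presentation => //; first by ring.
- apply: ord3P; rewrite mxE /=; [exact: hom0 | exact: hal |].
  by rewrite E1; apply/homN/hom_lf.
- apply: ord3P; rewrite mxE /=; [| | exact: hom0].
    by rewrite subrr; apply: hom1.
  by rewrite subrr; apply: homC.
have E (K : comPzRingType) (x y u : K) :
    cross (vec3 0 x (- y)) (vec3 1 u 0) = vec3 (u * y) (- y) (- x).
  by apply: row3P; rewrite !mxE /=; ring.
rewrite E; apply: ord3P; rewrite mxE /=.
- rewrite [r 0 o0]mxE /=; exists (- l^-1%:MP).
  rewrite lfa /t mpolyCN mpolyCM.
  have el : l%:MP * l^-1%:MP = 1 :> S by rewrite -mpolyCM mulfV // mpolyC1.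
  by rewrite -[X in _ - X = _]mul1r -el; ring.
- by rewrite [r 0 o1]mxE subrr; apply: dv0.
- by rewrite [r 0 o2]mxE subrr; apply: dv0.
Qed.

End Matrices.
End PencilPresentation.

(** * Splitting types, exponents and jumping point *)

Section LinearCombinations.
Variables (K : comPzRingType) (V : lmodType K).
Implicit Types (x y z : V) (c d u v : K).

Lemma comb_sub2 x y c1 c2 c3 u v :
  c1 *: x + c2 *: y + c3 *: (u *: x - v *: y) = (c1 + c3 * u) *: x + (c2 - c3 * v) *: y.
Proof.
rewrite scalerBr !scalerA scalerDl scalerBl -!addrA; congr (_ + _).
by rewrite addrCA.
Qed.

Lemma comb_diff2 x y z c1 c2 d1 d2 : c1 *: x + c2 *: y = d1 *: x + d2 *: y ->
  (c1 - d1) *: x + (c2 - d2) *: y + 0 *: z = 0.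
Proof.
move=> e; rewrite scale0r addr0 !scalerBl addrACA e -opprD; exact: subrr.
Qed.

Lemma comb_diff3 x y z c1 c2 c3 d1 d2 d3 :
  c1 *: x + c2 *: y + c3 *: z = d1 *: x + d2 *: y + d3 *: z ->
  (c1 - d1) *: x + (c2 - d2) *: y + (c3 - d3) *: z = 0.
Proof.
move=> e; rewrite !scalerBl [X in X + _]addrACA -opprD addrACA e -opprD; exact: subrr.
Qed.

Lemma comb_lin3 x y z c c1 c2 c3 d1 d2 d3 :
  c *: (c1 *: x + c2 *: y + c3 *: z) + (d1 *: x + d2 *: y + d3 *: z) =
  (c * c1 + d1) *: x + (c * c2 + d2) *: y + (c * c3 + d3) *: z.
Proof.
rewrite !scalerDr !scalerA !scalerDl addrACA; congr (_ + _).
exact: addrACA.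
Qed.

Lemma comb_e1 y z : 1 *: 0 + 0 *: y + 0 *: z = 0.
Proof. by rewrite scaler0 !scale0r !addr0. Qed.

Lemma comb_e3 x y : 0 *: x + 0 *: y + 1 *: 0 = 0.
Proof. by rewrite scaler0 !scale0r !addr0. Qed.

Lemma comb_z3 x y z c : c *: z = 0 *: x + 0 *: y + c *: z.
Proof. by rewrite !scale0r !add0r. Qed.

Lemma comb_z12 x y z c d : c *: x + d *: y = c *: x + d *: y + 0 *: z.
Proof. by rewrite scale0r addr0. Qed.

Lemma comb_ker x y z c c3 u v : u *: x - v *: y = c *: z -> forall e,
  (e * u) *: x + (- (e * v)) *: y + c3 *: z = (e * c + c3) *: z.
Proof.
move=> h e; rewrite scalerDl -[(e * c) *: z]scalerA -h scalerBr !scalerA scaleNr //.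
Qed.

End LinearCombinations.

Section PencilResults.
Variable R : realType.
Local Notation C := R[i].
Local Notation S := (poly3 R).
Variables (f : S) (m n : nat) (b1 b2 : 'rV[C]_3) (g1 g2 g3 : 'rV[S]_3) (al : S).
Hypothesis H : pencil_pres f m n b1 b2 g1 g2 g3 al.
Local Notation P := (cross b1 b2).
Implicit Types (L : line R) (t : int).

Lemma splitting_free L t : n = m.+1 -> splitting_type (AR_gmodule f t) L (m%:Z - t) (m%:Z - t).
Proof.
move=> nm; have [q1 [q2 h]] := pres_free H (line_neq0 L) nm.
exact: splitting_of_presentation h _.
Qed.

Lemma splitting_lt L t : (n < m)%N -> dot (val L) P != 0 ->
  splitting_type (AR_gmodule f t) L (n%:Z - t) (m%:Z - 1 - t).
Proof.
move=> nm LP; have [q1 [q2 h]] := pres_generic H (ltnW nm) LP.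
by apply: splitting_of_presentation h _; lia.
Qed.

Lemma splitting_special L t : (n <= m.+1)%N -> dot (val L) P = 0 ->
  splitting_type (AR_gmodule f t) L (n%:Z - 1 - t) (m%:Z - t).
Proof.
move=> nm LP; have [q1 [q2 h]] := pres_special H (line_neq0 L) LP.
by apply: splitting_of_presentation h _; lia.
Qed.

Lemma splitting_eq L t : n = m ->
  splitting_type (AR_gmodule f t) L (m%:Z - 1 - t) (m%:Z - t).
Proof.
move=> nm; have [LP|LP] := eqVneq (dot (val L) P) 0.
  have := splitting_special t _ LP; rewrite nm; apply.
  exact: leqnSn.
have [|q1 [q2 h]] := pres_generic H _ LP; first by rewrite nm.
have := splitting_of_presentation t (cross_swap h).
rewrite nm; apply; lia.
Qed.

(** The generic type depends only on the numbers of lines through and off the nearly modular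
    point. *)
Definition gtype (m n : nat) : int * int :=
  if n == m.+1 then (m%:Z, m%:Z)
  else if n == m then (m%:Z - 1, m%:Z) else (n%:Z, m%:Z - 1).

Lemma generic_all (M : gmodule R) a b : (forall L, splitting_type M L a b) ->
  generic_splitting_type M a b.
Proof.
by move=> h; exists 0%N, 1; split; [exact: dhomog1 | exact: oner_neq0 | move=> L _; apply: h].
Qed.

Lemma generic_gtype t :
  generic_splitting_type (AR_gmodule f t) ((gtype m n).1 - t) ((gtype m n).2 - t).
Proof.
rewrite /gtype; case: eqP => [nm|nm] /=.
  by apply: generic_all => L; apply: splitting_free.
case: eqP => [nm'|nm'] /=.
  by apply: generic_all => L; apply: splitting_eq.
have lt : (n < m)%N by have := pp_le H; lia.
(* The lines to exclude are those through [P]; in the dual plane they form the line with equation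
   [lf P]. *)
exists 1%N, (lf P); split.
- by apply/hom_dhomog/hom_lf.
- exact: lf_neq0 (pp_P H).
move=> L; rewrite -/(ev _ _) ev_lf dotC => LP; exact: splitting_lt.
Qed.

Let g1_neq0 : g1 != 0.
Proof.
apply/negP => /eqP h.
have [|e [e1 _ _]] := pp_rels H (c1 := 1) (c2 := 0) (c3 := 0).
  by rewrite h; exact: comb_e1.
have b20 : b2 != 0.
  apply/negP => /eqP b20; move: (pp_P H); rewrite b20.
  have -> : cross b1 0 = 0 by apply: row3P; rewrite !mxE /=; ring.
  by rewrite eqxx.
by apply: (lf_Ndv1 b20); rewrite e1; apply/dvMl/dvv.
Qed.

Let b2_neq0 : b2 != 0.
Proof.
apply/negP => /eqP b20; move: (pp_P H); rewrite b20.
have -> : cross b1 0 = 0 by apply: row3P; rewrite !mxE /=; ring.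
by rewrite eqxx.
Qed.

Lemma g3_neq0 : g3 != 0.
Proof.
apply/negP => /eqP h.
have [|e [e1 _ e3]] := pp_rels H (c1 := 0) (c2 := 0) (c3 := 1).
  by rewrite h; exact: comb_e3.
move/esym/eqP: e1; rewrite mulf_eq0 (negPf (lf_neq0 b2_neq0)) orbF => /eqP e0.
by move/eqP: e3; rewrite e0 mul0r oppr0 oner_eq0.
Qed.

Lemma pp_small k x : (k < m%:Z)%R -> (k < n%:Z)%R -> ARdeg f k x -> x = 0.
Proof.
move=> km kn /ARdegE[hx dx]; have [c hc ->] := pp_gen_hom H hx dx.
rewrite lin_tri.
have -> : c 0 o0 = 0 by apply: hom_neg (hc o0); rewrite subr_lt0.
have -> : c 0 o1 = 0 by apply: hom_neg (hc o1); rewrite subr_lt0.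
have -> : c 0 o2 = 0 by apply: hom_neg (hc o2); rewrite subr_lt0.
by rewrite !scale0r !addr0.
Qed.

Lemma mdr_nearly_free : (n <= m)%N -> is_mdr f n.
Proof.
move=> nm; split.
  exists g3; first exact: g3_neq0.
  by apply/ARdegE; split; [exact: pp_hom3 H | exact: pp_der3 H].
by move=> k kn x; apply: pp_small; lia.
Qed.

Lemma mdr_free : n = m.+1 -> is_mdr f m.
Proof.
move=> nm; split.
  exists g1; first exact: g1_neq0.
  by apply/ARdegE; split; [exact: pp_hom1 H | exact: pp_der1 H].
by move=> k kn x; apply: pp_small; lia.
Qed.

(** [al] is invertible, so the relation eliminates [g3]; a relation without [g3] has [e * al = 0],
    hence is trivial. *)
Lemma free_basis : n = m.+1 -> exists (k : nat) (e : 'I_k -> nat) (b : 'I_k -> 'rV[S]_3),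
    (forall i, ARdeg f (e i)%:Z (b i)) /\
    forall rho, AR f rho ->
      exists! c : 'rV[S]_k, rho = \sum_(i < k) c 0 i *: b i.
Proof.
move=> nm; have hal : hom 0 al.
  by rewrite (_ : 0 = m%:Z + 1 - n%:Z); [exact: pp_homal H | lia].
have [c ec] : exists c, al = c%:MP by exists (al@_0%MM); apply: hom0C.
have c0 : c != 0 by apply: contraNneq (pp_al_neq0 H) => c0; rewrite ec c0 mpolyC0.
have e1 : c^-1%:MP * al = 1 by rewrite ec -mpolyCM mulVf // mpolyC1.
have eg3 : g3 = (c^-1%:MP * lf b2) *: g1 - (c^-1%:MP * lf b1) *: g2.
  by rewrite -2!scalerA -scalerBr (pp_rel H) scalerA e1 scale1r.
pose b (i : 'I_2) := if i == 0 then g1 else g2.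
have sumE (c' : 'rV[S]_2) : \sum_(i < 2) c' 0 i *: b i = c' 0 0 *: g1 + c' 0 ord_max *: g2.
  rewrite !big_ord_recl big_ord0 addr0 /b /=.
  by congr (_ + c' _ _ *: _); apply: val_inj.
exists 2%N, (fun _ => m), b; split.
  by apply: ord2P; apply/ARdegE; split;
    [exact: pp_hom1 H | exact: pp_der1 H | exact: pp_hom2 H | exact: pp_der2 H].
move=> rho hr; have [c1 [c2 [c3 er]]] := pp_gen H hr.
exists (vec2 (c1 + c3 * (c^-1%:MP * lf b2)) (c2 - c3 * (c^-1%:MP * lf b1))); split.
  by rewrite sumE vec20 vec21 er eg3; exact: comb_sub2.
move=> d; rewrite sumE => ed.
set u1 := c1 + _; set u2 := c2 - _.
have eu : rho = u1 *: g1 + u2 *: g2.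
  by rewrite er eg3; exact: comb_sub2.
have [|e [h1 h2 h3]] := pp_rels H (c1 := u1 - d 0 0) (c2 := u2 - d 0 ord_max) (c3 := 0).
  exact: comb_diff2 (etrans (esym eu) ed).
have e0 : e = 0.
  move/esym/eqP: h3; rewrite oppr_eq0 mulf_eq0 (negPf (pp_al_neq0 H)) orbF => /eqP //.
move: h1 h2; rewrite e0 !mul0r oppr0 => /subr0_eq h1 /subr0_eq h2.
by apply: row2P; rewrite ?vec20 ?vec21.
Qed.

Lemma is_mdr_uniq (f' : S) r r' : is_mdr f' r -> is_mdr f' r' -> r = r'.
Proof.
move=> [[x x0 hx] hr] [[y y0 hy] hr']; case: (ltngtP r r') => // lt.
  by move/eqP: x0; case; apply: hr' lt _ hx.
by move/eqP: y0; case; apply: hr lt _ hy.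
Qed.

Lemma point_idealE (Q : point R) g : point_ideal Q g <-> forall k, ev g (k *: rep Q) = 0.
Proof.
split=> [h k|h v].
  by apply: h; rewrite val_rep; apply/vlineP; exists k.
by rewrite val_rep => /vlineP[k ->]; apply: h.
Qed.

Let Pt : point R := mkpoint (pp_P H).

Let ideal_Pt g : point_ideal Pt g <-> forall k, ev g (k *: P) = 0.
Proof.
have [c c0 ec] := mkpoint_rep (pp_P H).
split=> [/point_idealE h k|h]; last by apply/point_idealE => k; rewrite ec scalerA.
by have := h (k / c); rewrite ec scalerA divfK.
Qed.

(** Independent linear forms have only the Koszul syzygy. *)
Let dvb_factor c1 c2 : c1 * lf b1 + c2 * lf b2 = 0 ->
  exists e, c1 = e * lf b2 /\ c2 = - (e * lf b1).
Proof.
move=> h; have h2 : c1 * lf b1 = - c2 * lf b2.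
  by apply/eqP; rewrite mulNr -addr_eq0 h.
have [e ee] : dv (lf b2) c1.
  have : dv (lf b2) (c1 * lf b1) by rewrite h2; apply/dvMl/dvv.
  move/(lf_prime b2_neq0) => [//|/(lf_dv b2_neq0)].
  by rewrite crossC => /eqP; rewrite oppr_eq0 (negPf (pp_P H)).
exists e; split; first by rewrite mulrC.
apply: (mulfI (lf_neq0 b2_neq0)).
have : - (c2 * lf b2) = lf b2 * e * lf b1 by rewrite -mulNr -h2 ee.
move/(congr1 -%R); rewrite opprK mulrC => ->; ring.
Qed.

(** The second map sends [c1 *: g1 + c2 *: g2 + c3 *: g3] to [c1 * lf b1 + c2 * lf b2]. It is well
    defined because the relation goes to 0, and its image is the ideal of [P]. *)
Lemma jumping_point_ex : (n < m)%N -> exists pi,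
  point_sequence f (m + n) n Pt g3 pi.
Proof.
move=> nm.
have piE (rho : 'rV[S]_3) : exists v : S, forall c1 c2 c3,
    rho = c1 *: g1 + c2 *: g2 + c3 *: g3 -> v = c1 * lf b1 + c2 * lf b2.
  have [[c1 [c2 [c3 er]]]|nr] := pselect (exists c1 c2 c3, rho = c1 *: g1 + c2 *: g2 + c3 *: g3);
    last by exists 0 => c1 c2 c3 er; case: nr; exists c1, c2, c3.
  exists (c1 * lf b1 + c2 * lf b2) => d1 d2 d3 ed.
  have [|e [e1 e2 _]] := pp_rels H (c1 := c1 - d1) (c2 := c2 - d2) (c3 := c3 - d3).
    exact: comb_diff3 (etrans (esym er) ed).
  apply/eqP; rewrite -subr_eq0; apply/eqP.
  have -> : c1 * lf b1 + c2 * lf b2 - (d1 * lf b1 + d2 * lf b2) =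
    (c1 - d1) * lf b1 + (c2 - d2) * lf b2 by ring.
  rewrite e1 e2; ring.
have [pi piP] := boolp.choice piE.
exists pi; split.
- move=> c rho sigma /(pp_gen H)[c1 [c2 [c3 er]]] /(pp_gen H)[d1 [d2 [d3 es]]].
  rewrite (piP _ _ _ _ er) (piP _ _ _ _ es).
  rewrite (piP _ (c * c1 + d1) (c * c2 + d2) (c * c3 + d3)); first by ring.
  by rewrite er es; exact: comb_lin3.
- move=> k rho /ARdegE[hr dr]; have [c hc ec] := pp_gen_hom H hr dr.
  rewrite lin_tri in ec; rewrite (piP _ _ _ _ ec); apply/homogeneousE.
  rewrite (_ : _ + 1 = k - m%:Z + 1); last by rewrite PoszD; ring.
  apply: homD; apply: homM; try exact: hom_lf.
    exact: (hc o0).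
  exact: (hc o1).
- move=> rho /(pp_gen H)[c1 [c2 [c3 er]]]; rewrite (piP _ _ _ _ er); split.
    move=> /dvb_factor[e [e1 e2]]; exists (e * al + c3).
    by rewrite er e1 e2; exact: (comb_ker c3 (pp_rel H)).
  move=> [c ec]; rewrite -(piP _ _ _ _ er) (piP _ 0 0 c); first by ring.
  by rewrite ec; exact: comb_z3.
move=> g; rewrite ideal_Pt; split.
  move=> hg; have [|A [B eg]] := ideal_ev (f := g) (pp_P H); first by move=> k _; apply: hg.
  exists (A *: g1 + B *: g2).
    rewrite /AR -/(der _ _) derDl !derZl (pp_der1 H) (pp_der2 H); ring.
  by rewrite (piP _ A B 0 (comb_z12 _ _ _ _ _)) eg; ring.
move=> [rho /(pp_gen H)[c1 [c2 [c3 er]]] <-] k; rewrite (piP _ _ _ _ er).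
by rewrite evD !evM !ev_lf !dotZr dot_crossl dot_crossr; ring.
Qed.

(** As [n < m], [rho1] is a constant multiple of [g3], so [pi] kills [g3] and the relation makes
    [pi g1], [pi g2] a common multiple of [lf b1], [lf b2]. Everything in the ideal of [Q] thus
    vanishes at [P]. *)
Lemma jumping_point_uniq Q r rho1 pi : (n < m)%N ->
  is_mdr f r -> ARdeg f r%:Z rho1 -> rho1 != 0 ->
  point_sequence f (m + n) r Q rho1 pi -> Q = Pt.
Proof.
move=> nm hr /ARdegE[h1 d1] r0 [pl ph pk pim].
have er := is_mdr_uniq hr (mdr_nearly_free (ltnW nm)); rewrite er in h1.
have [c3 ec] : exists c, g3 = c *: rho1.
  have [c hc ec] := pp_gen_hom H h1 d1; rewrite lin_tri in ec.
  have e0 : c 0 o0 = 0 by apply: hom_neg (hc o0); rewrite subr_lt0 ltz_nat.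
  have e1 : c 0 o1 = 0 by apply: hom_neg (hc o1); rewrite subr_lt0 ltz_nat.
  have h2 : hom 0 (c 0 o2) by have := hc o2; rewrite /= subrr.
  have e2 := hom0C h2; set x := (c 0 o2)@_0%MM in e2.
  have ex : rho1 = x%:MP *: g3 by rewrite ec e0 e1 e2 !scale0r !add0r.
  have x0 : x != 0.
    by apply: contraNneq r0 => x0; rewrite ex x0 mpolyC0 scale0r.
  have xV : x^-1%:MP * x%:MP = 1 :> S by rewrite -mpolyCM mulVf // mpolyC1.
  exists x^-1%:MP; rewrite ex scalerA xV scale1r.
  exact: erefl.
have d0 : AR f 0 by rewrite /AR big1 // => j _; rewrite mxE mul0r.
have pi0 : pi 0 = 0 by apply/(pk _ d0); exists 0; rewrite scale0r.
have piZ c x : AR f x -> pi (c *: x) = c * pi x.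
  by move=> hx; rewrite -[c *: x]addr0 pl // pi0 addr0.
have pi3 : pi g3 = 0 by apply/(pk _ (pp_der3 H)); exists c3.
have rel : lf b2 * pi g1 + (- lf b1) * pi g2 = 0.
  have D c x : der x f = 0 -> AR f (c *: x).
    by move=> hx; rewrite /AR -/(der (c *: x) f) derZl hx mulr0.
  have := piZ al _ (pp_der3 H); rewrite -(pp_rel H) pi3 mulr0 -scaleNr.
  rewrite pl; [|exact: pp_der1 H|exact: (D _ _ (pp_der2 H))].
  by rewrite piZ //; exact: pp_der2 H.
have [e [e1 e2]] : exists e, pi g2 = e * lf b2 /\ - pi g1 = - (e * lf b1).
  apply: dvb_factor; rewrite -[RHS]oppr0 -rel; ring.
have vanP g : point_ideal Q g -> forall k, ev g (k *: P) = 0.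
  move=> /pim[rho /[dup] hrho /(pp_gen H)[c1 [c2 [c4 er']]] <-] k.
  have D c x : der x f = 0 -> AR f (c *: x).
    by move=> hx; rewrite /AR -/(der (c *: x) f) derZl hx mulr0.
  rewrite er' -addrA pl; [|exact: pp_der1 H|]; last first.
    rewrite /AR -/(der _ _) derDl !derZl (pp_der2 H) (pp_der3 H); ring.
  rewrite pl; [|exact: pp_der2 H|exact: (D _ _ (pp_der3 H))].
  rewrite (piZ _ _ (pp_der3 H)) pi3 e1 -[pi g1]opprK e2 opprK.
  by rewrite evD !evM evD !evM !ev_lf !dotZr dot_crossl dot_crossr /ev meval0; ring.
have rQ := rep_neq0 Q.
have cr : cross (rep Q) P = 0.
  apply/eqP/negPn/negP => nz.
  have [c [v [w [_ _ [qw pw] _ _]]]] := dual_basis nz.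
  have /vanP/(_ 1) : point_ideal Q (lf w).
    by apply/point_idealE => k; rewrite ev_lf dotZr dotC qw mulr0.
  by rewrite ev_lf dotZr dotC pw mulr1 => /eqP; rewrite oner_eq0.
have [k ek] := cross_eq0 rQ cr.
apply/val_inj; rewrite /= val_rep ek.
have k0 : k != 0 by apply: contraNneq (pp_P H) => k0; rewrite ek k0 scale0r.
apply/eqP; rewrite eqEdim !dim_vline rQ scaler_eq0 negb_or k0 rQ leqnn andbT.
by rewrite -memvE; apply/vlineP; exists k^-1; rewrite scalerA mulVf // scale1r.
Qed.

Lemma on_line_Pt L : on_line Pt L = (dot (val L) P == 0).
Proof.
rewrite on_lineE; have [c c0 ->] := mkpoint_rep (pp_P H).
by rewrite dotZr mulf_eq0 (negPf c0).
Qed.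

End PencilResults.

(** * Nearly modular points *)

Lemma scaleVNB (K : fieldType) (V : lmodType K) (y : K) (u v : V) : y != 0 ->
  v - u = y^-1 *: (- y *: u + y *: v).
Proof. by move=> y0; rewrite scaleNr [X in _ *: X]addrC -scalerBr scalerA mulVf // scale1r. Qed.

Lemma dot_comb (K : comPzRingType) (a u v p : 'rV[K]_3) x y :
  a = x *: u + y *: v -> dot a p = x * dot u p + y * dot v p.
Proof. by move=> ->; rewrite dotDl !dotZl. Qed.

Lemma dot_crossZZ (K : comPzRingType) (a u v : 'rV[K]_3) x y :
  dot a (cross (x *: u) (y *: v)) = x * y * dot a (cross u v).
Proof. by rewrite crossZl crossZr !dotZr mulrA. Qed.

Section Lines.
Variable R : realType.
Local Notation C := R[i].
Local Notation S := (poly3 R).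

Section Arrangement.
Variables (d : nat) (A : arrangement R d).
Implicit Types (i j k : 'I_d) (p q : point R).

Definition alf i : 'rV[C]_3 := val (aline A i).

(* Concurrency, for [i != j]; locked because unfolding subspaces during
   unification is very slow. *)
Definition conc i j k : bool :=
  locked (line_supp (aline A i) :&: line_supp (aline A j) <= line_supp (aline A k))%VS.

Lemma mem_alfP i (v : 'rV[C]_3) :
  reflect (dot (alf i) v = 0) (v \in line_supp (aline A i)).
Proof. by rewrite mem_line_supp; apply: eqP. Qed.

Lemma alf_neq0 i : alf i != 0. Proof. exact: line_neq0. Qed.

Lemma line_supp_eq (L L' : line R) : cross (val L) (val L') = 0 -> line_supp L = line_supp L'.
Proof.
move/(cross_eq0 (line_neq0 L)) => [k ek].
have k0 : k != 0 by apply: contraNneq (line_neq0 L') => k0; rewrite ek k0 scale0r.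
have e v : dot (val L') v = k * dot (val L) v by rewrite ek dotZl.
apply/vspaceP => v; rewrite [LHS]mem_line_supp [RHS]mem_line_supp (e v).
by rewrite mulf_eq0 (negPf k0).
Qed.

Lemma alf_cross i j : i != j -> cross (alf i) (alf j) != 0.
Proof.
apply: contraNneq => /line_supp_eq h; apply/eqP; exact: (@aline_distinct R d A) h.
Qed.

Lemma cap_lines i j : i != j ->
  (line_supp (aline A i) :&: line_supp (aline A j))%VS =
  (<[cross (alf i) (alf j)]>%VS : space3 R).
Proof.
move=> ij; have c0 := alf_cross ij; apply/vspaceP => v; rewrite memv_cap.
apply/andP/vlineP => [[/mem_alfP vi /mem_alfP vj]|[k ->]].
  have [c [x [y [_ _ _ _ ev_]]]] := dual_basis c0.
  by exists (dot c v); rewrite {1}(ev_ v) vi vj !scale0r !add0r.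
split; apply/mem_alfP; rewrite dotZr.
  by rewrite (dot_crossl (alf i)) mulr0.
by rewrite (dot_crossr (alf i)) mulr0.
Qed.

Lemma concE i j k : i != j -> conc i j k = (dot (alf k) (cross (alf i) (alf j)) == 0).
Proof. by move=> ij; rewrite /conc -lock cap_lines // -memvE mem_line_supp. Qed.

Lemma defpolyE : defpoly A = \prod_(i < d) lf (alf i).
Proof. by []. Qed.

(* The existence of a nearly modular point, in terms of the indices of lines: [i1]
   and [i2] meet at that point, [j1] and [j2] at the exceptional double point. *)
Record near_pencil (i1 i2 j1 j2 : 'I_d) : Prop := NearPencil {
  np_i : i1 != i2;
  np_j : j1 != j2;
  np_j1 : ~~ conc i1 i2 j1;
  np_j2 : ~~ conc i1 i2 j2;
  np_join : forall j k, j != k -> ~~ conc i1 i2 j -> ~~ conc i1 i2 k ->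
    ~~ ((j == j1) && (k == j2)) -> ~~ ((j == j2) && (k == j1)) ->
    exists2 i, conc i1 i2 i & conc j k i;
  np_njoin : forall i, conc i1 i2 i -> ~~ conc j1 j2 i
}.

Section Pencil.
Variables (i1 i2 j1 j2 : 'I_d).
Hypothesis H : near_pencil i1 i2 j1 j2.
Let p := cross (alf i1) (alf i2).
Let onp : {set 'I_d} := [set i | conc i1 i2 i].
Let m := #|onp|.

Let onpE i : (i \in onp) = (dot (alf i) p == 0).
Proof. by rewrite inE concE // (np_i H). Qed.

Let p0 : p != 0. Proof. exact: alf_cross (np_i H). Qed.

Let nrm i : 'rV[C]_3 := (dot (alf i) p)^-1 *: alf i.

Let nrm_p i : i \notin onp -> dot (nrm i) p = 1.
Proof. by rewrite onpE => h; rewrite /nrm dotZl mulVf. Qed.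

Let cross_nrm i j : i \notin onp -> j \notin onp -> cross (nrm i) (nrm j) = 0 -> i = j.
Proof.
rewrite !onpE => hi hj /eqP; rewrite /nrm crossZl crossZr scalerA scaler_eq0.
rewrite mulf_eq0 !invr_eq0 (negPf hi) (negPf hj) /= => h.
by apply/eqP/negPn/negP => /alf_cross; rewrite h.
Qed.

Let rest := [seq i <- enum 'I_d | (i \notin onp) && (i != j1) && (i != j2)].

Let j1N : j1 \notin onp. Proof. by rewrite inE (np_j1 H). Qed.
Let j2N : j2 \notin onp. Proof. by rewrite inE (np_j2 H). Qed.

Let offs := j1 :: j2 :: rest.

Let mem_offs i : (i \in offs) = (i \notin onp).
Proof.
rewrite in_cons in_cons mem_filter mem_enum andbT.
have [->|_] := eqVneq i j1; first by rewrite j1N.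
have [->|_] := eqVneq i j2; first by rewrite j2N.
by rewrite /= !andbT.
Qed.

Let uniq_offs : uniq offs.
Proof.
rewrite /= inE negb_or (np_j H) /= !mem_filter !eqxx !andbF /=.
by rewrite filter_uniq // enum_uniq.
Qed.

Let gs := [seq alf i | i <- enum onp].
Let bs0 := [seq nrm i | i <- rest].

Let joined_offs j k : j \notin onp -> k \notin onp -> j != k ->
  ~~ ((j == j1) && (k == j2)) -> ~~ ((j == j2) && (k == j1)) ->
  exists2 g, g \in gs & exists c, nrm k - nrm j = c *: g.
Proof.
move=> jN kN jk h1 h2; have jc : ~~ conc i1 i2 j by move: jN; rewrite inE.
have kc : ~~ conc i1 i2 k by move: kN; rewrite inE.
have [i hi hjk] := np_join H jk jc kc h1 h2.
have ip : i \in onp by rewrite inE.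
exists (alf i); first by apply: map_f; rewrite mem_enum.
rewrite concE // in hjk; rewrite onpE in ip.
have nz : cross (nrm j) (nrm k) != 0 by apply/eqP => /(cross_nrm jN kN)/eqP; apply/negP.
have := jN; have := kN; rewrite !onpE => kN' jN'.
have [|x [y e]] := @pencil_expand _ (nrm j) (nrm k) (alf i) nz.
  by rewrite /nrm crossZl crossZr !dotZr (eqP hjk) !mulr0.
have ex : x = - y.
  have := dot_comb p e; rewrite (eqP ip) (nrm_p jN) (nrm_p kN) !mulr1.
  by move=> /esym/eqP; rewrite addr_eq0 => /eqP.
have y0 : y != 0.
  by apply: contraNneq (alf_neq0 i) => y0; rewrite e ex y0 oppr0 !scale0r addr0.
exists y^-1; rewrite e ex; exact: scaleVNB.
Qed.

Let const := \prod_(i <- offs) dot (alf i) p.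

Let const_neq0 : const != 0.
Proof.
rewrite /const big_seq prodf_seq_neq0; apply/allP => i io; apply/implyP => _.
by move: io; rewrite mem_offs onpE.
Qed.

Let defpoly_lfp : defpoly A = const%:MP * lfp (gs ++ nrm j1 :: nrm j2 :: bs0).
Proof.
rewrite defpolyE (bigID (fun i => i \in onp)) /= /lfp big_cat /= mulrCA; congr (_ * _).
  by rewrite big_map big_enum.
rewrite -[nrm j1 :: _]/([seq nrm i | i <- offs]) big_map /const rmorph_prod -big_split /=.
transitivity (\prod_(i <- offs) lf (alf i)); last first.
  apply: eq_big_seq => i; rewrite mem_offs onpE => hi.
  by rewrite /nrm lfZ mulrA -mpolyCM mulfV // mpolyC1 mul1r.
rewrite -big_filter; apply: perm_big; apply: uniq_perm => //.
  by rewrite filter_uniq // /index_enum -enumT enum_uniq.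
by move=> i; rewrite mem_offs mem_filter mem_index_enum andbT.
Qed.

Let size_offs : size offs = (d - m)%N.
Proof.
have -> : size offs = #|~: onp|.
  rewrite cardE; apply: perm_size; apply: uniq_perm; rewrite ?enum_uniq //.
  by move=> i; rewrite mem_offs mem_enum in_setC.
by rewrite cardsCs setCK card_ord.
Qed.

Lemma near_pencil_card : (1 < m)%N /\ (1 < d - m)%N.
Proof.
split; last by rewrite -size_offs.
have -> : m = #|[set i1; i2]| + #|onp :\: [set i1; i2]| :> nat.
  rewrite /m -(cardsID [set i1; i2] onp); congr (_ + _)%N; congr #|pred_of_set _|.
  apply/setIidPr/subsetP => i; rewrite !inE => /orP[] /eqP ->; rewrite /conc -lock.
    exact: capvSl.
  exact: capvSr.
by rewrite cards2 (np_i H).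
Qed.

Lemma near_pencil_le : (m <= d)%N.
Proof. by rewrite -[X in (_ <= X)%N](card_ord d) max_card. Qed.

Lemma near_pencil_pres : exists b1 b2 g1 g2 g3 al,
  pencil_pres (defpoly A) m (d - m) b1 b2 g1 g2 g3 al.
Proof.
have sg : size gs = m by rewrite size_map -cardE.
have sb : size (nrm j1 :: nrm j2 :: bs0) = (d - m)%N.
  by rewrite -size_offs /= size_map.
have memb b : b \in nrm j1 :: nrm j2 :: bs0 -> exists2 i, i \notin onp & b = nrm i.
  move=> hb; have /seq.mapP[i io ->] : b \in map nrm offs := hb.
  by exists i => //; move: io; rewrite mem_offs.
have gsP g : g \in gs -> exists2 i, i \in onp & g = alf i.
  move=> hg; have /seq.mapP[i io ->] : g \in map alf (enum onp) := hg.
  by exists i => //; move: io; rewrite mem_enum.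
have nrm_inj i j : i \notin onp -> j \notin onp -> nrm i = nrm j -> i = j.
  by move=> io jo e; apply: cross_nrm => //; rewrite e crossvv.
have P0 : cross (nrm j1) (nrm j2) != 0.
  by apply/eqP => /(cross_nrm j1N j2N)/eqP; rewrite (negPf (np_j H)).
have alf_inj : injective alf.
  move=> i j e; apply/eqP/negPn/negP => /alf_cross; rewrite e crossvv eqxx //.
have [|||||||||g1 [g2 [g3 [al [[h1 h2 h3 h4] [d1 d2 d3 er] gen rel nal]]]]] :=
    @structure C p (nrm j1) (nrm j2) gs bs0.
- exact: p0.
- rewrite -size_eq0 sg; have [] := near_pencil_card; lia.
- by rewrite map_inj_uniq ?enum_uniq.
- move=> g /gsP[i ip ->]; move: ip; rewrite onpE => /eqP ip; split=> //; exact: alf_neq0.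
- move=> g h /gsP[i _ ->] /gsP[j _ ->] e; congr alf; apply/eqP/negPn/negP.
  by move=> /alf_cross; rewrite e eqxx.
- rewrite -[_ :: _]/([seq nrm i | i <- offs]) map_inj_in_uniq //.
  by move=> i j; rewrite !mem_offs; apply: nrm_inj.
- by move=> b /memb[i io ->]; apply: nrm_p.
- move=> b c /memb[i io ->] /memb[j jo ->] ij h1 h2; apply: joined_offs => //.
  + by apply: contraNneq ij => ->.
  + by apply: contra h1 => /andP[/eqP -> /eqP ->]; rewrite !eqxx.
  + by apply: contra h2 => /andP[/eqP -> /eqP ->]; rewrite !eqxx.
- move=> g /gsP[i ip ->]; apply/eqP.
  have b0 : nrm j1 - nrm j2 != 0.
    by rewrite subr_eq0; apply/eqP => /(nrm_inj _ _ j1N j2N)/eqP; rewrite (negPf (np_j H)).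
  move/(cross_eq0 b0) => [c ec].
  have ci : conc i1 i2 i by move: ip; rewrite inE.
  have := np_njoin H ci; rewrite concE ?(np_j H) //; case/negP.
  have : dot (alf i) (cross (nrm j1) (nrm j2)) = 0.
    by rewrite ec dotZl dotBl dot_crossl dot_crossr subrr mulr0.
  rewrite /nrm dot_crossZZ => /eqP; rewrite mulf_eq0 => /orP[|//].
  have k1 : dot (alf j1) p != 0 by rewrite -onpE.
  have k2 : dot (alf j2) p != 0 by rewrite -onpE.
  by rewrite (negPf (mulf_neq0 (invr_neq0 k1) (invr_neq0 k2))).
have derE (r : 'rV[S]_3) : der r (defpoly A) =
    const%:MP * der r (lfp (gs ++ nrm j1 :: nrm j2 :: bs0)).
  by rewrite defpoly_lfp derM derC mul0r add0r.
have c0 : const%:MP != 0 :> S by rewrite mpolyC_eq0 const_neq0.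
rewrite sb sg in h1 h2 h3 h4.
have der0 (r : 'rV[S]_3) : der r (lfp (gs ++ nrm j1 :: nrm j2 :: bs0)) = 0 ->
    der r (defpoly A) = 0 by move=> e; rewrite derE e mulr0.
exists (nrm j1), (nrm j2), g1, g2, g3, al; apply: PencilPres.
- exact: P0.
- exact: h1.
- exact: h2.
- exact: h3.
- exact: h4.
- exact: der0 d1.
- exact: der0 d2.
- exact: der0 d3.
- exact: er.
- move=> r /eqP; rewrite derE mulf_eq0 (negPf c0) => /eqP; exact: gen.
- exact: rel.
- exact: nal.
Qed.

End Pencil.
End Arrangement.
End Lines.

(** * The total Tjurina number *)

Section Points.
Variable R : realType.
Variables (d : nat) (A : arrangement R d).
Implicit Types (i j k : 'I_d) (p q : point R).

Definition on q i : bool := locked (on_line q (aline A i)).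

Lemma onE q i : on q i = (val q <= line_supp (aline A i))%VS.
Proof. by rewrite /on -lock. Qed.

Lemma multP q : mult A q = #|[set i | on q i]|.
Proof. by apply: eq_card => i; rewrite !inE onE. Qed.

Lemma point_le_eq p q : (val p <= val q)%VS -> p = q.
Proof.
by move=> pq; apply: val_inj; apply/eqP; rewrite eqEdim pq (eqP (valP p)) (eqP (valP q)) /=.
Qed.

Lemma dim_join p q : p != q -> \dim (val p + val q)%VS = 2%N.
Proof.
move=> pq; rewrite dimv_disjoint_sum ?(eqP (valP p)) ?(eqP (valP q)) //.
apply/eqP; rewrite -dimv_eq0 -leqn0 leqNgt; apply/negP => gt0.
have e : (val p :&: val q)%VS = val p.
  by apply/eqP; rewrite eqEdim capvSl (eqP (valP p)) /=.
by case/eqP: pq; apply: point_le_eq; rewrite -e capvSr.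
Qed.

Lemma join_line p q i : p != q -> on p i -> on q i ->
  line_supp (aline A i) = (val p + val q)%VS.
Proof.
rewrite !onE => pq pi qi; apply/esym/eqP.
by rewrite eqEdim subv_add pi qi /= dim_join // dim_line_supp.
Qed.

Lemma join_on p q i : line_supp (aline A i) = (val p + val q)%VS -> on p i /\ on q i.
Proof. by move=> e; rewrite !onE e addvSl addvSr. Qed.

Lemma on_two p q i j : p != q -> on p i -> on q i -> on p j -> on q j -> i = j.
Proof.
move=> pq pi qi pj qj; apply: (@aline_distinct R d A).
by rewrite (join_line pq pi qi) (join_line pq pj qj).
Qed.

Lemma meet_ex i j : i != j ->
  {q : point R | val q = (line_supp (aline A i) :&: line_supp (aline A j))%VS}.
Proof. by move=> ij; exists (mkpoint (alf_cross A ij)); rewrite cap_lines. Qed.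

Definition meet i j (ij : i != j) : point R := sval (meet_ex ij).

Lemma val_meet i j (ij : i != j) :
  val (meet ij) = (line_supp (aline A i) :&: line_supp (aline A j))%VS.
Proof. exact: svalP (meet_ex ij). Qed.

Lemma on_meet i j (ij : i != j) k : on (meet ij) k = conc A i j k.
Proof. by rewrite onE val_meet /conc -lock. Qed.

Lemma on_meetl i j (ij : i != j) : on (meet ij) i.
Proof. by rewrite onE val_meet capvSl. Qed.

Lemma on_meetr i j (ij : i != j) : on (meet ij) j.
Proof. by rewrite onE val_meet capvSr. Qed.

Lemma meet_uniq q i j (ij : i != j) : on q i -> on q j -> q = meet ij.
Proof.
rewrite !onE => qi qj; apply: point_le_eq.
by rewrite val_meet subv_cap; apply/andP; split; [exact: qi | exact: qj].
Qed.

Lemma on_meetP q i j (ij : i != j) : on q i && on q j = (q == meet ij).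
Proof.
apply/andP/eqP => [[qi qj]|->]; first exact: meet_uniq.
by rewrite on_meetl on_meetr.
Qed.

Lemma meet_intersection i j (ij : i != j) : intersection_point A (meet ij).
Proof.
rewrite /intersection_point multP; apply/card_gt1P; exists i, j; rewrite !inE.
by split; [exact: on_meetl | exact: on_meetr |].
Qed.

Lemma multE q i j : i != j -> on q i -> on q j -> mult A q = #|[set k | conc A i j k]|.
Proof.
move=> ij qi qj; rewrite multP; apply: eq_card => k; rewrite !inE -(on_meet ij).
by rewrite -(meet_uniq ij qi qj).
Qed.

Lemma two_on q : (1 < mult A q)%N -> exists i j, [/\ on q i, on q j & i != j].
Proof.
by rewrite multP => /card_gt1P[i [j [qi qj ij]]]; exists i, j; move: qi qj; rewrite !inE.
Qed.

Lemma nearly_modular_pencil p : nearly_modular A p -> exists i1 i2 j1 j2,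
  near_pencil A i1 i2 j1 j2 /\ mult A p = #|[set i | conc A i1 i2 i]|.
Proof.
move=> [/two_on[i1 [i2 [p1 p2 i12]]]].
move=> [p' [[m2 pp'] pjoin pnjoin _]].
have [|j1 [j2 [q1 q2 j12]]] := @two_on p'; first by rewrite m2.
exists i1, i2, j1, j2; split; last exact: multE.
have ep := meet_uniq i12 p1 p2; have ep' := meet_uniq j12 q1 q2.
have onpE k : conc A i1 i2 k = on p k by rewrite ep on_meet.
have onp'E k : conc A j1 j2 k = on p' k by rewrite ep' on_meet.
have on2 i : on p i -> ~~ on p' i.
  move=> pi; apply/negP => p'i; apply: pnjoin; exists i.
  by apply: join_line => //; rewrite eq_sym.
have onp' k : on p' k -> (k == j1) || (k == j2).
  move=> kp; have : [set j1; j2] == [set i | on p' i].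
    rewrite eqEcard cards2 j12 -multP m2 leqnn andbT.
    by apply/subsetP => x; rewrite !inE => /orP[] /eqP ->.
  by move/eqP/setP/(_ k); rewrite !inE kp.
split=> //.
- by rewrite onpE; apply/negP => /on2; rewrite q1.
- by rewrite onpE; apply/negP => /on2; rewrite q2.
(* The intersection of [j] and [k] is neither [p], which they miss, nor [p'], through which only
   [j1] and [j2] pass; so it is joined to [p]. *)
- move=> j k jk; rewrite !onpE => jN kN h1 h2.
  have [|||i ei] := pjoin (meet jk).
  + exact: meet_intersection.
  + by apply: contraNneq jN => <-; apply: on_meetl.
  + apply/eqP => e.
    have := onp' j; rewrite -e on_meetl => /(_ isT).
    have := onp' k; rewrite -e on_meetr => /(_ isT).
    move=> /orP[] /eqP ek /orP[] /eqP ej; move: h1 h2 (jk); rewrite ek ej !eqxx //=.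
  have [h3 h4] := join_on ei; exists i; first by rewrite onpE.
  by rewrite -(on_meet jk).
by move=> i; rewrite onpE onp'E; apply: on2.
Qed.

Local Notation Q := (intersection_points A).

Lemma sum_count (T : Type) (s : seq T) (P : pred T) : (\sum_(x <- s) P x = count P s)%N.
Proof. by elim: s => [|x s IH]; rewrite ?big_nil // big_cons IH. Qed.

Lemma sum_comb (T : Type) (s : seq T) (f g : T -> nat) (k : nat) :
  (\sum_(x <- s) f x = 1 -> \sum_(x <- s) g x = 1 -> \sum_(x <- s) (f x + k * g x) = 1 + k)%N.
Proof. by move=> hf hg; rewrite big_split -big_distrr /= hf hg muln1. Qed.

Lemma sum_meet i j : i != j -> (\sum_(q <- Q) (on q i && on q j) = 1)%N.
Proof.
move=> ij; rewrite sum_count (eq_count (fun q => on_meetP q ij)).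
by rewrite -/(count_mem (meet ij) Q) count_uniq_mem ?undup_uniq // mem_intersection_points meet_intersection.
Qed.

Lemma tauE : tau A = (\sum_(q <- Q) (mult A q - 1) ^ 2)%N.
Proof.
rewrite /tau /npoints; under eq_bigr => k _ do rewrite -sum_count big_distrl /=.
rewrite exchange_big /=; apply: eq_big_seq => q; rewrite mem_intersection_points => q2.
have qd : (mult A q < d.+1)%N by rewrite ltnS multP -[X in (_ <= X)%N](card_ord d) max_card.
rewrite (bigD1_seq (mult A q)) ?iota_uniq ?mem_index_iota ?qd ?andbT //=.
rewrite eqxx mul1n big1; first exact: addn0.
by move=> k kq; rewrite eq_sym (negPf kq).
Qed.

Lemma mult_sum q : mult A q = (\sum_i on q i)%N.
Proof. by rewrite multP -sum1_card big_mkcond; apply: eq_bigr => i _; rewrite inE; case: on. Qed.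
Lemma pairs_count (P : rel 'I_d) : (forall i j, P i j -> i != j) ->
  (\sum_(q <- Q) \sum_i \sum_(j | P i j) (on q i && on q j) = \sum_i \sum_(j | P i j) 1)%N.
Proof.
move=> hP; rewrite exchange_big; apply: eq_bigr => i _.
rewrite exchange_big; apply: eq_bigr => j Pij; exact: sum_meet (hP _ _ Pij).
Qed.

Lemma pairs_on q : (\sum_i \sum_(j | i != j) (on q i && on q j) =
  mult A q * (mult A q - 1))%N.
Proof.
rewrite [X in (X * _)%N]mult_sum big_distrl; apply: eq_bigr => i _ /=.
case: (boolP (on q i)) => qi /=; last by rewrite big1.
rewrite mult_sum mul1n [in RHS](bigD1 i) //= qi addKn.
by apply: eq_bigl => j; rewrite eq_sym.
Qed.

(** $\sum_q m_q(m_q-1)=d(d-1)$ counts ordered pairs of lines, and it exceeds $\tau$ by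
    $\sum_q(m_q-1)$. At an ordinary [q] exactly one line comes from [p], so $m_q-1$ is [I q * J q];
    summed, these products count pairs of a line through [p] and a line off [p]. Both products
    vanish at [p] and [p'], which contribute $m-1$ and $1$ instead. *)
Lemma tau_nearly_modular p : nearly_modular A p ->
  (tau A + ((d - mult A p) * mult A p + mult A p) = d * (d - 1))%N.
Proof.
move=> [p2 [p' [[m2 pp'] pjoin pnjoin _]]].
set m := mult A p.
pose I q := (\sum_(i | on p i) on q i)%N.
pose J q := (\sum_(i | ~~ on p i) on q i)%N.
have multIJ q : mult A q = (I q + J q)%N by rewrite mult_sum (bigID (on p)).
have Ip : I p = m.
  by rewrite /I /m mult_sum [RHS](bigID (on p)) /= [X in (_ + X)%N]big1 ?addn0 // => i /negPf ->.
have Jp : J p = 0%N by have := multIJ p; rewrite -/m Ip; lia.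
have Ip' : I p' = 0%N.
  rewrite /I big1 // => i pi; apply/eqP; rewrite eqb0; apply/negP => p'i; apply: pnjoin.
  by exists i; apply: join_line => //; rewrite eq_sym.
have Jp' : J p' = 2%N by have := multIJ p'; rewrite m2 Ip'; lia.
have Iq q : intersection_point A q -> q != p -> q != p' -> I q = 1%N.
  move=> qi qp qp'; have [i /join_on[pi q'i]] := pjoin q qi qp qp'.
  rewrite /I (bigD1 i) //= q'i big1 // => j /andP[pj ji]; apply/eqP; rewrite eqb0.
  apply: contra ji => qj; apply/eqP; apply: (on_two qp) => //.
have pQ : p \in Q by rewrite mem_intersection_points.
have p'Q : p' \in Q by rewrite mem_intersection_points /intersection_point m2.
have sumIJ : (\sum_(q <- Q) I q * J q = (d - m) * m)%N.
  have := @pairs_count (fun i j => on p i && ~~ on p j).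
  have cI : (\sum_(i | on p i) 1 = m)%N by rewrite /m multP sum1dep_card.
  have cJ : (\sum_(i | ~~ on p i) 1 = d - m)%N.
    by have := cI; have := card_ord d; rewrite -sum1_card (bigID (on p)) /=; lia.
  have E (F : 'I_d -> 'I_d -> nat) : (\sum_i \sum_(j | on p i && ~~ on p j) F i j =
      \sum_(i | on p i) \sum_(j | ~~ on p j) F i j)%N.
    rewrite [RHS]big_mkcond; apply: eq_bigr => i _; case: (on p i) => //=.
    by rewrite big_pred0.
  have -> : (\sum_i \sum_(j | on p i && ~~ on p j) 1 = (d - m) * m)%N.
    by rewrite E cJ -[X in (_ * X)%N]cI big_distrr; apply: eq_bigr => i _ /=; rewrite muln1.
  move=> <-; last by move=> i j /andP[pi]; apply: contraNneq => <-.
  apply: eq_bigr => q _; rewrite E /I big_distrl; apply: eq_bigr => i _ /=.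
  by rewrite /J big_distrr; apply: eq_bigr => j _; rewrite -mulnb.
have tot : (\sum_(q <- Q) mult A q * (mult A q - 1) = d * (d - 1))%N.
  transitivity (\sum_(i < d) \sum_(j < d | i != j) 1)%N.
    by rewrite -(@pairs_count (fun i j => i != j)) //; apply: eq_bigr => q _; rewrite pairs_on.
  rewrite -[X in (X * _)%N](card_ord d) -sum_nat_const; apply: eq_bigr => i _.
  have := card_ord d; rewrite -sum1_card (bigD1 i) //= => e.
  have {e} <- : (\sum_(j < d | j != i) 1 = d - 1)%N.
    by move: e; set s := (\sum_(j < d | _) _)%N; lia.
  by apply: eq_bigl => j; rewrite eq_sym.
have pw q : q \in Q -> (mult A q * (mult A q - 1) = (mult A q - 1) ^ 2 +
    (I q * J q + ((q == p') + (m - 1) * (q == p))))%N.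
  rewrite mem_intersection_points => qi.
  have [->|qp] := eqVneq q p.
    rewrite eq_sym (negPf pp') Jp -/m; move: p2; rewrite /intersection_point -/m; nia.
  have [->|qp'] := eqVneq q p'; first by rewrite m2 Ip' Jp' muln0.
  rewrite multIJ (Iq q qi qp qp') !muln0 /=; nia.
have cQ x : x \in Q -> (\sum_(q <- Q) (q == x) = 1)%N.
  by move=> xQ; rewrite sum_count -/(count_mem x Q) (count_uniq_mem x (undup_uniq _)) xQ.
have s1 : (\sum_(q <- Q) ((q == p') + (m - 1) * (q == p)) = m)%N.
  transitivity (1 + (m - 1))%N; last by rewrite addnC subnK // ltnW.
  exact: (sum_comb (m - 1) (cQ p' p'Q) (cQ p pQ)).
rewrite -tot tauE (eq_big_seq _ pw) [RHS]big_split [X in (_ = _ + X)%N]big_split /=.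
by rewrite sumIJ s1.
Qed.
End Points.

(** * Invariance under lattice isomorphisms *)

Section Subspaces.
Variables (K : fieldType) (V : vectType K).
Implicit Types (U W : {vspace V}).

Definition meets (d : nat) (l : 'I_d -> {vspace V}) : seq {vspace V} :=
  [seq (\bigcap_(i in J) l i)%VS | J : {set 'I_d}].

Section Meets.
Variables (d : nat) (l : 'I_d -> {vspace V}).

Lemma meets_full : fullv \in meets l.
Proof. by apply/imageP; exists set0; rewrite // big_set0. Qed.

Lemma meets_line i : l i \in meets l.
Proof. by apply/imageP; exists [set i]; rewrite // big_set1. Qed.

Lemma meets_cap i j : (l i :&: l j)%VS \in meets l.
Proof.
have [<-|ij] := eqVneq i j; first by rewrite capvv meets_line.
by apply/imageP; exists [set i; j]; rewrite // big_setU1 ?inE //= big_set1.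
Qed.

Lemma meets_le_line U : U \in meets l -> U != fullv -> exists i, (U <= l i)%VS.
Proof.
move=> /imageP[J _ ->]; have [->|[i iJ] _] := set_0Vmem J; first by rewrite big_set0 eqxx.
by exists i; rewrite (bigD1 i) //= capvSl.
Qed.
End Meets.

(** The isomorphism fixes the full space, hence matches the maximal proper members, which are the
    lines. It preserves greatest lower bounds, so pairwise intersections correspond too. *)
Lemma meets_iso_lines (d d' : nat) (l : 'I_d -> {vspace V}) (l' : 'I_d' -> {vspace V})
    (phi : {vspace V} -> {vspace V}) :
  (forall i, l i != fullv) -> (forall i, l' i != fullv) ->
  (forall i j, (l i <= l j)%VS -> i = j) -> (forall i j, (l' i <= l' j)%VS -> i = j) ->
  {in meets l, forall U, phi U \in meets l'} ->
  {in meets l', forall W, exists2 U, U \in meets l & phi U = W} ->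
  {in meets l &, forall U W, (phi U <= phi W)%VS = (U <= W)%VS} ->
  exists2 s : 'I_d -> 'I_d', bijective s &
    forall i j k, (l' (s i) :&: l' (s j) <= l' (s k))%VS = (l i :&: l j <= l k)%VS.
Proof.
move=> lN lN' l_inj l_inj' phi_meets phi_surj phi_le.
have phi_full : phi fullv = fullv.
  have [U UA e] := phi_surj _ (meets_full l'); apply/eqP; rewrite eqEsubv subvf /=.
  by rewrite -{1}e phi_le ?meets_full // subvf.
have phi_proper U : U \in meets l -> U != fullv -> phi U != fullv.
  move=> UA; apply: contraNneq => e.
  by rewrite eqEsubv subvf -phi_le ?meets_full // phi_full e subvv.
have line_ex i : exists i', phi (l i) = l' i'.
  have [|i' ii'] := meets_le_line (phi_meets _ (meets_line l i)).
    by apply: phi_proper; rewrite ?meets_line ?lN.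
  exists i'; have [U UA eU] := phi_surj _ (meets_line l' i').
  have [|j Uj] := meets_le_line UA.
    by apply: contraTneq (lN' i') => e; rewrite -eU e phi_full eqxx.
  have iU : (l i <= U)%VS by rewrite -phi_le ?meets_line // eU.
  have ej := l_inj _ _ (subv_trans iU Uj).
  by rewrite -eU; congr phi; apply/eqP; rewrite eqEsubv iU /= {1}ej.
have [s hs] := boolp.choice line_ex.
have s_inj : injective s.
  by move=> i j e; apply: l_inj; rewrite -phi_le ?meets_line // !hs e subvv.
have s_surj i' : exists j, i' = s j.
  have [U UA eU] := phi_surj _ (meets_line l' i').
  have [|j Uj] := meets_le_line UA.
    by apply: contraTneq (lN' i') => e; rewrite -eU e phi_full eqxx.
  by exists j; apply: l_inj'; rewrite -hs -eU phi_le ?meets_line.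
have phi_cap i j : phi (l i :&: l j)%VS = (l' (s i) :&: l' (s j))%VS.
  apply/eqP; rewrite eqEsubv subv_cap -!hs !phi_le ?meets_cap ?meets_line //.
  rewrite capvSl capvSr /= !hs.
  have [W WA eW] := phi_surj _ (meets_cap l' (s i) (s j)).
  rewrite -eW phi_le ?meets_cap // subv_cap.
  by rewrite -(phi_le W (l i)) -?(phi_le W (l j)) ?meets_line // eW !hs capvSl capvSr.
exists s; last by move=> i j k; rewrite -phi_cap -hs phi_le ?meets_cap ?meets_line.
have [t ht] := boolp.choice s_surj; exists t => [i|i']; last by rewrite -ht.
by apply: s_inj; rewrite -ht.
Qed.
End Subspaces.

Section Transfer.
Variable R : realType.

Lemma line_supp_proper (L : line R) : line_supp L != fullv.
Proof.
apply/eqP => /(congr1 (fun V : space3 R => \dim V)).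
by rewrite /= dim_line_supp dimvf.
Qed.

Lemma le_dim_eq (K : fieldType) (V : vectType K) (U W : {vspace V}) (n : nat) :
  \dim U = n -> \dim W = n -> (U <= W)%VS -> U = W.
Proof. by move=> du dw uw; apply/eqP; rewrite eqEdim uw du dw /=. Qed.

Lemma line_supp_inj (d : nat) (A : arrangement R d) i j :
  (line_supp (aline A i) <= line_supp (aline A j))%VS -> i = j.
Proof.
move=> ij; apply: (@aline_distinct R d A).
exact: le_dim_eq (dim_line_supp _) (dim_line_supp _) ij.
Qed.

Lemma conc_le (d : nat) (A : arrangement R d) i j k : conc A i j k =
  (line_supp (aline A i) :&: line_supp (aline A j) <= line_supp (aline A k))%VS.
Proof. by rewrite /conc -lock. Qed.

Variables (d d' : nat) (A : arrangement R d) (A' : arrangement R d').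

Lemma same_combinatorics_lines : same_combinatorics A A' ->
  exists2 s : 'I_d -> 'I_d', bijective s &
    forall i j k, conc A' (s i) (s j) (s k) = conc A i j k.
Proof.
move=> [phi [h1 h2 h3]].
have [s bs hs] := @meets_iso_lines _ _ d d' (fun i => line_supp (aline A i))
  (fun i => line_supp (aline A' i)) phi (fun i => line_supp_proper _)
  (fun i => line_supp_proper _) (@line_supp_inj d A) (@line_supp_inj d' A') h1 h2 h3.
exists s; first exact: bs.
by move=> i j k; rewrite !conc_le; exact: hs.
Qed.

Lemma near_pencil_transfer i1 i2 j1 j2 : near_pencil A i1 i2 j1 j2 ->
  same_combinatorics A A' -> d' = d /\ exists i1' i2' j1' j2',
    near_pencil A' i1' i2' j1' j2' /\
    #|[set i | conc A' i1' i2' i]| = #|[set i | conc A i1 i2 i]|.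
Proof.
move=> H /same_combinatorics_lines[s bs hs]; split.
  by have := bij_eq_card bs; rewrite !card_ord.
have s_inj := bij_inj bs; have [t st ts] := bs.
exists (s i1), (s i2), (s j1), (s j2); split; last first.
  rewrite -(card_imset _ s_inj); apply: eq_card => i'.
  by rewrite inE -(ts i') hs mem_imset // inE.
have sE i j : (s i == s j) = (i == j) := inj_eq s_inj i j.
apply: NearPencil.
- rewrite sE; exact: np_i H.
- rewrite sE; exact: np_j H.
- rewrite hs; exact: np_j1 H.
- rewrite hs; exact: np_j2 H.
- move=> j' k'; rewrite -(ts j') -(ts k'); move: (t j') (t k') => j k.
  rewrite !sE !hs => jk h1 h2 h3 h4.
  have [i h5 h6] := np_join H jk h1 h2 h3 h4.
  by exists (s i); rewrite hs; [exact: h5 | exact: h6].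
- move=> i'; rewrite -(ts i') !hs; exact: (np_njoin H).
Qed.
End Transfer.

(** * The three cases and the combinatorial invariance *)

Section Nearly.
Variable R : realType.
Variables (d : nat) (A : arrangement R d).
Implicit Types (p : point R) (L : line R).
Local Notation f := (defpoly A).

Lemma nearly_free_mdr p r : nearly_modular A p -> r = (d - mult A p)%N ->
  is_mdr f r -> nearly_free A.
Proof.
move=> hp er hr; exists r => //; have := tau_nearly_modular hp.
have md : (mult A p <= d)%N by rewrite multP -[X in (_ <= X)%N](card_ord d) max_card.
have d0 : (0 < d)%N by have [h _] := hp; apply: leq_trans md; apply: ltnW.
move: md er; move: (tau A) (mult A p) => t m md -> h.
have {}h : (t + ((d - m) * m + m))%:Z = (d * (d - 1))%:Z by rewrite h.
move: h; rewrite !(PoszD, PoszM) -!subzn //.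
by move=> h; have -> : t%:Z = t%:Z + ((d%:Z - m%:Z) * m%:Z + m%:Z) -
  ((d%:Z - m%:Z) * m%:Z + m%:Z); [ring | rewrite h; ring].
Qed.

Lemma nearly_modular_pres p : nearly_modular A p ->
  (mult A p <= d)%N /\ exists b1 b2 g1 g2 g3 al,
    pencil_pres f (mult A p) (d - mult A p) b1 b2 g1 g2 g3 al.
Proof.
move=> /nearly_modular_pencil[i1 [i2 [j1 [j2 [H ->]]]]]; split.
  exact: near_pencil_le.
exact: near_pencil_pres H.
Qed.

Lemma no_jumping_line (a b : int) :
  (forall L, splitting_type (E_gmodule A) L a b) ->
  forall L, ~ jumping_line (E_gmodule A) L.
Proof.
move=> h L [a' [b' [g]]]; apply.
by have [<- <-] := generic_unique (generic_all h) g.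
Qed.

Lemma jumping_lineE (a b : int) L : generic_splitting_type (E_gmodule A) a b ->
  jumping_line (E_gmodule A) L <-> ~ splitting_type (E_gmodule A) L a b.
Proof.
move=> g; split=> [[a' [b' [g' +]]]|h]; last by exists a, b.
by have [-> ->] := generic_unique g g'.
Qed.

Section Presented.
Variables (m n : nat) (b1 b2 : 'rV[R[i]]_3) (g1 g2 g3 : 'rV[poly3 R]_3) (al : poly3 R).
Hypothesis H : pencil_pres f m n b1 b2 g1 g2 g3 al.
Hypothesis dmn : d = (m + n)%N.
Local Notation P := (mkpoint (pp_P H)).

Lemma jumping_pointE Q : (n < m)%N -> jumping_point A Q <-> Q = P.
Proof.
have E r Q' rho pi : point_sequence f d r Q' rho pi = point_sequence f (m + n) r Q' rho pi
  := congr1 (fun k => point_sequence f k r Q' rho pi) dmn.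
move=> nm; split=> [[r [rho1 [pi [h1 h2 h3 h4]]]]|->].
  by rewrite E in h4; exact: (jumping_point_uniq H nm h1 h2 h3 h4).
have [pi h] := jumping_point_ex H nm; exists n, g3, pi; split.
- exact: mdr_nearly_free H (ltnW nm).
- by apply/ARdegE; split; [exact: pp_hom3 H | exact: pp_der3 H].
- exact: g3_neq0 H.
- rewrite E; exact: h.
Qed.

Lemma jumping_line_on L : (n < m)%N ->
  (jumping_line (E_gmodule A) L <-> on_line P L) /\
  (jumping_line (E_gmodule A) L ->
     splitting_type (E_gmodule A) L (n%:Z - 1) m%:Z).
Proof.
move=> nm; rewrite on_line_Pt.
have g : generic_splitting_type (E_gmodule A) n%:Z (m%:Z - 1).
  have := generic_gtype H 0; rewrite /gtype.
  by rewrite (ltn_eqF (ltn_trans nm (ltnSn m))) (ltn_eqF nm) /= !subr0.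
have [LP|LP] := eqVneq (dot (val L) (cross b1 b2)) 0.
  have := splitting_special H 0 (pp_le H) LP; rewrite !subr0 => s.
  split=> //; split=> // _; apply/(jumping_lineE _ g) => s'.
  have [] := splitting_unique (AR_stable (f:=f) (t:=0)) s s'; lia.
have := splitting_lt H 0 nm LP; rewrite !subr0 => s.
have nj : ~ jumping_line (E_gmodule A) L by move=> /(jumping_lineE _ g).
by split=> // /nj.
Qed.
End Presented.
End Nearly.

(** What is transported is [near_pencil], which mentions only line indices and concurrency. The
    shift by 1 is the twist from $E_{\mathcal{A}}$ to $T\langle\mathcal{A}\rangle$. *)
Lemma generic_T_combinatorics (R : realType) (d d' : nat) (A : arrangement R d)
    (A' : arrangement R d') p : nearly_modular A p -> same_combinatorics A A' ->
  generic_splitting_type (T_gmodule A') ((gtype (mult A p) (d - mult A p)).1 - 1)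
    ((gtype (mult A p) (d - mult A p)).2 - 1).
Proof.
move=> /nearly_modular_pencil[i1 [i2 [j1 [j2 [H em]]]]] sc.
have [ed [i1' [i2' [j1' [j2' [H' em']]]]]] := near_pencil_transfer H sc.
have [b1 [b2 [g1 [g2 [g3 [al hp]]]]]] := near_pencil_pres H'.
move: hp; rewrite em' -em => hp.
have := generic_gtype hp 1; rewrite [in X in gtype _ (X - _)]ed; exact.
Qed.

Theorem corollary5p2 (R : realType) (d : nat) (A : arrangement R d) :
  nearly_supersolvable A ->
  (forall p : point R, nearly_modular A p ->
     let m := mult A p in
     [/\ (2 * m < d)%N ->
           [/\ d = (2 * m).+1,
               free_with_exponents A m m,
               generic_splitting_type (E_gmodule A) m%:Z m%:Z
             & forall L : line R, ~ jumping_line (E_gmodule A) L],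
         (2 * m)%N = d ->
           [/\ nearly_free_with_exponents A m m,
               generic_splitting_type (E_gmodule A) (m%:Z - 1) m%:Z
             & forall L : line R, ~ jumping_line (E_gmodule A) L]
       & (d < 2 * m)%N ->
           let d1 := (d - m)%N in
           let d2 := m in
           [/\ nearly_free_with_exponents A d1 d2,
               generic_splitting_type (E_gmodule A) d1%:Z (d2%:Z - 1)
             & exists P : point R,
                 (forall Q : point R, jumping_point A Q <-> Q = P) /\
                 (forall L : line R,
                    (jumping_line (E_gmodule A) L <-> on_line P L) /\
                    (jumping_line (E_gmodule A) L ->
                       splitting_type (E_gmodule A) L (d1%:Z - 1) d2%:Z))]]) /\
  (exists e : int * int,
     forall (d' : nat) (A' : arrangement R d'), same_combinatorics A A' ->
       forall a b : int,
         generic_splitting_type (T_gmodule A') a b <-> (a, b) = e).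
Proof.
move=> [_ [p0 hp0]]; split; last first.
  exists ((gtype (mult A p0) (d - mult A p0)).1 - 1,
          (gtype (mult A p0) (d - mult A p0)).2 - 1) => d' A' sc a b.
  have g := generic_T_combinatorics hp0 sc.
  split=> [h|[-> ->]]; last exact: g.
  by have [-> ->] := generic_unique h g.
move=> p hp; have [md [b1 [b2 [g1 [g2 [g3 [al H]]]]]]] := nearly_modular_pres hp.
have nf := nearly_free_mdr hp; have le := pp_le H.
move: md H nf le; set m := mult A p => md; set n := (d - m)%N => H nf le /=.
have dmn : d = (m + n)%N by rewrite /n subnKC.
split=> [lt|eq|gt].
(* The bound [n <= m.+1] from [pp_le] leaves this as the only possibility. *)
- have nm : n = m.+1 by lia.
  have s L : splitting_type (E_gmodule A) L m%:Z m%:Z.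
    by have := splitting_free H L 0 nm; rewrite subr0.
  split; first lia.
  + split; [exact: free_basis H nm | exact: mdr_free H nm | lia].
  + exact: generic_all s.
  exact: no_jumping_line s.
- have nm : n = m by lia.
  have s L : splitting_type (E_gmodule A) L (m%:Z - 1) m%:Z.
    by have := splitting_eq H L 0 nm; rewrite !subr0.
  have hm : is_mdr (defpoly A) m.
    by have := mdr_nearly_free H; rewrite nm => /(_ (leqnn m)).
  split.
  + split; [exact: nf (esym nm) hm | exact: hm | lia].
  + exact: generic_all s.
  exact: no_jumping_line s.
have nm : (n < m)%N by lia.
have hm := mdr_nearly_free H (ltnW nm).
split.
- split; [exact: nf erefl hm | exact: hm | lia].
- have := generic_gtype H 0; rewrite /gtype.
  by rewrite (ltn_eqF (ltn_trans nm (ltnSn m))) (ltn_eqF nm) /= !subr0.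
exists (mkpoint (pp_P H)); split=> [Q|L]; first exact: jumping_pointE.
exact: jumping_line_on.
Qed.
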